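(* Let $\mathfrak L=L_{\boldsymbol m}(\mathfrak g,\boldsymbol\sigma,\mathfrak h)$ be a multiloop Lie algebra of nullity $n$. Then $\mathfrak L$ is support-isomorphic to some multiloop Lie $\mathbb Z^n$-torus if and only if $\mathfrak g^{\boldsymbol\sigma}\neq\{0\}$.
   Context: $k$ is an algebraically closed field of characteristic $0$; primitive roots of unity $\zeta_n\in k$ are fixed with $\zeta_{mn}^m=\zeta_n$. Let $\mathfrak g$ be a finite-dimensional simple Lie algebra over $k$, $\boldsymbol\sigma=(\sigma_1,\dots,\sigma_n)$ pairwise commuting finite-order automorphisms of $\mathfrak g$, $\boldsymbol m=(m_1,\dots,m_n)\in\mathbb Z^n_{>0}$ with $\sigma_i^{m_i}=\mathrm{id}$. For $\lambda=(l_1,\dots,l_n)\in\mathbb Z^n$, $\mathfrak g^{\bar\lambda}=\{g:\sigma_i(g)=\zeta_{m_i}^{l_i}g\ \forall i\}$ (depends on $\bar\lambda\in\bar\Lambda_{\boldsymbol m}=\mathbb Z/m_1\mathbb Z\times\dots\times\mathbb Z/m_n\mathbb Z$), $\mathfrak g^{\boldsymbol\sigma}=\mathfrak g^{\bar0}$. If $\mathfrak g^{\boldsymbol\sigma}\ne0$, $\mathfrak h$ is a Cartan subalgebra of the reductive algebra $\mathfrak g^{\boldsymbol\sigma}$, which acts diagonalizably on $\mathfrak g$ with root spaces $\mathfrak g_\alpha$ ($\alpha\in\mathfrak h^*$); $Q_{\mathfrak h}$ is the subgroup of $\mathfrak h^*$ generated by the nonzero weights, $\mathfrak g_\alpha^{\bar\lambda}=\mathfrak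 g_\alpha\cap\mathfrak g^{\bar\lambda}$, and $L_{\boldsymbol m}(\mathfrak g,\boldsymbol\sigma,\mathfrak h)=\bigoplus_{(\alpha,\lambda)\in Q_{\mathfrak h}\times\mathbb Z^n}\mathfrak g_\alpha^{\bar\lambda}\otimes t^\lambda\subseteq\mathfrak g\otimes k[t_1^{\pm1},\dots,t_n^{\pm1}]$, graded by $Q_{\mathfrak h}\times\mathbb Z^n$. If $\mathfrak g^{\boldsymbol\sigma}=0$, $\mathfrak h=0$, $Q_{\mathfrak h}=\{0\}$ and $L_{\boldsymbol m}(\mathfrak g,\boldsymbol\sigma,\mathfrak h)=\bigoplus_\lambda\mathfrak g^{\bar\lambda}\otimes t^\lambda$. $n$ is the nullity. A multiloop Lie $\mathbb Z^n$-torus is a multiloop Lie algebra $L_{\boldsymbol m}(\mathfrak g,\boldsymbol\sigma,\mathfrak h)$ of nullity $n$ satisfying: (A0) $m_i=\mathrm{ord}(\sigma_i)$ for all $i$; (A1) $\mathfrak g^{\boldsymbol\sigma}$ is simple; (A2) for every $\bar\lambda\ne\bar0$ with $\mathfrak g^{\bar\lambda}\ne0$, $\mathfrak g^{\bar\lambda}\cong U\oplus V$ as $\mathfrak g^{\boldsymbol\sigma}$-modules, where $\mathfrak g^{\boldsymbol\sigma}$ acts trivially on $U$ and either $V=0$ or $V$ is irreducible of dimension $>1$ with all $\mathfrak h$-weights in $(\Delta_0)_{\mathrm{en}}\cup\{0\}$, $\Delta_0$ being the root system of $\mathfrak g^{\boldsymbol\sigma}$ relative to $\mathfrak h$; (A3)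 the group generated by $\sigma_1,\dots,\sigma_n$ has order $\prod_i\mathrm{ord}(\sigma_i)$. For an irreducible finite root system $\Delta_0$, $(\Delta_0)_{\mathrm{en}}=\Delta_0\cup\{2\alpha:\alpha\text{ a short root}\}$ if $\Delta_0$ has type $B_l$ ($l\ge1$), and $(\Delta_0)_{\mathrm{en}}=\Delta_0$ otherwise. Support-isomorphism: for an abelian group $\Lambda$ and $\Lambda$-graded algebra $B$, $\langle\mathrm{supp}_\Lambda(B)\rangle$ is the subgroup generated by $\{\lambda:B^\lambda\ne0\}$; a $\Lambda$-graded $B$ and $\Lambda'$-graded $B'$ are support-isomorphic if there exist an algebra isomorphism $\varphi:B\to B'$ and a group isomorphism $\varphi_{\mathrm{su}}:\langle\mathrm{supp}_\Lambda(B)\rangle\to\langle\mathrm{supp}_{\Lambda'}(B')\rangle$ with $\varphi(B^\lambda)=B'^{\varphi_{\mathrm{su}}(\lambda)}$ for all $\lambda\in\langle\mathrm{supp}_\Lambda(B)\rangle$. Here the gradings are by $Q_{\mathfrak h}\times\mathbb Z^n$. *)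

(* Defs.v *)
From mathcomp Require Import all_boot all_order all_algebra.
From Stdlib Require Import ClassicalEpsilon.
Set Implicit Arguments.
Unset Strict Implicit.
Unset Printing Implicit Defensive.
Import Order.TTheory GRing.Theory Num.Theory.
Local Open Scope ring_scope.

Definition zeta_ok (k : fieldType) (zeta : nat -> k) : Prop :=
  (forall N, (0 < N)%N -> N.-primitive_root (zeta N)) /\
  (forall M N, (0 < M)%N -> (0 < N)%N -> zeta (M * N)%N ^+ M = zeta N).

Definition is_order (T : Type) (f : T -> T) (d : nat) : Prop :=
  (0 < d)%N /\ (forall x, iter d f x = x) /\
  (forall e, (0 < e < d)%N -> exists x, iter e f x <> x).

Section LieDefs.
Variables (k : fieldType) (g : vectType k) (br : g -> g -> g).

Definition is_lie : Prop :=
  (forall a x y z, br (a *: x + y) z = a *: br x z + br y z) /\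
  (forall a x y z, br z (a *: x + y) = a *: br z x + br z y) /\
  (forall x, br x x = 0) /\
  (forall x y z, br x (br y z) + br y (br z x) + br z (br x y) = 0).

Definition simple_in (S : {vspace g}) : Prop :=
  (forall x y, x \in S -> y \in S -> br x y \in S) /\
  (exists x y, [/\ x \in S, y \in S & br x y != 0]) /\
  (forall I : {vspace g}, (I <= S)%VS ->
     (forall x y, x \in S -> y \in I -> br x y \in I) ->
     I = 0%VS \/ I = S).

Definition nilpotent_sub (h : {vspace g}) : Prop :=
  exists N : nat, forall (xs : seq g) (y : g), size xs = N ->
    (forall x, x \in xs -> x \in h) -> y \in h -> foldr br y xs = 0.

Definition cartan_sub (S h : {vspace g}) : Prop :=
  [/\ (h <= S)%VS,
      (forall x y, x \in h -> y \in h -> br x y \in h),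
      nilpotent_sub h &
      (forall x, x \in S -> (forall y, y \in h -> br x y \in h) -> x \in h)].

Definition is_lie_aut (f : 'End(g)) : Prop :=
  lker f = 0%VS /\ (forall x y, f (br x y) = br (f x) (f y)).

Variables (n : nat) (sigma : 'I_n -> 'End(g)) (m : 'I_n -> nat).

Definition gsig : {vspace g} := (\bigcap_(i < n) fixedSpace (sigma i))%VS.

Definition geig (zeta : nat -> k) (lam : 'rV[int]_n) : {vspace g} :=
  (\bigcap_(i < n) passmx.leigenspace (sigma i) (zeta (m i) ^ (lam ord0 i)))%VS.

(* The standing hypotheses of a multiloop Lie algebra L_m(g, sigma, h):
   g finite-dimensional simple, sigma_i pairwise commuting automorphisms with
   sigma_i^{m_i} = id, m_i > 0, and h a Cartan subalgebra of g^sigma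
   (which forces h = 0 when g^sigma = 0). *)
Definition multiloop_data (h : {vspace g}) : Prop :=
  is_lie /\ simple_in fullv /\
  (forall i, is_lie_aut (sigma i)) /\
  (forall i j x, sigma i (sigma j x) = sigma j (sigma i x)) /\
  (forall i, (0 < m i)%N /\ forall x, iter (m i) (sigma i) x = x) /\
  cartan_sub gsig h.

Variable h : {vspace g}.

Definition hdual := 'Hom(subvs_of h, k^o).

Definition wvec (alpha : hdual) (x : g) : Prop :=
  forall y : subvs_of h, br (vsval y) x = (alpha y : k) *: x.

Definition kill (x y : g) : k :=
  \sum_(i < \dim gsig)
     coord (vbasis gsig) i (br x (br y (tnth (vbasis gsig) i))).

Definition tvec (alpha : hdual) : g :=
  epsilon (inhabits 0)
    (fun t => t \in h /\ forall y : subvs_of h, kill (vsval y) t = alpha y).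
Definition dform (alpha beta : hdual) : k := kill (tvec alpha) (tvec beta).

Definition is_root0 (alpha : hdual) : Prop :=
  alpha != 0 /\ exists x, [/\ x != 0, x \in gsig & wvec alpha x].

Definition is_base (l : nat) (Pi : 'I_l -> hdual) : Prop :=
  (forall i, is_root0 (Pi i)) /\ free [seq Pi i | i <- enum 'I_l] /\
  (forall alpha, is_root0 alpha -> exists c : 'I_l -> nat,
     alpha = \sum_(i < l) Pi i *+ c i \/ alpha = - \sum_(i < l) Pi i *+ c i).

(* Cartan matrix of type B_l (Bourbaki numbering, last simple root short),
   entry (i,j) = <alpha_i, alpha_j^vee> = 2(alpha_i,alpha_j)/(alpha_j,alpha_j). *)
Definition BCartan (l : nat) (i j : 'I_l) : int :=
  if i == j then 2
  else if ((i.+1 == j) && (j == l.-1 :> nat))%N then -2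
  else if ((i.+1 == j) || (j.+1 == i))%N then -1
  else 0.

(* Delta_0 has type B_l for some l >= 1 (B_1 = A_1). *)
Definition typeB : Prop :=
  exists l : nat, (0 < l)%N /\ exists Pi : 'I_l -> hdual,
    is_base Pi /\ forall i j,
      2%:R * dform (Pi i) (Pi j) = (BCartan i j)%:~R * dform (Pi j) (Pi j).

(* alpha is a short root: a root of minimal length, i.e.
   (beta,beta) = r (alpha,alpha) with r rational >= 1 for every root beta. *)
Definition short_root (alpha : hdual) : Prop :=
  is_root0 alpha /\ forall beta, is_root0 beta ->
    exists p q : nat, (0 < q <= p)%N /\
      q%:R * dform beta beta = p%:R * dform alpha alpha.

Definition in_en (alpha : hdual) : Prop :=
  is_root0 alpha \/ (typeB /\ exists beta, short_root beta /\ alpha = beta *+ 2).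

Definition submod (V : {vspace g}) : Prop :=
  forall x v, x \in gsig -> v \in V -> br x v \in V.

Definition lie_torus (zeta : nat -> k) : Prop :=
  [/\ (* A0 *) (forall i, is_order (sigma i) (m i)),
      (* A1 *) simple_in gsig,
      (forall lam : 'rV[int]_n,
         (exists i, ~~ ((m i)%:Z %| lam ord0 i)%Z) -> geig zeta lam != 0%VS ->
         exists U V : {vspace g},
           [/\ (U + V)%VS = geig zeta lam, (U :&: V)%VS = 0%VS,
               (forall x u, x \in gsig -> u \in U -> br x u = 0),
               submod V &
               (V = 0%VS \/
                [/\ (1 < \dim V)%N,
                    (forall W : {vspace g}, (W <= V)%VS -> submod W ->
                       W = 0%VS \/ W = V) &
                    (forall alpha v, v \in V -> v != 0 -> wvec alpha v ->
                       alpha = 0 \/ in_en alpha)])]) &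
      (* A3: the group generated by the sigma_i has order prod_i ord(sigma_i) *)
      (exists E : seq 'End(g),
         [/\ uniq E, size E = (\prod_(i < n) m i)%N &
             forall f, f \in E <->
               exists s : seq 'I_n,
                 f = foldr (fun i acc => (sigma i \o acc)%VF) \1%VF s])].

(* ---- the multiloop algebra inside g (x) k[t_1^{+-1},...,t_n^{+-1}] ----
   An element of g (x) k[t^{+-1}] is a finitely supported function
   u : Z^n -> g (u lam is the coefficient of t^lam). *)
Definition fin_supp (u : 'rV[int]_n -> g) : Prop :=
  exists s : seq 'rV[int]_n, forall lam, u lam != 0 -> lam \in s.

(* L_m(g,sigma,h) = sum over (alpha,lam) of g_alpha^{lam bar} (x) t^lam *)
Definition in_loop (zeta : nat -> k) (u : 'rV[int]_n -> g) : Prop :=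
  fin_supp u /\ forall lam, exists ps : seq (hdual * g),
    (forall p, p \in ps -> p.2 \in geig zeta lam /\ wvec p.1 p.2) /\
    u lam = \sum_(p <- ps) p.2.

(* The homogeneous component of degree (alpha, lam) in Q_h x Z^n (we index by
   h^* x Z^n; the component is 0 unless alpha lies in Q_h). *)
Definition loop_comp (zeta : nat -> k) (d : hdual * 'rV[int]_n)
    (u : 'rV[int]_n -> g) : Prop :=
  [/\ forall mu, mu != d.2 -> u mu = 0, u d.2 \in geig zeta d.2 & wvec d.1 (u d.2)].

Definition loop_supp (zeta : nat -> k) (d : hdual * 'rV[int]_n) : Prop :=
  exists u, loop_comp zeta d u /\ exists mu, u mu != 0.

End LieDefs.

Arguments lie_torus {k g} br {n} sigma m h zeta.
Arguments in_loop {k g} br {n} sigma m h zeta u.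
Arguments loop_comp {k g} br {n} sigma m h zeta d u.
Arguments loop_supp {k g} br {n} sigma m h zeta d.

Definition supp_seq (k : fieldType) (g : vectType k) (n : nat)
    (u : 'rV[int]_n -> g) : seq 'rV[int]_n :=
  epsilon (inhabits [::]) (fun s => forall lam, u lam != 0 -> lam \in s).

(* The Lie bracket of g (x) k[t^{+-1}]: [x t^a, y t^b] = [x,y] t^(a+b). *)
Definition loop_br (k : fieldType) (g : vectType k) (br : g -> g -> g) (n : nat)
    (u v : 'rV[int]_n -> g) : 'rV[int]_n -> g :=
  fun mu => \sum_(lam <- undup (supp_seq u)) br (u lam) (v (mu - lam)).

Definition in_gen (G : zmodType) (S : G -> Prop) (x : G) : Prop :=
  exists (s : seq G) (c : seq int),
    (forall y, List.In y s -> S y) /\ x = \sum_(i < size s) s`_i *~ c`_i.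

Definition support_iso (k : fieldType) (zeta : nat -> k) (n : nat)
    (g : vectType k) (br : g -> g -> g) (sigma : 'I_n -> 'End(g))
    (m : 'I_n -> nat) (h : {vspace g})
    (g' : vectType k) (br' : g' -> g' -> g') (sigma' : 'I_n -> 'End(g'))
    (m' : 'I_n -> nat) (h' : {vspace g'}) : Prop :=
  let L := in_loop br sigma m h zeta in
  let L' := in_loop br' sigma' m' h' zeta in
  let G := in_gen (loop_supp br sigma m h zeta) in
  let G' := in_gen (loop_supp br' sigma' m' h' zeta) in
  exists (phi : ('rV[int]_n -> g) -> ('rV[int]_n -> g'))
         (psi : (hdual h * 'rV[int]_n)%type -> (hdual h' * 'rV[int]_n)%type),
    [/\ (forall u, L u -> L' (phi u)),
        (forall a u v, L u -> L v ->
           phi (fun mu => a *: u mu + v mu) = (fun mu => a *: phi u mu + phi v mu)),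
        (forall u v, L u -> L v -> phi u = phi v -> u = v),
        (forall w, L' w -> exists u, L u /\ phi u = w) &
        (forall u v, L u -> L v ->
           phi (loop_br br u v) = loop_br br' (phi u) (phi v))] /\
    [/\ (forall d, G d -> G' (psi d)),
        (forall d e, G d -> G e -> psi (d + e) = psi d + psi e),
        (forall d e, G d -> G e -> psi d = psi e -> d = e),
        (forall d', G' d' -> exists d, G d /\ psi d = d') &
        (forall d, G d ->
           (forall u, loop_comp br sigma m h zeta d u ->
              loop_comp br' sigma' m' h' zeta (psi d) (phi u)) /\
           (forall w, loop_comp br' sigma' m' h' zeta (psi d) w ->
              exists u, loop_comp br sigma m h zeta d u /\ phi u = w))].

(* Main.v *)
(* Over h the simple algebra g has a (possibly non-reduced) irreducible root system Phi,
   with rational values on coroots, and root spaces graded by Z^n/m.  Choose a base p of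
   Phi, degrees s_i in which the simple root spaces g_(p i) are nonzero, and shift degrees
   by the additive map a |-> s(a) with s(p i) = s_i.  After the shift the simple root
   vectors have degree 0; since the reflections move a base onto all indivisible roots,
   every indivisible root space meets degree 0, so that degree 0 is simple, and sl2-theory
   makes every other homogeneous part a sum of invariants and an irreducible module.  The
   shifted degrees that occur, together with m_1 Z + ... + m_n Z, span a lattice; a basis
   adapted to that sublattice, with elementary divisors d_i, defines automorphisms of
   orders d_i which generate a group of order d_1 ... d_n and whose multiloop algebra is
   the regraded one.  Conversely, the (0,0)-component of a torus contains a nonzero central
   element of h', and a support-isomorphism carries it back into g^sigma. *)
Require Import Defs.
From HB Require Import structures.
From mathcomp Require Import all_boot all_order all_algebra.
From mathcomp Require Import ring lra zify.
From Stdlib Require Import ClassicalEpsilon FunctionalExtensionality.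
Set Implicit Arguments.
Unset Strict Implicit.
Unset Printing Implicit Defensive.
Import Order.TTheory GRing.Theory Num.Theory.
Local Open Scope ring_scope.

(** * Linear algebra *)

(** The obstacle is that [h] is a Cartan subalgebra of the fixed algebra only: its weight spaces on
    [g] can be large, and [h] is given merely as nilpotent and self-normalizing. Refining weights by
    degree restores the classical picture: [h] turns out abelian and diagonalisable on [g], and a
    nonzero weight space is a line in each degree ([gr_dim]), so that sl2-strings behave as for an
    ordinary Cartan subalgebra. The same fact keeps doubled roots 2a out of degree 0 after the
    shift: lowering such a vector would land on the line of the degree-0 vector of weight a. Doubled
    roots thus live in nonzero degrees only, and they are what the enlargement of type B absorbs.
    Positivity comes from a trace form: a weight is recorded by its pairings with all basis weights,
    and the Killing form becomes the standard dot product on rational vectors. The shifted degrees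
    may span another lattice than the old ones, so the new automorphisms are built from a new basis
    of degrees. Including the m_i Z in that lattice keeps its rank equal to n and makes the
    regrading bijective. *)

Section Subspaces.
Variables (k : fieldType) (V : vectType k).

(** A subspace inside [P] that misses some vector of [P] can be enlarged by it, which happens at
    most dim V times. This turns any classically stated linear condition into a [{vspace V}];
    centralizers, eigenspaces and radicals below are obtained in this way. *)
Lemma ex_vspace (P : V -> Prop) :
  P 0 -> (forall a x y, P x -> P y -> P (a *: x + y)) ->
  exists U : {vspace V}, forall v, v \in U <-> P v.
Proof.
move=> P0 PD.
have step d : (exists U : {vspace V}, forall v, v \in U <-> P v) \/
    exists2 U : {vspace V}, (d <= \dim U)%N & forall v, v \in U -> P v.
  elim: d => [|d [|[U dU PU]]]; [|by left|].
    by right; exists 0%VS => // v; rewrite memv0 => /eqP->.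
  case: (classic (forall v, P v -> v \in U)) => [UP|nUP].
    by left; exists U => v; split=> [/PU|/UP].
  have [v nv] := not_all_ex_not _ _ nUP; have [Pv /negP vU] := imply_to_and _ _ nv.
  right.
  exists (U + <[v]>)%VS.
    apply: (leq_ltn_trans dU); rewrite ltn_neqAle dimvS ?addvSl // andbT.
    apply: contra vU => /eqP dE.
    have /eqP-> : U == (U + <[v]>)%VS by rewrite eqEdim addvSl dE /=.
    by rewrite memvE addvSr.
  move=> w /memv_addP[u uU [v' /vlineP[a ->] ->]].
  by rewrite addrC; apply: PD => //; apply: PU.
case: (step (\dim {:V}).+1) => [//|[U dU _]].
by move: (leq_trans dU (dimvS (subvf U))); rewrite ltnn.
Qed.

Lemma ex_free_sub (X : seq V) :
  exists Y : seq V, [/\ {subset Y <= X}, free Y & <<Y>>%VS = <<X>>%VS].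
Proof.
elim: X => [|x X [Y [YX fY sY]]]; first by exists [::]; split=> //; exact: nil_free.
case: (boolP (x \in <<Y>>%VS)) => [xY|xY].
  exists Y; split=> //; first by move=> y /YX; rewrite inE orbC => ->.
  by rewrite span_cons -sY; apply/esym/addv_idPr; rewrite -memvE.
exists (x :: Y); split; last by rewrite !span_cons sY.
  by move=> y; rewrite !inE => /orP[->//|/YX->]; rewrite orbT.
by rewrite free_cons xY.
Qed.

Definition sum_of (P : V -> Prop) (v : V) : Prop :=
  exists2 s : seq V, (forall x, x \in s -> P x) & v = \sum_(x <- s) x.

Lemma ex_basis (P : V -> Prop) :
  (forall v, sum_of P v) ->
  exists b : (\dim {:V}).-tuple V, basis_of fullv b /\ forall i, P (tnth b i).
Proof.
move=> Psum.
have [X XP XS] : exists2 X : seq V, (forall x, x \in X -> P x) &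
    forall v, v \in (vbasis {:V} : seq V) -> v \in <<X>>%VS.
  elim: (vbasis {:V} : seq V) => [|v s [X XP XS]]; first by exists [::].
  have [t tP vE] := Psum v; exists (t ++ X).
    by move=> x; rewrite mem_cat => /orP[/tP|/XP].
  move=> w; rewrite inE => /orP[/eqP->|/XS wX]; rewrite span_cat.
    rewrite -[v]addr0 memv_add ?mem0v // vE big_seq memv_suml // => x xt.
    exact: memv_span.
  by rewrite -[w]add0r memv_add ?mem0v.
have [Y [YX fY sY]] := ex_free_sub X.
have XT : <<X>>%VS = fullv.
  apply/eqP; rewrite eqEsubv subvf /= -{1}(span_basis (vbasisP {:V})).
  exact/span_subvP.
have bY : basis_of fullv Y by rewrite /basis_of sY XT eqxx.
have sz : size Y == \dim {:V} by rewrite (size_basis (X := in_tuple Y) bY).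
by exists (Tuple sz); split=> // i; apply/XP/YX; rewrite (mem_tnth i (Tuple sz)).
Qed.

Lemma basis_coordE d (b : d.-tuple V) v : basis_of fullv b ->
  v = \sum_(i < d) coord b i v *: tnth b i.
Proof.
move=> bb; rewrite {1}(coord_basis bb (memvf v)).
by apply: eq_bigr => i _; rewrite (tnth_nth 0).
Qed.

Lemma coord_basisE d (b : d.-tuple V) (c : 'I_d -> k) i : free b ->
  coord b i (\sum_j c j *: tnth b j) = c i.
Proof.
by move=> fb; under eq_bigr => j _ do rewrite (tnth_nth 0); rewrite coord_sum_free.
Qed.

End Subspaces.

(** * Traces on invariant subspaces *)

Section Trace.
Variables (k : fieldType) (V : vectType k).
Implicit Types (U W : {vspace V}) (f h : 'End(V)).

(** The trace of the restriction of [f] to [U]. It has this meaning only when [U] is [f]-stable,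
    since [coord] is arbitrary on vectors outside [U]. *)
Definition trU U f : k := \sum_(i < \dim U) coord (vbasis U) i (f (tnth (vbasis U) i)).

(** Both sides expand to the same double sum of products of matrix entries of [f : U -> W] and
    [h : W -> U]. An identity map gives independence of the basis, U = W gives tr(fh) = tr(hf), and
    an inclusion compares traces on U and on f(U). *)
Lemma tr_cyc p q (X : p.-tuple V) (Y : q.-tuple V) U W (f h : 'End(V)) :
  basis_of U X -> basis_of W Y ->
  (forall v, v \in U -> f v \in W) -> (forall v, v \in W -> h v \in U) ->
  \sum_(i < p) coord X i (h (f (tnth X i))) =
  \sum_(j < q) coord Y j (f (h (tnth Y j))).
Proof.
move=> bX bY fUW hWU.
transitivity (\sum_(i < p) \sum_(j < q) coord Y j (f X`_i) * coord X i (h Y`_j)).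
  apply: eq_bigr => i _; rewrite (tnth_nth 0).
  have fX : f X`_i \in W by apply/fUW/(basis_mem bX); rewrite mem_nth ?size_tuple.
  rewrite {1}(coord_basis bY fX) !linear_sum.
  by apply: eq_bigr => j _; rewrite !linearZ.
rewrite exchange_big; apply: eq_bigr => j _; rewrite (tnth_nth 0).
have hY : h Y`_j \in U by apply/hWU/(basis_mem bY); rewrite mem_nth ?size_tuple.
rewrite {2}(coord_basis bX hY) !linear_sum.
by apply: eq_bigr => i _; rewrite !linearZ /= mulrC.
Qed.

Lemma trU_basis p (X : p.-tuple V) U f : basis_of U X ->
  (forall v, v \in U -> f v \in U) -> trU U f = \sum_(i < p) coord X i (f (tnth X i)).
Proof.
move=> bX fU; rewrite /trU.
have idU v : v \in U -> (\1%VF : 'End(V)) v \in U by rewrite id_lfunE.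
have H := tr_cyc (vbasisP U) bX fU idU.
transitivity (\sum_(i < \dim U) coord (vbasis U) i (\1%VF (f (tnth (vbasis U) i)))).
  by apply: eq_bigr => i _; rewrite id_lfunE.
rewrite H.
by apply: eq_bigr => i _; rewrite id_lfunE.
Qed.

Lemma trU_mulC U f h : (forall v, v \in U -> f v \in U) ->
  (forall v, v \in U -> h v \in U) -> trU U (f \o h)%VF = trU U (h \o f)%VF.
Proof.
move=> fU hU; rewrite /trU.
transitivity (\sum_(i < \dim U) coord (vbasis U) i (f (h (tnth (vbasis U) i)))).
  by apply: eq_bigr => i _; rewrite comp_lfunE.
rewrite (tr_cyc (f := h) (h := f) (vbasisP U) (vbasisP U) hU fU).
by apply: eq_bigr => i _; rewrite comp_lfunE.
Qed.

Lemma trUD U f h : trU U (f + h) = trU U f + trU U h.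
Proof. by rewrite -big_split; apply: eq_bigr => i _; rewrite add_lfunE linearD. Qed.

Lemma trUZ U a f : trU U (a *: f) = a * trU U f.
Proof. by rewrite mulr_sumr; apply: eq_bigr => i _; rewrite scale_lfunE linearZ. Qed.

Lemma trUN U f : trU U (- f) = - trU U f.
Proof. by rewrite -scaleN1r trUZ mulN1r. Qed.

Lemma trU_eq U f h : (forall v, v \in U -> f v = h v) -> trU U f = trU U h.
Proof. by move=> fh; apply: eq_bigr => i _; rewrite fh // vbasis_mem ?mem_tnth. Qed.

Lemma trU_scal U f c : (forall v, v \in U -> f v = c *: v) -> trU U f = c * (\dim U)%:R.
Proof.
move=> fc; rewrite /trU (eq_bigr (fun => c)) => [|i _].
  by rewrite sumr_const card_ord mulr_natr.
rewrite fc ?vbasis_mem ?mem_tnth // linearZ /= (tnth_nth 0).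
by rewrite coord_free ?(basis_free (vbasisP _)) // eqxx mulr1.
Qed.

(** A map injective on a nonzero [U] is not nilpotent there, so f(U) is smaller than [U]. Viewing
    [f] as a map U -> f(U) followed by the inclusion, [tr_cyc] replaces [U] by f(U). *)
Lemma trU_nilp U f : (forall v, v \in U -> f v \in U) ->
  (forall v, v \in U -> exists N, iter N f v = 0) -> trU U f = 0.
Proof.
have [d] := ubnP (\dim U); elim: d U => // d IH U dU fU fN.
have [U0|Un0] := eqVneq U 0%VS.
  rewrite (trU_scal (c := 0)) ?mul0r // => v.
  by rewrite U0 memv0 => /eqP->; rewrite linear0 scaler0.
have sU : (f @: U <= U)%VS.
  by apply/subvP=> _ /memv_imgP[v vU ->]; apply: fU.
have ltU : (\dim (f @: U) < \dim U)%N.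
  rewrite ltn_neqAle dimvS // andbT; apply/negP=> /eqP dE.
  have ker0 : \dim (U :&: lker f) = 0%N.
    by apply/eqP; rewrite -(eqn_add2r (\dim (f @: U))) limg_ker_dim dE.
  have inj v : v \in U -> f v = 0 -> v = 0.
    move=> vU fv; apply/eqP; rewrite -memv0.
    move/eqP: ker0; rewrite dimv_eq0 => /eqP <-.
    by rewrite memv_cap vU memv_ker fv eqxx.
  have [N] := fN _ (memv_pick U).
  suff H n v : v \in U -> iter n f v = 0 -> v = 0.
    by move=> /(H _ _ (memv_pick U)) /eqP; rewrite vpick0 (negPf Un0).
  elim: n v => // n IHn v vU; rewrite iterSr => /(IHn _ (fU _ vU)).
  exact: inj.
have fI v : v \in (f @: U)%VS -> f v \in (f @: U)%VS.
  by move=> vI; apply/memv_img/(subvP sU).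
rewrite -(IH (f @: U)%VS) //; last first.
- by move=> v /(subvP sU)/fN.
- exact: leq_trans ltU _.
rewrite /trU.
have := tr_cyc (f := f) (h := \1%VF) (vbasisP U) (vbasisP (f @: U)%VS) _ _.
rewrite (eq_bigr (fun i => coord (vbasis U) i (f (tnth (vbasis U) i)))) => [->|i _].
- by apply: eq_bigr => i _; rewrite id_lfunE.
- by move=> v; apply: memv_img.
- by move=> v; rewrite id_lfunE => /(subvP sU).
by rewrite id_lfunE.
Qed.

End Trace.

(** * Generalised eigenspaces and diagonalisable operators *)

Section Eigen.
Variables (k : fieldType) (V : vectType k).
Implicit Types (f h : 'End(V)) (U : {vspace V}).

Definition shift f c : 'End(V) := f - c *: \1%VF.

Lemma shiftE f c v : shift f c v = f v - c *: v.
Proof. by rewrite /shift add_lfunE opp_lfunE scale_lfunE id_lfunE. Qed.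

Definition gev f c (v : V) : Prop := exists N, iter N (shift f c) v = 0.

Lemma iter_lin f n a v w : iter n f (a *: v + w) = a *: iter n f v + iter n f w.
Proof. by elim: n => //= n ->; rewrite linearP. Qed.

Lemma iter_lin0 f n : iter n f 0 = 0 :> V.
Proof. by elim: n => //= n ->; rewrite linear0. Qed.

Lemma iter_lin_sum f n (I : Type) (r : seq I) (F : I -> V) :
  iter n f (\sum_(i <- r) F i) = \sum_(i <- r) iter n f (F i).
Proof.
elim: r => [|i r IH]; first by rewrite !big_nil iter_lin0.
by rewrite !big_cons -IH -[F i in LHS]scale1r iter_lin scale1r.
Qed.

Lemma iter_comm (T : Type) (f h : T -> T) n v : (forall v, f (h v) = h (f v)) ->
  iter n f (h v) = h (iter n f v).
Proof. by move=> fh; elim: n => //= n ->. Qed.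

Lemma shift_stable U f c : (forall v, v \in U -> f v \in U) ->
  forall v, v \in U -> shift f c v \in U.
Proof. by move=> fU v vU; rewrite shiftE memvB ?memvZ ?fU. Qed.

Lemma gev0 f c : gev f c 0.
Proof. by exists 0%N. Qed.

Lemma gev_lin f c a v w : gev f c v -> gev f c w -> gev f c (a *: v + w).
Proof.
move=> [N vN] [M wM]; exists (M + N)%N.
by rewrite iter_lin [in X in X + _]iterD vN addnC iterD wM !iter_lin0 scaler0 addr0.
Qed.

Lemma gevB f c v w : gev f c v -> gev f c w -> gev f c (v - w).
Proof. by move=> gv gw; rewrite addrC -scaleN1r; apply: gev_lin. Qed.

Lemma gevZ f c a v : gev f c v -> gev f c (a *: v).
Proof. by move=> gv; rewrite -[_ *: _]addr0; apply: gev_lin => //; apply: gev0. Qed.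

Lemma gev_sum f c (I : Type) (r : seq I) (P : pred I) (F : I -> V) :
  (forall i, P i -> gev f c (F i)) -> gev f c (\sum_(i <- r | P i) F i).
Proof.
move=> gF; elim/big_rec: _ => [|i x Pi gx]; first exact: gev0.
by rewrite -[F i]scale1r; apply: gev_lin; first exact: gF.
Qed.

Lemma gev_eig f c v : f v = c *: v -> gev f c v.
Proof. by move=> fv; exists 1%N; rewrite /= shiftE fv subrr. Qed.

Lemma shift_comm f c d v : shift f c (shift f d v) = shift f d (shift f c v).
Proof.
rewrite !shiftE ![f (_ - _)]linearB /= ![f (_ *: _)]linearZ /= !scalerBr !scalerA [d * c]mulrC !opprB -!addrA.
by congr (_ + _); rewrite addrC [RHS]addrC addrAC.
Qed.

Lemma gev_shift f c d v : gev f c v -> gev f c (shift f d v).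
Proof.
move=> [N vN]; exists N; rewrite iter_comm ?vN ?linear0 // => w.
exact: shift_comm.
Qed.

Lemma gev_comm f h c v : (forall v, f (h v) = h (f v)) -> gev f c v -> gev f c (h v).
Proof.
move=> fh [N vN]; exists N; rewrite iter_comm ?vN ?linear0 // => w.
by rewrite !shiftE fh [h (_ - _)]linearB /= [h (_ *: _)]linearZ.
Qed.

Lemma gev_inj f c d v : c != d -> gev f c v -> f v = d *: v -> v = 0.
Proof.
move=> cd [N vN] fv.
have H n : iter n (shift f c) v = (d - c) ^+ n *: v.
  elim: n => [|n IH]; first by rewrite scale1r.
  by rewrite iterS IH linearZ /= shiftE fv -scalerBl scalerA -exprSr.
move: vN; rewrite H => /eqP; rewrite scaler_eq0 expf_eq0 subr_eq0 eq_sym (negPf cd).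
by rewrite andbF => /eqP.
Qed.

Lemma gev_uniq f c d v : c != d -> gev f c v -> gev f d v -> v = 0.
Proof.
move=> cd gc [N]; elim: N v gc => // N IH v gc.
rewrite iterSr => vN.
have /IH-/(_ vN) : gev f c (shift f d v) by apply: gev_shift.
rewrite shiftE => /eqP; rewrite subr_eq0 => /eqP; exact: gev_inj gc.
Qed.

(** A power of f - r kills the component at r and preserves the other generalised eigenspaces. By
    induction it kills every other component too, so each of these lies in two generalised
    eigenspaces and vanishes. *)
Lemma gev_indep f (rs : seq k) (w : k -> V) : uniq rs ->
  (forall r, r \in rs -> gev f r (w r)) -> \sum_(r <- rs) w r = 0 ->
  forall r, r \in rs -> w r = 0.
Proof.
elim: rs w => // r rs IH w /= /andP[rrs urs] gw.
rewrite big_cons => sw.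
have [N wN] : gev f r (w r) by apply: gw; rewrite mem_head.
have w0 s : s \in rs -> w s = 0.
  move=> srs; apply: (@gev_uniq f s r).
  - by apply: contraNneq rrs => <-.
  - by apply: gw; rewrite inE srs orbT.
  exists N; apply: (IH (fun s => iter N (shift f r) (w s))) => //.
    move=> s' s'rs; have [M wM] : gev f s' (w s') by apply: gw; rewrite inE s'rs orbT.
    exists M; rewrite iter_comm ?wM ?iter_lin0 // => v.
    by rewrite iter_comm // => u; apply: shift_comm.
  have : iter N (shift f r) (w r + \sum_(j <- rs) w j) = 0 by rewrite sw iter_lin0.
  rewrite -[w r]scale1r iter_lin wN scaler0 add0r => sN.
  by rewrite -iter_lin_sum.
move=> s; rewrite inE => /orP[/eqP->|/w0//].
by move: sw; rewrite big_seq big1 ?addr0 // => i /w0.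
Qed.

(** f - r is invertible on the generalised s-eigenspace: if (f - r)x = (f - s)u, then (f - r)(u - x)
    = (s - r)u, and such an x exists by induction because (f - s)u is killed by a lower power of f -
    s. *)
Lemma gev_solve f r s u U : s != r -> gev f s u -> (forall v, v \in U -> f v \in U) ->
  u \in U -> exists x, [/\ gev f s x, x \in U & shift f r x = u].
Proof.
move=> sr [N uN] fU uU; elim: N u uU uN => [|N IH] u uU.
  by move=> /= ->; exists 0; split; [exact: gev0 | exact: mem0v | exact: linear0].
rewrite iterSr => uN.
have [x [gx xU xE]] := IH _ (shift_stable s fU uU) uN.
have gu : gev f s u by exists N.+1; rewrite iterSr.
have nz : s - r != 0 by rewrite subr_eq0.
exists ((s - r)^-1 *: (u - x)); split.
- by apply/gevZ/gevB.
- by rewrite memvZ ?memvB.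
rewrite linearZ linearB /= xE !shiftE opprB [_ - _ *: u + _]addrC addrA addrNK.
by rewrite -scalerBl scalerA mulVf ?scale1r.
Qed.

Lemma foldr_shiftC f v r (rs : seq k) :
  foldr (fun r w => shift f r w) v (r :: rs) = foldr (fun r w => shift f r w) (shift f r v) rs.
Proof. by elim: rs => //= s rs IH; rewrite -IH /= shift_comm. Qed.

(** Split (f - r)v by induction and lift each component with s <> r through f - r by [gev_solve].
    What remains of v is sent by f - r into the generalised r-eigenspace, hence lies in it. *)
Lemma gev_split f U (rs : seq k) v : (forall v, v \in U -> f v \in U) -> v \in U ->
  foldr (fun r w => shift f r w) v rs = 0 ->
  exists w : k -> V, (forall r, gev f r (w r) /\ w r \in U) /\
    v = \sum_(r <- undup rs) w r.
Proof.
move=> fU; elim: rs v => [|r rs IH] v vU.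
  by move=> /= ->; exists (fun=> 0); rewrite big_nil; split=> // r; split; [exact: gev0|exact: mem0v].
rewrite foldr_shiftC => /(IH _ (shift_stable r fU vU))[w [gw wE]].
have solve s : exists x, [/\ gev f s x, x \in U & s != r -> shift f r x = w s].
  have [->|sr] := eqVneq s r.
    by exists 0; split; [exact: gev0|exact: mem0v|].
  by have [x [gx xU xE]] := gev_solve sr (gw s).1 fU (gw s).2; exists x.
pose x s := projT1 (constructive_indefinite_description _ (solve s)).
have xP s : [/\ gev f s (x s), x s \in U & s != r -> shift f r (x s) = w s].
  exact: projT2 (constructive_indefinite_description _ (solve s)).
pose v0 := v - \sum_(s <- undup rs | s != r) x s.
have gv0 : gev f r v0.
  suff [N vN] : gev f r (shift f r v0) by exists N.+1; rewrite iterSr.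
  rewrite /v0 linearB /= wE linear_sum /=.
  rewrite [X in _ - X](eq_bigr w) => [|s sr]; last by have [_ _ ->] := xP s.
  rewrite (bigID (fun s => s == r)) /= addrK; apply: gev_sum => s /eqP->.
  by case: (gw r).
have v0U : v0 \in U.
  by rewrite memvB // memv_suml // => s _; case: (xP s).
exists (fun s => if s == r then v0 else x s); split.
  by move=> s; case: eqP => [->//|_]; case: (xP s).
have vE : v = v0 + \sum_(s <- undup rs | s != r) x s by rewrite subrK.
rewrite {1}vE /=; case: ifP => rrs.
  rewrite [RHS](bigD1_seq r) ?undup_uniq ?mem_undup //= eqxx; congr (_ + _).
  by apply: eq_bigr => s /negPf->.
rewrite big_cons eqxx; congr (_ + _); rewrite big_seq_cond [RHS]big_seq.
apply: congr_big => // s; last by case/andP=> _ /negPf->.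
case: (boolP (s \in undup rs)) => //=; rewrite mem_undup => srs.
by apply: contraFneq rrs => <-.
Qed.

End Eigen.

Section AlgClosed.
Variables (k : closedFieldType) (V : vectType k).
Implicit Types (f h : 'End(V)) (U : {vspace V}).

(** The first dim V + 1 iterates of [f] on [v] are dependent, so a nonzero polynomial in [f] kills
    [v]; it splits into linear factors over [k]. *)
Lemma foldr_shift_ex f v : exists rs : seq k, foldr (fun r w => shift f r w) v rs = 0.
Proof.
(* Evaluation of p(f) on w with a fixed number [n] of terms, so that the sum does not depend on the
   size of [p]. *)
pose ev n (p : {poly k}) w := \sum_(i < n) p`_i *: iter i f w.
have evD n p q w a : ev n (p + a *: q) w = ev n p w + a *: ev n q w.
  rewrite /ev scaler_sumr -big_split; apply: eq_bigr => i _.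
  by rewrite coefD coefZ scalerDl scalerA.
have evX n p w : ev n.+1 (p * 'X) w = ev n p (f w).
  rewrite /ev big_ord_recl coefMX scale0r add0r; apply: eq_bigr => i _.
  by rewrite coefMX /= -iterS iterSr.
have evS n (p : {poly k}) w : (size p <= n)%N -> ev n.+1 p w = ev n p w.
  by move=> sp; rewrite /ev big_ord_recr /= nth_default // scale0r addr0.
pose N := \dim {:V}; pose X := [tuple of mkseq (fun i => iter i f v) N.+1].
have /freeP nfX : ~~ free X.
  apply/negP=> fX; have := dimvS (subvf <<X>>).
  by move: fX; rewrite /free => /eqP->; rewrite size_tuple ltnn.
have [c nc] := not_all_ex_not _ _ nfX.
have [sc nc0] := imply_to_and _ _ nc.
have [i0 /eqP ci0] := not_all_ex_not _ _ nc0.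
pose p := \poly_(i < N.+1) (if insub i is Some j then c j else 0).
have pE (i : 'I_N.+1) : p`_i = c i by rewrite coef_poly ltn_ord valK.
have p0 : p != 0 by apply: contraNneq ci0 => p0; rewrite -pE p0 coef0.
have sp : (size p <= N.+1)%N by apply: size_poly.
have evp : ev N.+1 p v = 0.
  by rewrite -[RHS]sc; apply: eq_bigr => i _; rewrite pE nth_mkseq.
have [rs pf] := closed_field_poly_normal p.
have lc0 : lead_coef p != 0 by rewrite lead_coef_eq0.
pose q := \prod_(z <- rs) ('X - z%:P).
have evq : ev N.+1 q v = 0.
  move: evp; rewrite pf -[_ *: _]add0r evD.
  rewrite [X in X + _]big1 ?add0r => [/eqP|i _]; last by rewrite coef0 scale0r.
  by rewrite scaler_eq0 (negPf lc0) => /eqP.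
have evq' d : ev (d + N.+1)%N q v = 0.
  have sq : (size q <= N.+1)%N by move: sp; rewrite pf size_scale.
  by elim: d => // d IH; rewrite addSn evS // (leq_trans sq) ?leq_addl.
exists rs; rewrite -(evq' (size rs)) /q.
have : (size rs < size rs + N.+1)%N by rewrite addnS ltnS leq_addr.
move: (size rs + N.+1)%N => n; clear - n evD evX evS; move: n v.
elim: rs => [|r rs IH] [|n] v // sn.
  by rewrite /ev big_nil big_ord_recl coef1 scale1r big1 ?addr0 // => i _; rewrite coef1 scale0r.
rewrite foldr_shiftC (IH n) // big_cons mulrC; set q := \prod_(z <- rs) _.
have -> : q * ('X - r%:P) = q * 'X + (- r) *: q by rewrite mulrBr scaleNr -mul_polyC mulrC [q * _]mulrC.
rewrite evD evX evS ?size_prod_XsubC // /ev scaler_sumr -big_split; apply: eq_bigr => i _.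
have -> : shift f r v = (- r) *: v + f v by rewrite shiftE addrC scaleNr.
by rewrite iter_lin scalerDr addrC !scalerA mulrC.
Qed.

Lemma gev_span f v : sum_of (fun x => exists c, gev f c x) v.
Proof.
have [rs /gev_split] := foldr_shift_ex f v.
move=> /(_ fullv (fun _ _ => memvf _) (memvf _))[w [gw ->]].
exists [seq w r | r <- undup rs]; last by rewrite big_map.
by move=> x /mapP[r _ ->]; exists r; case: (gw r).
Qed.

Definition semisimple_part f (s : 'End(V)) : Prop := forall c v, gev f c v -> s v = c *: v.

(** Subtract [v] from the sum of its basis terms, grouped by eigenvalue: the groups vanish
    separately by [gev_indep], and a group with eigenvalue other than [e] consists of basis terms
    only. *)
Lemma gev_basis_coord f d (b : d.-tuple V) (c : 'I_d -> k) e v i :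
  basis_of fullv b -> (forall j, gev f (c j) (tnth b j)) -> gev f e v ->
  c i != e -> coord b i v = 0.
Proof.
move=> bb gb gv ce.
pose w r := (if r == e then - v else 0) + \sum_(j < d | c j == r) coord b j v *: tnth b j.
pose rs := undup (e :: codom c).
have w0 := @gev_indep _ _ f rs w (undup_uniq _) _ _ (c i).
have crs j : c j \in rs by rewrite mem_undup inE codom_f orbT.
have wi : w (c i) = 0.
  apply: w0 => //.
    move=> r _; rewrite /w -[X in X + _]scale1r; apply: gev_lin.
      case: eqP => [->|_]; last exact: gev0.
      by rewrite -scaleN1r; apply: gevZ.
    by apply: gev_sum => j /eqP <-; apply: gevZ.
  rewrite /w big_split /= (bigD1_seq e) ?undup_uniq ?mem_undup ?mem_head //= eqxx.
  rewrite big1 ?addr0 => [|r /negPf-> //].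
  rewrite (exchange_big_dep xpredT) //= {1}(basis_coordE v bb) -sumrN -big_split /=.
  rewrite big1 // => j _; rewrite -big_filter.
  have -> : [seq r <- rs | c j == r] = [:: c j].
    rewrite -(@filter_pred1_uniq _ rs (c j)) ?undup_uniq //.
    by apply: eq_filter => r /=; rewrite eq_sym.
  by rewrite big_seq1 addNr.
move: wi; rewrite /w (negPf ce) add0r.
have := coord_basisE (fun j => if c j == c i then coord b j v else 0) i (basis_free bb).
rewrite eqxx => <-; rewrite big_mkcond => H.
rewrite (eq_bigr (fun j => if c j == c i then coord b j v *: tnth b j else 0)) ?H ?linear0 //.
by move=> j _; case: ifP; rewrite ?scale0r.
Qed.

Lemma ex_semisimple_part f : exists s, semisimple_part f s.
Proof.
have [b [bb gb]] := ex_basis (gev_span f).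
have [c gc] : exists c : 'I_(\dim {:V}) -> k, forall j, gev f (c j) (tnth b j).
  exists (fun j => projT1 (constructive_indefinite_description _ (gb j))) => j.
  exact: projT2 (constructive_indefinite_description _ (gb j)).
have lin : linear (fun v => \sum_j (c j * coord b j v) *: tnth b j).
  move=> a u v; rewrite scaler_sumr -big_split; apply: eq_bigr => j _.
  by rewrite linearP /= scalerA -scalerDl mulrDr; congr ((_ + _) *: _); rewrite mulrCA.
pose L := GRing.isLinear.Build _ _ _ _ _ lin.
pose S : {linear V -> V} := HB.pack (fun v => \sum_j (c j * coord b j v) *: tnth b j) L.
exists (linfun S) => e v gv; rewrite lfunE /= [v in RHS](basis_coordE v bb) scaler_sumr.
apply: eq_bigr => j _; rewrite scalerA; have [->//|ce] := eqVneq (c j) e.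
by rewrite (gev_basis_coord bb gc gv ce) !mulr0.
Qed.
Definition diagop f : Prop := forall v, sum_of (fun x => exists c, f x = c *: x) v.

Lemma diagop_gev f c v : diagop f -> gev f c v -> f v = c *: v.
Proof.
move=> df gv; have [b [bb gb]] := ex_basis df.
pose e j := projT1 (constructive_indefinite_description _ (gb j)).
have eP j : f (tnth b j) = e j *: tnth b j.
  exact: projT2 (constructive_indefinite_description _ (gb j)).
rewrite (basis_coordE v bb) scaler_sumr linear_sum; apply: eq_bigr => j _.
rewrite linearZ /= eP !scalerA; have [->|ec] := eqVneq (e j) c; first by rewrite mulrC.
by rewrite (gev_basis_coord bb (fun j => gev_eig (eP j)) gv ec) mul0r mulr0.
Qed.

Lemma joint_eig (fs : seq 'End(V)) v :
  (forall f h, f \in fs -> h \in fs -> forall v, f (h v) = h (f v)) ->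
  (forall f, f \in fs -> diagop f) ->
  sum_of (fun x => forall f, f \in fs -> exists c, f x = c *: x) v.
Proof.
elim: fs v => [|f fs IH] v cF dF.
  by exists [:: v]; rewrite ?big_seq1.
have [||s sP ->] := IH v.
- by move=> h h' hf hf'; apply: cF; rewrite inE ?hf ?hf' orbT.
- by move=> h hf; apply: dF; rewrite inE hf orbT.
elim: s sP => [|x s IHs] sP; first by exists [::]; rewrite ?big_nil.
have [|t tP tE] := IHs; first by move=> y ys; apply: sP; rewrite inE ys orbT.
have xP : forall h, h \in fs -> exists c, h x = c *: x by apply: sP; rewrite mem_head.
(* U collects the vectors sharing all eigenvalues of x under the operators in fs. It is f-stable, so
   splitting x inside U keeps the components joint eigenvectors. *)
have [||U UE] := @ex_vspace _ _ (fun y => forall h c, h \in fs -> h x = c *: x -> h y = c *: y).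
- by move=> h c _ _; rewrite linear0 scaler0.
- move=> a y z yP zP h c hf hx; rewrite linearP /= (yP h c) // (zP h c) //.
  by rewrite scalerDr !scalerA mulrC.
have xU : x \in U by apply/UE.
have fU y : y \in U -> f y \in U.
  move/UE=> yP; apply/UE => h c hf hx.
  by rewrite cF ?mem_head // ?inE ?hf ?orbT // (yP h c) // linearZ.
have [rs /(gev_split fU xU)[w [gw xE]]] := foldr_shift_ex f x.
exists ([seq w r | r <- undup rs] ++ t).
  move=> y; rewrite mem_cat => /orP[/mapP[r _ ->]|/tP//] h.
  rewrite inE => /orP[/eqP->|hf].
    by exists r; apply: diagop_gev (gw r).1; apply: dF; rewrite mem_head.
  by have [c hx] := xP h hf; exists c; have /UE := (gw r).2; apply.
by rewrite big_cons big_cat big_map -tE {1}xE.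
Qed.

(** Discrete Fourier transform: m^-1 times the sum over i of z^(-ij) f^i v is an eigenvector for
    z^j, and summing over j restores v because the powers of a nontrivial root of unity sum to 0. *)
Lemma finite_order_diagop f (m : nat) (z : k) :
  m.-primitive_root z -> (forall v, iter m f v = v) -> diagop f.
Proof.
move=> pz fm v; have m0 := prim_order_gt0 pz.
have mk0 : m%:R != 0 :> k by apply: prim_root_natf_neq0 pz.
have zV : z != 0 by rewrite (prim_root_eq0 pz) -lt0n.
pose a j i := z ^- (i * j) *: iter i f v.
have aS j i : f (a j i) = z ^+ j *: a j i.+1.
  rewrite /a linearZ /= scalerA; congr (_ *: _).
  by rewrite mulSn exprD invfM mulVKf // expf_neq0.
have am j : a j m = a j 0%N.
  by rewrite /a fm exprM (prim_expr_order pz) expr1n mul0n expr0.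
exists [seq m%:R^-1 *: \sum_(i < m) a j i | j <- iota 0 m].
  move=> _ /mapP[j _ ->]; exists (z ^+ j).
  rewrite linearZ /= linear_sum scalerA mulrC -scalerA; congr (_ *: _).
  rewrite (eq_bigr (fun i : 'I_m => z ^+ j *: a j i.+1)) => [|i _]; last exact: aS.
  rewrite -!scaler_sumr; congr (_ *: _).
  case: m m0 am {fm pz mk0} => // m _ am.
  by rewrite big_ord_recr [RHS]big_ord_recl am /= addrC; congr (_ + _).
rewrite big_map -scaler_sumr -[in iota 0 m](subn0 m) -/(index_iota 0 m) big_mkord.
rewrite exchange_big /=; transitivity (m%:R^-1 *: (m%:R *: v)).
  by rewrite scalerA mulVf ?scale1r.
congr (_ *: _).
case: m m0 pz {fm mk0 am} => // m _ pz; rewrite big_ord_recl [X in _ + X]big1 ?addr0 => [|i _].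
  under eq_bigr => j _ do rewrite /a mul0n expr0 invr1 scale1r.
  by rewrite sumr_const card_ord scaler_nat.
rewrite -scaler_suml; set x := z ^- (bump 0 i).
have -> : \sum_(j < m.+1) z ^- (lift ord0 i * j) = \sum_(j < m.+1) x ^+ j.
  by apply: eq_bigr => j _; rewrite exprM exprVn.
have x1 : x - 1 != 0.
  rewrite subr_eq0 -invr1 (inj_eq invr_inj) -[1](expr0 z) (eq_prim_root_expr pz).
  by rewrite mod0n modn_small // ltnS /bump /= add1n.
have : (x - 1) * \sum_(j < m.+1) x ^+ j = 0.
  by rewrite -subrX1 exprVn -exprM mulnC exprM (prim_expr_order pz) expr1n invr1 subrr.
by move/eqP; rewrite mulf_eq0 (negPf x1) => /eqP->; rewrite scale0r.
Qed.

End AlgClosed.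

Section CharZero.
Variable k : fieldType.
Hypothesis char0 : [pchar k] =i pred0.

Lemma natf_eq0 n : (n%:R == 0 :> k) = (n == 0%N).
Proof. exact: (pcharf0P k).1. Qed.

Lemma intf_eq0 (z : int) : (z%:~R == 0 :> k) = (z == 0).
Proof. by case: z => n; rewrite ?NegzE ?mulrNz ?oppr_eq0 natf_eq0. Qed.

(** [k] has no order; positivity arguments are carried out in [rat] and transported to [k] along
    this embedding. *)
Lemma ex_rat_morph : exists io : {rmorphism rat -> k}, True.
Proof.
pose f x : k := (numq x)%:~R / (denq x)%:~R.
have fE x (a b : int) : b != 0 -> x * b%:~R = a%:~R -> f x = a%:~R / b%:~R.
  move=> b0 xE; apply/eqP; rewrite eqr_div ?intf_eq0 ?denq_neq0 // -!intrM.
  apply/eqP; congr _%:~R; apply: (@intr_inj rat).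
  by rewrite !intrM numqE -xE mulrAC.
have d0 x : (denq x)%:~R != 0 :> k by rewrite intf_eq0 denq_neq0.
have fB : zmod_morphism f.
  move=> x y; rewrite (fE _ (numq x * denq y - numq y * denq x) (denq x * denq y)).
  - rewrite rmorphB /= !intrM mulrBl; congr (_ - _).
      by rewrite invfM mulrACA divff ?mulr1.
    by rewrite invfM [_^-1 * _]mulrC mulrACA divff ?mulr1.
  - by rewrite mulf_neq0 ?denq_neq0.
  by rewrite rmorphB /= !intrM !numqE; ring.
have fM : monoid_morphism f.
  split; first by rewrite /f divr1.
  move=> x y; rewrite (fE _ (numq x * numq y) (denq x * denq y)).
  - by rewrite !intrM invfM mulrACA.
  - by rewrite mulf_neq0 ?denq_neq0.
  by rewrite !intrM !numqE mulrACA.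
pose A := GRing.isZmodMorphism.Build _ _ f fB.
pose M := GRing.isMonoidMorphism.Build _ _ f fM.
by exists (HB.pack f A M : {rmorphism rat -> k}).
Qed.

End CharZero.

(* The family b is a minimal one spanning cs over the rationals. *)
Lemma rat_coordinates (k : fieldType) (io : {rmorphism rat -> k}) (cs : seq k) :
  exists (N : nat) (b : 'I_N -> k) (a : k -> 'I_N -> rat),
    (forall c, c \in cs -> c = \sum_j io (a c j) * b j) /\
    (forall q : 'I_N -> rat, \sum_j io (q j) * b j = 0 -> forall j, q j = 0).
Proof.
have : exists (N : nat) (b : 'I_N -> k) (a : k -> 'I_N -> rat),
    (forall c, c \in cs -> c = \sum_j io (a c j) * b j).
  exists (size cs), (fun j => cs`_j), (fun c (j : 'I__) => (index c cs == j :> nat)%:R) => c ccs.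
  have lt : (index c cs < size cs)%N by rewrite index_mem.
  rewrite (bigD1 (Ordinal lt)) //= eqxx rmorph1 mul1r nth_index // big1 ?addr0 // => j.
  by rewrite -val_eqE /= eq_sym => /negPf->; rewrite rmorph0 mul0r.
case=> N; elim: N => [|N IH] [b [a aP]]; first by exists 0%N, b, a; split=> // q _ [].
case: (classic (forall q : 'I_N.+1 -> rat, \sum_j io (q j) * b j = 0 -> forall j, q j = 0)).
  by move=> ind; exists N.+1, b, a.
move=> /not_all_ex_not[q nq]; have [sq nq0] := imply_to_and _ _ nq.
have [j0 /eqP qj0] := not_all_ex_not _ _ nq0.
(* A relation with q j0 <> 0 expresses b j0 through the others; substituting it shortens the
   family. *)
apply: IH; exists (fun j => b (lift j0 j)).
exists (fun c j => a c (lift j0 j) - a c j0 * (q (lift j0 j) / q j0)) => c ccs.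
have E (F : 'I_N.+1 -> k) : \sum_j F j = F j0 + \sum_(j < N) F (lift j0 j).
  rewrite (bigD1 j0) //=; congr (_ + _).
  rewrite (reindex_omap (lift j0) (unlift j0)) /= => [|j]; last first.
    by rewrite eq_sym => /unlift_some[l jl ->]; rewrite /= -jl.
  by apply: eq_bigl => j; rewrite eq_sym neq_lift liftK eqxx.
have bj0 : b j0 = - \sum_(j < N) io (q (lift j0 j) / q j0) * b (lift j0 j).
  move: sq; rewrite E => /eqP; rewrite addr_eq0 => /eqP sq.
  have io0 : io (q j0) != 0 by rewrite fmorph_eq0.
  apply: (mulfI io0); rewrite sq mulrN mulr_sumr; congr (- _); apply: eq_bigr => j _.
  by rewrite fmorph_div mulrA [_ * (_ / _)]mulrC divfK.
rewrite [LHS]aP // E bj0 mulrN mulr_sumr addrC -sumrB; apply: eq_bigr => j _.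
by rewrite rmorphB rmorphM /=; ring.
Qed.

(** * Lie algebras and the Killing form *)

Section LieBasics.
Variables (k : fieldType) (g : vectType k) (br : g -> g -> g).
Hypothesis lieP : is_lie br.

Lemma br_lin_l z a x y : br (a *: x + y) z = a *: br x z + br y z.
Proof. by case: lieP. Qed.
Lemma br_lin_r z a x y : br z (a *: x + y) = a *: br z x + br z y.
Proof. by case: lieP => _ []. Qed.
Lemma brxx x : br x x = 0.
Proof. by case: lieP => _ [_ []]. Qed.
Lemma brDl x y z : br (x + y) z = br x z + br y z.
Proof. by rewrite -[x]scale1r br_lin_l !scale1r. Qed.
Lemma brDr x y z : br z (x + y) = br z x + br z y.
Proof. by rewrite -[x]scale1r br_lin_r !scale1r. Qed.
Lemma br0l z : br 0 z = 0.
Proof. by apply: (addrI (br 0 z)); rewrite -brDl !addr0. Qed.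
Lemma br0r z : br z 0 = 0.
Proof. by apply: (addrI (br z 0)); rewrite -brDr !addr0. Qed.
Lemma brZl a x z : br (a *: x) z = a *: br x z.
Proof. by rewrite -[a *: x]addr0 br_lin_l br0l addr0. Qed.
Lemma brZr a x z : br z (a *: x) = a *: br z x.
Proof. by rewrite -[a *: x]addr0 br_lin_r br0r addr0. Qed.
Lemma brNl x z : br (- x) z = - br x z.
Proof. by rewrite -scaleN1r brZl scaleN1r. Qed.
Lemma brNr x z : br z (- x) = - br z x.
Proof. by rewrite -scaleN1r brZr scaleN1r. Qed.
Lemma brC x y : br x y = - br y x.
Proof.
have := brxx (x + y); rewrite brDl !brDr !brxx add0r addr0 => /eqP.
by rewrite addr_eq0 => /eqP.
Qed.
Lemma jacobi x y z : br x (br y z) = br (br x y) z + br y (br x z).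
Proof.
have [_ [_ [_ /(_ x y z) J]]] := lieP.
move: J; rewrite (brC z x) brNr (brC (br x y)) => /eqP.
by rewrite -addrA addr_eq0 opprD opprK addrC => /eqP.
Qed.
Lemma br_suml (I : Type) (r : seq I) (P : pred I) (F : I -> g) z :
  br (\sum_(i <- r | P i) F i) z = \sum_(i <- r | P i) br (F i) z.
Proof. by elim/big_rec2: _ => [|i y x _ <-]; rewrite ?br0l ?brDl. Qed.
Lemma br_sumr (I : Type) (r : seq I) (P : pred I) (F : I -> g) z :
  br z (\sum_(i <- r | P i) F i) = \sum_(i <- r | P i) br z (F i).
Proof. by elim/big_rec2: _ => [|i y x _ <-]; rewrite ?br0r ?brDr. Qed.

Definition ad x : 'End(g) := linfun (br x).

Lemma adE x y : ad x y = br x y.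
Proof.
pose L := GRing.isLinear.Build _ _ _ _ _ (br_lin_r x).
pose F : {linear g -> g} := HB.pack (br x) L.
exact: (lfunE F y).
Qed.

Lemma ad_lin a x y : ad (a *: x + y) = a *: ad x + ad y.
Proof.
apply/lfunP=> z.
by rewrite add_lfunE scale_lfunE !adE br_lin_l.
Qed.

Lemma iter_ad n x y : iter n (ad x) y = iter n (br x) y.
Proof. by elim: n => //= n ->; rewrite adE. Qed.

Lemma ad_br x y : ad (br x y) = (ad x \o ad y)%VF - (ad y \o ad x)%VF.
Proof.
apply/lfunP=> z; rewrite add_lfunE opp_lfunE !comp_lfunE !adE jacobi.
by rewrite addrK.
Qed.

Definition subalg (K : {vspace g}) := forall x y, x \in K -> y \in K -> br x y \in K.

(** Engel's theorem relative to a pair of modules: a nilpotent action on V modulo W has a common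
    null vector there. Carrying W along avoids quotient spaces. *)
Definition engel_prop (K : {vspace g}) := forall W V : {vspace g},
  ~~ (V <= W)%VS ->
  (forall x v, x \in K -> v \in V -> br x v \in V) ->
  (forall x v, x \in K -> v \in W -> br x v \in W) ->
  (forall x v, x \in K -> v \in V -> exists N, iter N (br x) v \in W) ->
  exists2 v, v \in V & v \notin W /\ forall x, x \in K -> br x v \in W.

(** Start from a vector of V annihilated by K modulo W. Since [K, y] lies in K, its iterates under y
    are annihilated as well, and the last iterate outside W is annihilated by y too. *)
Lemma engel_step (K : {vspace g}) y : engel_prop K -> subalg K ->
  (forall x, x \in K -> br x y \in K) ->
  engel_prop (K + <[y]>)%VS /\ subalg (K + <[y]>)%VS.
Proof.
move=> EK sK Ky; have KL x : x \in K -> x \in (K + <[y]>)%VS.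
  by move=> xK; rewrite -[x]addr0 memv_add ?mem0v.
have yL : y \in (K + <[y]>)%VS by rewrite memvE addvSr.
split; last first.
  move=> _ _ /memv_addP[x xK [_ /vlineP[a ->] ->]] /memv_addP[z zK [_ /vlineP[b ->] ->]].
  apply: KL; rewrite brDl !brDr !brZl !brZr brxx !scaler0 addr0.
  apply: memvD; first by apply: memvD; [exact: sK | rewrite memvZ ?Ky].
  by rewrite memvZ // brC memvN Ky.
move=> W V VW LV LW nil.
have [v vV [vW Kv]] : exists2 v, v \in V & v \notin W /\ forall x, x \in K -> br x v \in W.
  by apply: EK => // x v xK vV; [apply: LV|apply: LW|apply: nil]; rewrite ?KL.
have [N yNv] := nil _ _ yL vV.
have [n [nW nW']] : exists n, iter n (br y) v \notin W /\ iter n.+1 (br y) v \in W.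
  elim: N yNv => [|N IH]; first by rewrite /= (negPf vW).
  by case: (boolP (iter N (br y) v \in W)) => [/IH //|nW yW]; exists N.
have H m : iter m (br y) v \in V /\ forall x, x \in K -> br x (iter m (br y) v) \in W.
  elim: m => [//|m [mV Km]] /=; split; first exact: LV.
  by move=> x xK; rewrite jacobi; apply: memvD; [apply/Km/Ky | apply/LW/Km].
exists (iter n (br y) v); first by case: (H n).
split=> // _ /memv_addP[x xK [_ /vlineP[a ->] ->]].
by rewrite brDl brZl memvD ?memvZ //; case: (H n) => _; apply.
Qed.

(** A chain of subalgebras of dimensions 0, 1, ..., dim L: the property for K, applied to the pair K
    in L, yields a vector outside K that normalizes K, and [engel_step] adjoins it. *)
Lemma engel (L : {vspace g}) : subalg L ->
  (forall x y, x \in L -> y \in L -> exists N, iter N (br x) y = 0) -> engel_prop L.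
Proof.
move=> sL nL.
have : forall d, (d <= \dim L)%N ->
    exists K : {vspace g}, [/\ (K <= L)%VS, \dim K = d, engel_prop K & subalg K].
  elim=> [_|d IH dL].
    exists 0%VS; split; rewrite ?sub0v ?dimv0 //.
      move=> W V /subvPn[v vV vW] _ _ _; exists v => //; split=> // x.
      by rewrite memv0 => /eqP->; rewrite br0l mem0v.
    by move=> x y; rewrite !memv0 => /eqP->; rewrite br0l.
  have [K [KL dK EK sK]] := IH (ltnW dL).
  have [y yL [yK Ky]] : exists2 y, y \in L & y \notin K /\ forall x, x \in K -> br x y \in K.
    apply: (EK K L) => // [|x v /(subvP KL)|x v /(subvP KL) xL vL].
    - by apply: contraTN dL => /dimvS; rewrite dK -leqNgt.
    - exact: sL.
    by have [N xv] := nL _ _ xL vL; exists N; rewrite xv mem0v.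
  have [EK' sK'] := engel_step EK sK Ky.
  exists (K + <[y]>)%VS; split=> //.
    by rewrite subv_add KL -memvE.
  rewrite dimv_disjoint_sum ?dK ?dim_vline.
    by rewrite (_ : y != 0) ?addn1 //; apply: contraNneq yK => ->; rewrite mem0v.
  apply/eqP; rewrite -subv0; apply/subvP=> w; rewrite memv_cap => /andP[wK /vlineP[a wE]].
  move: wK; rewrite wE memv0 scaler_eq0; have [//|a0 ayK] := eqVneq a 0.
  by move: yK; rewrite -[y](scalerK a0) memvZ.
move=> /(_ _ (leqnn _))[K [KL dK EK _]].
by have /eqP <- : K == L by rewrite eqEdim KL dK /=.
Qed.

(** Leibniz rule: (D - c - d)[x, y] = [(D - c)x, y] + [x, (D - d)y], and in each term the total
    exponent has dropped. *)
Lemma gev_br (D : 'End(g)) c d x y : (forall x y, D (br x y) = br (D x) y + br x (D y)) ->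
  gev D c x -> gev D d y -> gev D (c + d) (br x y).
Proof.
move=> dD [N xN] [M yM]; exists (N + M)%N.
have [n] := ubnP (N + M)%N; elim: n N M x y xN yM => // n IH [|N] [|M] x y.
- by move=> /= ->; rewrite br0l.
- by move=> x0 _ _; rewrite (x0 : x = 0) br0l iter_lin0.
- by move=> _ y0 _; rewrite (y0 : y = 0) br0r iter_lin0.
rewrite !iterSr => xN yM le.
have -> : shift D (c + d) (br x y) = 1 *: br (shift D c x) y + br x (shift D d y).
  rewrite scale1r !shiftE dD brDl brDr brNl brNr brZl brZr scalerDl opprD.
  by rewrite addrACA.
have h1 : iter (N + M.+1) (shift D (c + d)) (br (shift D c x) y) = 0.
  by apply: IH => //; rewrite iterSr.
have h2 : iter (N + M.+1) (shift D (c + d)) (br x (shift D d y)) = 0.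
  by rewrite -addSnnS; apply: IH; rewrite ?iterSr // addSn -addnS.
by rewrite iter_lin scale1r h1 h2 addr0.
Qed.

Definition derivation (D : 'End(g)) := forall x y, D (br x y) = br (D x) y + br x (D y).

Lemma ad_derivation x : derivation (ad x).
Proof. by move=> y z; rewrite !adE jacobi. Qed.

Definition kf x y := trU fullv (ad x \o ad y)%VF.

Lemma kfC x y : kf x y = kf y x.
Proof. by apply: trU_mulC => v _; apply: memvf. Qed.

Lemma kf_lin a x y z : kf (a *: x + y) z = a * kf x z + kf y z.
Proof. by rewrite /kf ad_lin comp_lfunDl -comp_lfunZl trUD trUZ. Qed.

Lemma kfZl a x z : kf (a *: x) z = a * kf x z.
Proof.
rewrite -[a *: x]addr0 kf_lin.
suff -> : kf 0 z = 0 by rewrite addr0.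
apply: etrans (trU_scal (c := 0) _) (mul0r _) => v _.
by rewrite comp_lfunE adE br0l scale0r.
Qed.

Lemma kfDl x y z : kf (x + y) z = kf x z + kf y z.
Proof. by rewrite -[x]scale1r kf_lin mul1r scale1r. Qed.

(** ad(Dy) is the commutator of [D] and ad y, and the trace is cyclic. The identity drives both the
    nondegeneracy of the Killing form and the inner derivation theorem. *)
Lemma kf_deriv D y z : derivation D ->
  trU fullv (D \o ad (br y z))%VF = kf (D y) z.
Proof.
move=> dD; have mf (h : 'End(g)) v : v \in fullv -> h v \in fullv by rewrite !memvf.
have E : ad (D y) = (D \o ad y)%VF - (ad y \o D)%VF.
  apply/lfunP=> w; rewrite add_lfunE opp_lfunE !comp_lfunE !adE dD.
  by rewrite addrK.
rewrite /kf E comp_lfunDl comp_lfunNl ad_br comp_lfunDr comp_lfunNr !trUD !trUN.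
congr (_ - _); first by rewrite comp_lfunA.
transitivity (trU fullv (ad y \o (D \o ad z))%VF); last by rewrite comp_lfunA.
by rewrite comp_lfunA; apply: trU_mulC => v; apply: mf.
Qed.

Lemma kf_inv x y z : kf (br x y) z = kf x (br y z).
Proof.
have := kf_deriv y z (ad_derivation x); rewrite adE => <-.
by [].
Qed.

End LieBasics.

Lemma basis_ind (k : fieldType) (V : vectType k) d (b : d.-tuple V) (P : V -> Prop) :
  basis_of fullv b -> (forall a x y, P x -> P y -> P (a *: x + y)) -> P 0 ->
  (forall i, P (tnth b i)) -> forall v, P v.
Proof.
move=> bb PD P0 Pb v; rewrite (basis_coordE v bb).
by elim/big_rec: _ => // i x _ Px; apply: PD.
Qed.

Lemma derivation_basis (k : fieldType) (V : vectType k) (br : V -> V -> V) d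
    (b : d.-tuple V) (D : 'End(V)) : is_lie br -> basis_of fullv b ->
  (forall i j, D (br (tnth b i) (tnth b j)) =
     br (D (tnth b i)) (tnth b j) + br (tnth b i) (D (tnth b j))) ->
  derivation br D.
Proof.
move=> L bb H u v; move: u; apply: (basis_ind bb).
- move=> a x y; rewrite (br_lin_l L) !linearP /= !(br_lin_l L) => -> ->.
  by rewrite scalerDr addrACA.
- by rewrite linear0 !(br0l L) linear0 addr0.
move=> i; move: v; apply: (basis_ind bb) => //.
- move=> a x y; rewrite (br_lin_r L) !linearP /= !(br_lin_r L) => -> ->.
  by rewrite scalerDr addrACA.
by rewrite linear0 !(br0r L) linear0 addr0.
Qed.

(** * The Killing form of a simple Lie algebra *)

Section Killing.
Variables (k : closedFieldType) (g : vectType k) (br : g -> g -> g).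
Variable io : {rmorphism rat -> k}.
Hypothesis lieP : is_lie br.
Hypothesis simpleP : simple_in br fullv.

Lemma simple_ideal (I : {vspace g}) : (forall x y, y \in I -> br x y \in I) ->
  I = 0%VS \/ I = fullv.
Proof. by case: simpleP => _ [_ H] HI; apply: H; rewrite ?subvf // => x y _; apply: HI. Qed.

Lemma simple_center x : (forall y, br x y = 0) -> x = 0.
Proof.
move=> xZ; have [||U UE] := @ex_vspace _ _ (fun x => forall y, br x y = 0).
- by move=> y; rewrite br0l.
- by move=> a u v uZ vZ y; rewrite br_lin_l // uZ vZ scaler0 addr0.
have [|U0|UT] := @simple_ideal U.
- move=> u v /UE vZ; apply/UE => y.
  by rewrite (brC lieP u v) vZ oppr0 br0l.
- by apply/eqP; rewrite -memv0 -U0; apply/UE.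
case: simpleP => _ [[u [v [_ _ uv]]] _]; case/eqP: uv.
by have /UE : u \in U by rewrite UT memvf.
Qed.

Lemma simple_perfect x : exists s : seq (g * g), x = \sum_(p <- s) br p.1 p.2.
Proof.
have [||U UE] := @ex_vspace _ _ (fun x => exists s : seq (g * g), x = \sum_(p <- s) br p.1 p.2).
- by exists [::]; rewrite big_nil.
- move=> a u v [s ->] [t ->]; exists ([seq (a *: p.1, p.2) | p <- s] ++ t).
  rewrite big_cat big_map scaler_sumr; congr (_ + _); apply: eq_bigr => p _.
  by rewrite brZl.
have [|U0|UT] := @simple_ideal U.
- by move=> u v _; apply/UE; exists [:: (u, v)]; rewrite big_seq1.
- case: simpleP => _ [[u [v [_ _ uv]]] _]; case/negP: uv; rewrite -memv0 -U0.
  by apply/UE; exists [:: (u, v)]; rewrite big_seq1.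
by apply/UE; rewrite UT memvf.
Qed.

(** Otherwise Engel's theorem for [g] acting on itself gives a nonzero central vector. *)
Lemma not_all_ad_nilp : ~ forall x y, exists N, iter N (br x) y = 0.
Proof.
move=> nil; have EL : engel_prop br fullv.
  by apply: engel => // x y *; apply: memvf.
case: simpleP => _ [[u [v [_ _ /eqP uv]]] _].
have [||x y _|x y _ _|w _ [w0 wZ]] := EL 0%VS fullv.
- apply/negP; rewrite subv0 => /eqP F0; apply: uv.
  by apply/eqP; rewrite -memv0 -F0 memvf.
- by move=> *; apply: memvf.
- by rewrite !memv0 => /eqP->; rewrite br0r.
- by have [N xy] := nil x y; exists N; rewrite xy mem0v.
move: w0; rewrite memv0 => /eqP[]; apply: simple_center => y.
by rewrite (brC lieP); apply/eqP; rewrite oppr_eq0 -memv0 wZ ?memvf.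
Qed.

(* Cartan's criterion: a rational functional of the eigenvalues of ad x defines a
   derivation, whose trace pairing with ad x is a sum of squares. *)
Lemma kf0_nilp : (forall x y, kf br x y = 0) -> forall x y, exists N, iter N (br x) y = 0.
Proof.
move=> kf0 x y.
have [b [bb gb]] := ex_basis (gev_span (ad br x)).
pose c j := projT1 (constructive_indefinite_description _ (gb j)).
have gc j : gev (ad br x) (c j) (tnth b j).
  exact: projT2 (constructive_indefinite_description _ (gb j)).
have [N [e [a [aP eP]]]] := rat_coordinates io (codom c).
have cE j : c j = \sum_l io (a (c j) l) * e l by apply: aP; apply: codom_f.
(* The operator [D l] built from this multiplies the generalised c-eigenspace of ad x by the l-th
   rational coordinate of c. Coordinates add when eigenvalues add, which makes it a derivation. *)
pose fl l v := \sum_j (io (a (c j) l) * coord b j v) *: tnth b j.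
have lin l : linear (fl l).
  move=> t u v; rewrite scaler_sumr -big_split; apply: eq_bigr => j _.
  by rewrite linearP /= scalerA -scalerDl mulrDr; congr ((_ + _) *: _); rewrite mulrCA.
pose F l : {linear g -> g} := HB.pack (fl l) (GRing.isLinear.Build _ _ _ _ _ (lin l)).
pose D l := linfun (F l).
have DE l v : D l v = fl l v by rewrite lfunE.
have Dgev l j v : gev (ad br x) (c j) v -> D l v = io (a (c j) l) *: v.
  move=> gv; rewrite DE {2}(basis_coordE v bb) scaler_sumr; apply: eq_bigr => i _.
  rewrite scalerA; have [->//|ce] := eqVneq (c i) (c j).
  by rewrite (gev_basis_coord bb gc gv ce) !mulr0.
have Dd l : derivation br (D l).
  suff H i j : D l (br (tnth b i) (tnth b j)) =
               br (D l (tnth b i)) (tnth b j) + br (tnth b i) (D l (tnth b j)).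
    exact: (derivation_basis lieP bb).
  rewrite !(Dgev _ _ _ (gc _)) brZl // brZr // -scalerDl.
  have gij : gev (ad br x) (c i + c j) (br (tnth b i) (tnth b j)).
    by apply: gev_br => //; apply: ad_derivation.
  set w := br _ _ in gij *; rewrite DE [w in RHS](basis_coordE w bb) scaler_sumr.
  apply: eq_bigr => m _; rewrite scalerA.
  have [cm|cm] := eqVneq (c m) (c i + c j); last first.
    by rewrite (gev_basis_coord bb gc gij cm) !mulr0.
  suff -> : a (c m) l = a (c i) l + a (c j) l by rewrite rmorphD.
  apply/eqP; rewrite -subr_eq0; apply/eqP.
  apply: (eP (fun l => a (c m) l - (a (c i) l + a (c j) l))).
  under eq_bigr => p _ do rewrite rmorphB rmorphD mulrBl mulrDl.
  by rewrite sumrB big_split -!cE cm subrr.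
(* x is a sum of brackets [y, z], and the trace of D ad [y, z] is the Killing form of Dy and z,
   which is zero. *)
have tr0 l : trU fullv (D l \o ad br x)%VF = 0.
  have [s {1}->] := simple_perfect x.
  elim: s => [|p s IH].
    rewrite big_nil; apply: etrans (trU_scal (c := 0) _) (mul0r _) => v _.
    by rewrite comp_lfunE adE // br0l // linear0 scale0r.
  rewrite big_cons -[br _ _]scale1r ad_lin // scale1r comp_lfunDr trUD IH addr0.
  by rewrite kf_deriv.
have [s sP] := ex_semisimple_part (ad br x).
have nil l v : iter v.1 (D l \o (ad br x - s))%VF v.2 = iter v.1 (shift (D l \o (ad br x - s))%VF 0) v.2.
  by rewrite /shift scale0r subr0.
(* ad x may be replaced by its semisimple part s: the composite of [D l] with ad x - s is nilpotent,
   so it contributes no trace. *)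
have sum0 l : \sum_j io (a (c j) l) * c j = 0.
  pose h : 'End(g) := (D l \o (ad br x - s))%VF.
  have hn v : gev h 0 v.
    move: v; apply: (basis_ind bb); [exact: gev_lin | exact: gev0 |] => j.
    have [n bn] := gc j; exists n.
    suff [-> _] : iter n (shift h 0) (tnth b j) =
        io (a (c j) l) ^+ n *: iter n (shift (ad br x) (c j)) (tnth b j) /\
        gev (ad br x) (c j) (iter n (shift (ad br x) (c j)) (tnth b j)).
      by rewrite bn scaler0.
    elim: n {bn} => [|n [IH1 IH2]]; first by rewrite scale1r.
    split; last by apply: gev_shift.
    rewrite !iterS IH1 shiftE scale0r subr0 linearZ /= comp_lfunE add_lfunE opp_lfunE.
    rewrite (sP _ _ IH2) -shiftE (Dgev _ j) ?scalerA -?exprSr //.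
    exact: gev_shift.
  have htr : trU fullv h = 0.
    apply: trU_nilp => v _; first exact: memvf.
    by have [n] := hn v; rewrite /shift scale0r subr0; exists n.
  have : trU fullv ((D l \o s)%VF + h) = 0.
    rewrite -comp_lfunDr addrC subrK.
    exact: tr0.
  rewrite trUD htr addr0 (trU_basis bb) => [sE|v _]; last exact: memvf.
  rewrite -[RHS]sE.
  apply: eq_bigr => j _; rewrite comp_lfunE (sP _ _ (gc j)) linearZ /= (Dgev _ _ _ (gc j)).
  rewrite !linearZ /= (tnth_nth 0) coord_free ?(basis_free bb) // eqxx mulr1.
  by rewrite mulrC.
(* Substituting the coordinates of [c j] into [sum0] gives a rational relation between the [e i];
   its l-th coefficient is a sum of squares of rational numbers. *)
have a0 l j : a (c j) l = 0.
  have : \sum_i io (\sum_j a (c j) l * a (c j) i) * e i = 0.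
    rewrite -[RHS](sum0 l); under [RHS]eq_bigr => m _ do rewrite {2}cE mulr_sumr.
    rewrite exchange_big; apply: eq_bigr => i _; rewrite rmorph_sum mulr_suml.
    by apply: eq_bigr => m _; rewrite rmorphM mulrA.
  move/eP => /(_ l) /eqP; rewrite psumr_eq0 => [/allP/(_ j (mem_index_enum _))|m _].
    by rewrite mulf_eq0 orbb => /eqP.
  by rewrite -expr2 sqr_ge0.
have c0 j : c j = 0.
  by rewrite cE big1 // => l _; rewrite a0 rmorph0 mul0r.
have : gev (ad br x) 0 y.
  move: y; apply: (basis_ind bb); [exact: gev_lin | exact: gev0 |] => j.
  by rewrite -(c0 j).
by move=> [n]; rewrite /shift scale0r subr0 iter_ad //; exists n.
Qed.

Lemma kf_nondeg x : (forall y, kf br x y = 0) -> x = 0.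
Proof.
move=> xK; have [||U UE] := @ex_vspace _ _ (fun x => forall y, kf br x y = 0).
- by move=> y; rewrite kfC -(scale0r (0 : g)) kfC kfZl ?mul0r.
- by move=> a u v uK vK y; rewrite kf_lin // uK vK mulr0 addr0.
have [|U0|UT] := @simple_ideal U.
- move=> u v /UE vK; apply/UE => y.
  by rewrite (brC lieP) -scaleN1r kfZl // kf_inv // vK mulr0.
- by apply/eqP; rewrite -memv0 -U0; apply/UE.
case: not_all_ad_nilp; apply: kf0_nilp => u v.
by have /UE : u \in U by rewrite UT memvf.
Qed.

Lemma kf_repr (U : {vspace g}) (phi : g -> k) :
  (forall a x y, phi (a *: x + y) = a * phi x + phi y) ->
  (forall x, x \in U -> (forall y, y \in U -> kf br x y = 0) -> x = 0) ->
  exists2 x, x \in U & forall y, y \in U -> phi y = kf br x y.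
Proof.
move=> phiL nd; pose d := \dim U; pose X := vbasis U.
pose ev x : 'rV[k]_d := \row_i kf br x (tnth X i).
have lin : linear ev.
  by move=> a u v; apply/rowP=> i; rewrite !mxE kf_lin.
pose F0 : {linear g -> 'rV[k]_d} := HB.pack ev (GRing.isLinear.Build _ _ _ _ _ lin).
pose F := linfun F0; have FE x : F x = ev x by rewrite lfunE.
have kf0 x : kf br x 0 = 0 by rewrite kfC -(scale0r (0 : g)) kfZl ?mul0r.
have kfs x (c : 'I_d -> k) : kf br x (\sum_i c i *: X`_i) = \sum_i c i * kf br x (tnth X i).
  elim/big_rec2: _ => [//|i y1 y2 _ <-].
  by rewrite kfC kf_lin // kfC (kfC _ y2) (tnth_nth 0).
have phi0 : phi 0 = 0.
  by have := phiL 1 0 0; rewrite mul1r scale1r addr0 => /eqP; rewrite -subr_eq0 opprD addNKr oppr_eq0 => /eqP.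
have phis (c : 'I_d -> k) : phi (\sum_i c i *: X`_i) = \sum_i c i * phi (tnth X i).
  by elim/big_rec2: _ => [//|i y1 y2 _ <-]; rewrite phiL (tnth_nth 0).
have kerF : (U :&: lker F = 0)%VS.
  apply/eqP; rewrite -subv0; apply/subvP=> x; rewrite memv_cap memv_ker FE memv0.
  move=> /andP[xU /eqP/rowP x0]; apply/eqP/nd => // y yU.
  rewrite (coord_vbasis yU) kfs big1 // => i _.
  by have := x0 i; rewrite !mxE => ->; rewrite mulr0.
have FU : (F @: U)%VS = fullv.
  apply/eqP; rewrite eqEdim subvf (limg_dim_eq kerF) dimvf /dim /= mul1n.
  exact: leqnn.
have /memv_imgP[x xU xE] : (\row_i phi (tnth X i)) \in (F @: U)%VS by rewrite FU memvf.
exists x => // y yU; rewrite (coord_vbasis yU) kfs phis; apply: eq_bigr => i _.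
by move/rowP/(_ i): xE; rewrite FE !mxE => ->.
Qed.

(** Represent y |-> tr(D ad y) as the Killing form with some x. For E = D - ad x, the form of Ey and
    z is tr(E ad [y, z]) = 0 by [kf_deriv], so E = 0. *)
Lemma derivation_inner D : derivation br D -> exists x, forall y, D y = br x y.
Proof.
move=> dD; have [||x _ xE] := @kf_repr fullv (fun y => trU fullv (D \o ad br y)%VF).
- by move=> a x y; rewrite ad_lin // comp_lfunDr -comp_lfunZr trUD trUZ.
- by move=> x _ xK; apply: kf_nondeg => y; apply: xK; apply: memvf.
exists x => y; apply/eqP; rewrite -subr_eq0; apply/eqP/kf_nondeg => z.
have -> : D y - br x y = (D - ad br x) y by rewrite add_lfunE opp_lfunE adE.
have dE : derivation br (D - ad br x).
  move=> u v; rewrite !add_lfunE !opp_lfunE !adE // dD jacobi //.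
  by rewrite (brDl lieP) (brDr lieP) (brNl lieP) (brNr lieP) opprD addrACA.
rewrite -(kf_deriv lieP y z dE).
by rewrite comp_lfunDl comp_lfunNl trUD trUN xE ?memvf // subrr.
Qed.

(** The semisimple part of ad x is a derivation because eigenvalues add under the bracket; hence it
    is inner. *)
Lemma jordan_semisimple x : exists s, forall c v, gev (ad br x) c v -> br s v = c *: v.
Proof.
have [s sP] := ex_semisimple_part (ad br x).
have [b [bb gb]] := ex_basis (gev_span (ad br x)).
pose c j := projT1 (constructive_indefinite_description _ (gb j)).
have gc j : gev (ad br x) (c j) (tnth b j).
  exact: projT2 (constructive_indefinite_description _ (gb j)).
have [|y yE] := @derivation_inner s.
  apply: (derivation_basis lieP bb) => i j.
  rewrite !(sP _ _ (gc _)) brZl // brZr // -scalerDl.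
  by apply: sP; apply: gev_br => //; apply: ad_derivation.
by exists y => e v gv; rewrite -yE (sP _ _ gv).
Qed.

End Killing.

Lemma ex_span_list (k : fieldType) (V : vectType k) (P : V -> Prop) :
  exists ts : seq V, (forall t, t \in ts -> P t) /\ forall v, P v -> v \in <<ts>>%VS.
Proof.
have step d : (exists ts : seq V, (forall t, t \in ts -> P t) /\ forall v, P v -> v \in <<ts>>%VS) \/
    exists2 ts : seq V, (d <= \dim <<ts>>)%N & forall t, t \in ts -> P t.
  elim: d => [|d [|[ts dts Pts]]]; [by right; exists [::]|by left|].
  case: (classic (forall v, P v -> v \in <<ts>>%VS)) => [tsP|nP]; first by left; exists ts.
  have [v nv] := not_all_ex_not _ _ nP; have [Pv /negP vts] := imply_to_and _ _ nv.
  right; exists (v :: ts); last by move=> t; rewrite inE => /orP[/eqP->//|/Pts].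
  apply: (leq_ltn_trans dts); rewrite span_cons ltn_neqAle dimvS ?addvSr // andbT.
  apply: contra vts => /eqP dE.
  have /eqP-> : <<ts>>%VS == (<[v]> + <<ts>>)%VS by rewrite eqEdim addvSr dE /=.
  by rewrite memvE addvSl.
case: (step (\dim {:V}).+1) => [//|[ts dts _]].
by move: (leq_trans dts (dimvS (subvf <<ts>>))); rewrite ltnn.
Qed.

Lemma semisimple_part_ker (k : closedFieldType) (V : vectType k) (f : 'End(V)) s v :
  (forall c w, gev f c w -> s w = c *: w) -> linear s -> s v = 0 -> gev f 0 v.
Proof.
move=> sP slin sv; have [b [bb gb]] := ex_basis (gev_span f).
pose c j := projT1 (constructive_indefinite_description _ (gb j)).
have gc j : gev f (c j) (tnth b j).
  exact: projT2 (constructive_indefinite_description _ (gb j)).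
have s0 : s 0 = 0 by rewrite (sP 0) ?scale0r //; apply: gev0.
have sE : s v = \sum_j (coord b j v * c j) *: tnth b j.
  rewrite {1}(basis_coordE v bb).
  elim/big_rec2: _ => [//|j y1 y2 _ <-]; rewrite slin; congr (_ + _).
  by rewrite (sP _ _ (gc j)) scalerA.
have cj j : coord b j v * c j = 0.
  rewrite -(coord_basisE (fun j => coord b j v * c j) j (basis_free bb)) -sE sv.
  by rewrite linear0.
rewrite (basis_coordE v bb); apply: gev_sum => j _.
have /eqP := cj j; rewrite mulf_eq0 => /orP[/eqP->|/eqP <-].
  by rewrite scale0r; apply: gev0.
exact: gevZ.
Qed.

(** * Cartan subalgebras of fixed-point algebras *)

Section Cartan.
Variables (k : closedFieldType) (g : vectType k) (br : g -> g -> g).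
Variable io : {rmorphism rat -> k}.
Hypothesis lieP : is_lie br.
Hypothesis simpleP : simple_in br fullv.
Variables (n : nat) (sigma : 'I_n -> 'End(g)) (h : {vspace g}).
Hypothesis autP : forall i, is_lie_aut br (sigma i).
Hypothesis sigmaC : forall i j x, sigma i (sigma j x) = sigma j (sigma i x).
Hypothesis sigma_diag : forall i, diagop (sigma i).
Hypothesis cartanP : cartan_sub br (gsig sigma) h.

Lemma mem_gsig x : (x \in gsig sigma) <-> forall i, sigma i x = x.
Proof.
rewrite memvE; split=> [/subv_bigcapP H i|H].
  by apply/fixedSpaceP; rewrite memvE H.
by apply/subv_bigcapP => i _; rewrite -memvE; apply/fixedSpaceP.
Qed.

Lemma gsig_br x y : x \in gsig sigma -> y \in gsig sigma -> br x y \in gsig sigma.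
Proof.
move=> /mem_gsig xS /mem_gsig yS; apply/mem_gsig => i.
by rewrite (autP i).2 xS yS.
Qed.

Lemma cartan_gsig x : x \in h -> x \in gsig sigma.
Proof. by case: cartanP => /subvP H _ _ _; apply: H. Qed.

Lemma cartan_br x y : x \in h -> y \in h -> br x y \in h.
Proof. by case: cartanP => _ H _ _; apply: H. Qed.

Lemma cartan_norm x : x \in gsig sigma -> (forall y, y \in h -> br x y \in h) -> x \in h.
Proof. by case: cartanP => _ _ _; apply. Qed.

Lemma cartan_nilp x y : x \in h -> y \in h -> exists N, iter N (br x) y = 0.
Proof.
move=> xh yh; case: cartanP => _ _ [N nilN] _; exists N.
have := nilN (nseq N x) y; rewrite size_nseq => <- //.
  by elim: N {nilN} => //= N ->.
by move=> z /nseqP[->].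
Qed.

Lemma sigma_bij i : exists2 f : 'End(g), forall x, f (sigma i x) = x & forall x, sigma i (f x) = x.
Proof.
have [ker _] := autP i; have k0 : lker (sigma i) == 0%VS by apply/eqP.
by exists (sigma i)^-1%VF; [apply: lker0_lfunK | apply: lker0_lfunVK].
Qed.

Lemma kf_sigma i x y : kf br (sigma i x) (sigma i y) = kf br x y.
Proof.
have [f fK Kf] := sigma_bij i; have [_ sB] := autP i.
have E z : ad br (sigma i z) = (sigma i \o (ad br z \o f))%VF.
  by apply/lfunP=> w; rewrite !comp_lfunE !adE // sB Kf.
have -> : kf br (sigma i x) (sigma i y) = trU fullv (sigma i \o (ad br x \o (ad br y \o f)))%VF.
  by apply: trU_eq => v _; rewrite !E !comp_lfunE fK.
rewrite trU_mulC => [|v _|v _]; rewrite ?memvf //.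
by apply: trU_eq => v _; rewrite !comp_lfunE fK.
Qed.

(** Each [sigma i] fixes x, so sigma_i(s) and s act alike on the generalised eigenspaces of ad x and
    agree, the center being 0. As ad x is nilpotent on h, s centralizes h, and self-normalization
    puts s in h. *)
Lemma cartan_semisimple x : x \in h -> exists s,
  [/\ s \in h, forall c v, gev (ad br x) c v -> br s v = c *: v &
      forall y, y \in h -> br s y = 0].
Proof.
move=> xh; have [s sP] := jordan_semisimple io lieP simpleP x; exists s.
have sh y : y \in h -> br s y = 0.
  move=> yh; rewrite (sP 0) ?scale0r //.
  have [N xy] := cartan_nilp xh yh; exists N.
  by rewrite /shift scale0r subr0 iter_ad.
split=> //; apply: cartan_norm; last by move=> y /sh->; rewrite mem0v.
apply/mem_gsig => i; apply/eqP; rewrite -subr_eq0; apply/eqP.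
apply: (simple_center lieP simpleP); move=> y.
have [b [bb gb]] := ex_basis (gev_span (ad br x)).
have [f fK Kf] := sigma_bij i; have [_ sB] := autP i.
have sx : sigma i x = x by move/cartan_gsig/mem_gsig: xh; apply.
move: y; apply: (basis_ind bb).
- by move=> a u v; rewrite (br_lin_r lieP) => -> ->; rewrite scaler0 addr0.
- by rewrite br0r.
move=> j; have [c gc] := gb j; set v := tnth b j in gc *.
have gfv : gev (ad br x) c (f v).
  apply: (gev_comm (h := f) _ gc) => w.
  by rewrite !adE // -[LHS]fK sB sx Kf.
by rewrite brDl // brNl // (sP _ _ gc) -{1}(Kf v) -sB (sP _ _ gfv) linearZ /= Kf subrr.
Qed.

Definition eig_list (ts : seq g) (x : g) := 
  (forall i, exists c, sigma i x = c *: x) /\ forall t, t \in ts -> exists c, br t x = c *: x.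

Lemma eig_list_span (ts : seq g) v :
  (forall t, t \in ts -> t \in gsig sigma /\ diagop (ad br t)) ->
  (forall t u, t \in ts -> u \in ts -> br t u = 0) ->
  sum_of (eig_list ts) v.
Proof.
move=> tsP tsC.
have [||s sP ->] := @joint_eig _ _ ([seq sigma i | i <- enum 'I_n] ++ [seq ad br t | t <- ts]) v.
- have st i t x : t \in ts -> sigma i (ad br t x) = ad br t (sigma i x).
    by move=> /tsP[/mem_gsig tS _]; rewrite !adE // (autP i).2 tS.
  move=> f f'; rewrite !mem_cat => /orP[] /mapP[x xi ->] /orP[] /mapP[y yi ->] w //.
  + by rewrite st.
  + by rewrite -st.
  by rewrite !adE // (jacobi lieP) (tsC x y) // (br0l lieP) add0r.
- move=> f; rewrite mem_cat => /orP[] /mapP[x xi ->] //.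
  by case: (tsP x xi).
exists s => // x xs; split=> [i|t ti].
  by apply: (sP x xs); rewrite mem_cat map_f ?mem_enum.
have [|c] := sP x xs (ad br t); first by rewrite mem_cat map_f ?orbT.
by rewrite adE // => xE; exists c.
Qed.

Lemma kf0r x : kf br x 0 = 0.
Proof. by rewrite kfC -(scale0r (0 : g)) kfZl ?mul0r. Qed.

Lemma kfDr x y z : kf br z (x + y) = kf br z x + kf br z y.
Proof. by rewrite kfC kfDl // !(kfC _ z). Qed.

Lemma kfZr a x z : kf br z (a *: x) = a * kf br z x.
Proof. by rewrite kfC kfZl // (kfC _ z). Qed.

Lemma kf_eig_orth t c d x y : br t x = c *: x -> br t y = d *: y -> c + d != 0 ->
  kf br x y = 0.
Proof.
move=> tx ty cd; have : kf br (br t x) y + kf br x (br t y) = 0.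
  by rewrite (brC lieP t x) -scaleN1r kfZl // kf_inv // mulN1r addNr.
rewrite tx ty kfZl // kfZr -mulrDl => /eqP.
by rewrite mulf_eq0 (negPf cd) => /eqP.
Qed.

Lemma kf_sigma_orth i c d x y : sigma i x = c *: x -> sigma i y = d *: y -> c * d != 1 ->
  kf br x y = 0.
Proof.
move=> sx sy cd; have := kf_sigma i x y.
rewrite sx sy kfZl // kfZr mulrA -[RHS]mul1r => /eqP.
by rewrite -subr_eq0 -mulrBl mulf_eq0 subr_eq0 (negPf cd) => /eqP.
Qed.

(** Joint eigenspaces of the [sigma i] and of the ad t are orthogonal unless the eigenvalues are
    mutually inverse, respectively opposite. The part fixed by all [sigma i] and killed by all t
    thus pairs only with itself and inherits nondegeneracy. *)
Lemma kf_nondeg_zero (ts : seq g) x :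
  (forall t, t \in ts -> t \in gsig sigma /\ diagop (ad br t)) ->
  (forall t u, t \in ts -> u \in ts -> br t u = 0) ->
  x \in gsig sigma -> (forall t, t \in ts -> br t x = 0) ->
  (forall y, y \in gsig sigma -> (forall t, t \in ts -> br t y = 0) -> kf br x y = 0) ->
  x = 0.
Proof.
move=> tsP tsC /mem_gsig xS xt xK; apply: (kf_nondeg io lieP simpleP) => y.
have [s sP ->] := eig_list_span y tsP tsC.
elim: s sP => [|z s IH] sP; first by rewrite big_nil kf0r.
rewrite big_cons kfDr IH ?addr0; last by move=> u us; apply: sP; rewrite inE us orbT.
have [sz tz] := sP z (mem_head _ _).
case: (classic (z \in gsig sigma /\ forall t, t \in ts -> br t z = 0)) => [[zS zt]|nz].
  exact: xK.
have [zS|] := classic (z \in gsig sigma); last first.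
  move=> nS; have /not_all_ex_not[i nzi] : ~ forall i, sigma i z = z by move/mem_gsig.
  have [c zc] := sz i; apply: (@kf_sigma_orth i 1 c); rewrite ?scale1r //.
  by rewrite mul1r; apply/eqP=> c1; case: nzi; rewrite zc c1 scale1r.
have /not_all_ex_not[t nt] : ~ forall t, t \in ts -> br t z = 0 by move=> zt; case: nz.
have [tts ntz] := imply_to_and _ _ nt; have [c zc] := tz t tts.
apply: (@kf_eig_orth t 0 c); rewrite ?scale0r ?xt ?add0r //.
by apply/eqP=> c0; case: ntz; rewrite zc c0 scale0r.
Qed.

Lemma semisimple_part_diagop x s :
  (forall c v, gev (ad br x) c v -> br s v = c *: v) -> diagop (ad br s).
Proof.
move=> sP v; have [t tP ->] := gev_span (ad br x) v; exists t => // w wt.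
by have [c gc] := tP w wt; exists c; rewrite adE // (sP _ _ gc).
Qed.

(* The centralizer in g^sigma of the semisimple parts of elements of h is h itself,
   by Engel's theorem, so the Killing form is nondegenerate on h. *)
Lemma cartan_kf_nondeg x : x \in h -> (forall y, y \in h -> kf br x y = 0) -> x = 0.
Proof.
pose P t := [/\ t \in h, forall y, y \in h -> br t y = 0 & diagop (ad br t)].
have [ts [tsP tsS]] := ex_span_list P.
have ts1 t : t \in ts -> t \in gsig sigma /\ diagop (ad br t).
  by move=> /tsP[th _ dt]; split=> //; apply: cartan_gsig.
have ts2 t u : t \in ts -> u \in ts -> br t u = 0.
  by move=> /tsP[_ tC _] /tsP[uh _ _]; apply: tC.
have [||C CE] := @ex_vspace _ _ (fun v => v \in gsig sigma /\ forall t, t \in ts -> br t v = 0).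
- by split; [exact: mem0v | move=> t _; rewrite br0r].
- move=> a u v [uS ut] [vS vt]; split; first by rewrite memvD ?memvZ.
  by move=> t tts; rewrite br_lin_r // ut // vt // scaler0 addr0.
have hC : {subset h <= C}.
  move=> y yh; apply/CE; split; first exact: cartan_gsig.
  by move=> t /tsP[_ tC _]; apply: tC.
(* If C were larger than h, Engel modulo h would give v in C outside h with [h, v] in h, against
   self-normalization. Elements of h act nilpotently on C because their semisimple parts kill C. *)
have Ch : {subset C <= h}.
  apply/subvP; apply/negPn/negP => nCh.
  have [|||||v vC [vh hv]] := @engel _ _ br lieP h _ _ h C nCh.
  - exact: cartan_br.
  - exact: cartan_nilp.
  - move=> x' v xh /CE[vS vt]; apply/CE; split.
      by apply: gsig_br => //; apply: cartan_gsig.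
    move=> t tts; rewrite jacobi //; have [_ tC _] := tsP t tts.
    by rewrite (tC x' xh) (br0l lieP) vt // (br0r lieP) addr0.
  - by move=> x' v xh vh; apply: cartan_br.
  - move=> x' v xh /CE[vS vt].
    have [s [sh sP s0]] := cartan_semisimple xh.
    have sts : s \in <<ts>>%VS.
      by apply: tsS; split=> //; apply: (semisimple_part_diagop (x := x')).
    have sv : br s v = 0.
      rewrite (coord_span (X := in_tuple ts) sts) br_suml // big1 // => i _.
      by rewrite brZl // vt ?scaler0 // mem_nth.
    have [|N xN] := @semisimple_part_ker _ _ (ad br x') (br s) v sP _ sv.
      by move=> a u w; rewrite br_lin_r.
    exists N; move: xN; rewrite /shift scale0r subr0 iter_ad // => ->.
    exact: mem0v.
  case/negP: vh; apply: cartan_norm; first by case/CE: vC.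
  by move=> y /hv; rewrite (brC lieP v) memvN.
move=> xh xK; apply: (kf_nondeg_zero ts1 ts2); first exact: cartan_gsig.
  by move=> t /tsP[_ tC _]; apply: tC.
by move=> y yS yt; apply: xK; apply: Ch; apply/CE.
Qed.

(** The difference m of x and its semisimple part is ad-nilpotent and commutes with y in h, so the
    Killing form of m and y is the trace of a nilpotent operator. Nondegeneracy on h gives m = 0. *)
Lemma cartan_center_diag x : x \in h -> (forall y, y \in h -> br x y = 0) -> diagop (ad br x).
Proof.
move=> xh xZ; have [s [sh sP s0]] := cartan_semisimple xh.
suff /eqP : x - s = 0.
  rewrite subr_eq0 => /eqP->; exact: (semisimple_part_diagop (x := x)).
apply: cartan_kf_nondeg; first by rewrite memvB.
move=> y yh; set m := x - s.
have my v : br m (br y v) = br y (br m v).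
  by rewrite (jacobi lieP m) brDl // brNl // xZ // s0 // oppr0 addr0 br0l // add0r.
have mn v : gev (ad br m) 0 v.
  have [t tP ->] := gev_span (ad br x) v; rewrite big_seq; apply: gev_sum => w wt.
  have [c [N cN]] := tP w wt; exists N.
  suff [-> _] : iter N (shift (ad br m) 0) w = iter N (shift (ad br x) c) w /\
        gev (ad br x) c (iter N (shift (ad br x) c) w) by [].
  have gw : gev (ad br x) c w by exists N.
  elim: (N) => [//|M [IH1 IH2]]; split; last exact: gev_shift.
  rewrite !iterS IH1 shiftE scale0r subr0 adE // brDl // brNl // (sP _ _ IH2).
  by rewrite shiftE adE.
apply: trU_nilp => v _; first exact: memvf.
have [N mN] := mn v; exists N.
have -> : iter N (ad br m \o ad br y)%VF v = iter N (br y) (iter N (br m) v).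
  elim: (N) => // M IH; rewrite iterS IH comp_lfunE !adE //.
  by rewrite -[br y _]iterS -(iter_comm M.+1 _ (fun v => esym (my v))).
by move: mN; rewrite /shift scale0r subr0 iter_ad // => ->; elim: (N) => //= M ->; rewrite br0r.
Qed.

(** Take z = [x1, z'] nonzero in the last term of the lower central series of h. It is central in h,
    hence diagonalisable on g. On its eigenspace for c it acts both as the scalar c and as a
    commutator of operators, so the trace gives c = 0. Then z is central in g, so z = 0. *)
Lemma cartan_abelian x y : x \in h -> y \in h -> br x y = 0.
Proof.
move=> xh yh; apply/eqP/negPn/negP => xy.
pose Q M := forall (xs : seq g) (y : g), size xs = M ->
    (forall x, x \in xs -> x \in h) -> y \in h -> foldr br y xs = 0.
have [N QN] : exists N, Q N by case: cartanP => _ _ [N QN] _; exists N.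
have nQ1 : ~ Q 1%N.
  move=> /(_ [:: x] y erefl) Q1; case/eqP: xy; apply: Q1 => // z.
  by rewrite inE => /eqP->.
have fh xs z : (forall x, x \in xs -> x \in h) -> z \in h -> foldr br z xs \in h.
  move=> xsh zh; elim: xs xsh => //= w xs IH xsh; apply: cartan_br.
    by apply: xsh; rewrite mem_head.
  by apply: IH => u us; apply: xsh; rewrite inE us orbT.
have [M [nQM QM]] : exists M, ~ Q M.+1 /\ Q M.+2.
  elim: N QN => [Q0|N IH QN].
    have x0 : x = 0 by apply: (Q0 [::] x).
    by case/eqP: xy; rewrite x0 br0l.
  case: (classic (Q N)) => [/IH//|nQN]; case: N {IH} nQN QN => [|N] nQN QN; last by exists N.
  by case: nQ1.
have /not_all_ex_not[[|x1 xs]] := nQM; first by case; move=> ? [].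
move=> /not_all_ex_not[y1 nQ']; have [sxs nQ2] := imply_to_and _ _ nQ'.
have [xsh nQ3] := imply_to_and _ _ nQ2; have [y1h z0] := imply_to_and _ _ nQ3.
pose z' := foldr br y1 xs; pose z := br x1 z'.
have x1h : x1 \in h by apply: xsh; rewrite mem_head.
have z'h : z' \in h by apply: fh => // u us; apply: xsh; rewrite inE us orbT.
have zh : z \in h by apply: cartan_br.
have zZ w : w \in h -> br z w = 0.
  move=> wh; rewrite brC //; apply/eqP; rewrite oppr_eq0; apply/eqP.
  apply: (QM (w :: x1 :: xs)) => //; first by rewrite /= in sxs *; rewrite sxs.
  by move=> u; rewrite inE => /orP[/eqP->|/xsh].
have zd := cartan_center_diag zh zZ.
apply: z0; rewrite -/(z); apply: (simple_center lieP simpleP) => v.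
have [t tP ->] := zd v; rewrite br_sumr // big_seq big1 // => w /tP[c].
rewrite adE // => zw.
have [c0|c0] := eqVneq c 0; first by rewrite zw c0 scale0r.
have [||U UE] := @ex_vspace _ _ (fun v => br z v = c *: v).
- by rewrite br0r // scaler0.
- by move=> a u1 u2 e1 e2; rewrite br_lin_r // e1 e2 scalerDr !scalerA mulrC.
have stab u : u \in h -> forall v, v \in U -> ad br u v \in U.
  move=> uh u' /UE e; apply/UE; rewrite adE // jacobi // zZ // br0l // add0r e.
  by rewrite brZr.
have : trU U (ad br z) = 0.
  by rewrite ad_br // trUD trUN (trU_mulC (stab _ x1h) (stab _ z'h)) subrr.
rewrite (trU_scal (c := c)) => [/eqP|u /UE]; last by rewrite adE.
rewrite mulf_eq0 (negPf c0) -(rmorph_nat io) fmorph_eq0 pnatr_eq0 dimv_eq0 => /eqP U0.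
by have : w \in U by [apply/UE]; rewrite U0 memv0 => /eqP->; rewrite br0r.
Qed.

Lemma cartan_diag x : x \in h -> diagop (ad br x).
Proof. by move=> xh; apply: cartan_center_diag => // y yh; apply: cartan_abelian. Qed.

End Cartan.

(** * Representations of sl2 *)

Section Sl2.
Variables (k : closedFieldType) (V : vectType k).
Variable io : {rmorphism rat -> k}.

Definition sl2_ops (E F H : 'End(V)) : Prop :=
  [/\ forall v, E (F v) = F (E v) + H v,
      forall v, H (E v) = E (H v) + 2%:R *: E v &
      forall v, H (F v) = F (H v) - 2%:R *: F v].

Lemma sl2_sym E F H : sl2_ops E F H -> sl2_ops F E (- H).
Proof.
move=> [ef he hf]; split=> v; rewrite !opp_lfunE.
- by rewrite ef addrK.
- by rewrite hf linearN /= opprB addrC.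
- by rewrite he linearN /= opprD.
Qed.

Lemma natk_eq0 m : (m%:R == 0 :> k) = (m == 0%N).
Proof. by rewrite -(rmorph_nat io) fmorph_eq0 pnatr_eq0. Qed.

Lemma natk_inj : injective (fun m : nat => m%:R : k).
Proof.
move=> m p /= /eqP; rewrite -!(rmorph_nat io) (inj_eq (fmorph_inj io)) eqr_nat.
by move/eqP.
Qed.

Lemma eig_finite (f : 'End(V)) : exists s : seq k, forall c v, f v = c *: v -> v != 0 -> c \in s.
Proof.
have [b [bb gb]] := ex_basis (gev_span f).
pose c j := projT1 (constructive_indefinite_description _ (gb j)).
have gc j : gev f (c j) (tnth b j).
  exact: projT2 (constructive_indefinite_description _ (gb j)).
exists (codom c) => e v fv; apply: contraNT => ec.
rewrite (basis_coordE v bb) big1 // => j _.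
rewrite (gev_basis_coord bb gc (gev_eig fv)) ?scale0r //.
by apply: contraNneq ec => <-; apply: codom_f.
Qed.

Variables E F H : 'End(V).
Hypothesis sl2P : sl2_ops E F H.

Lemma sl2_EF v : E (F v) = F (E v) + H v. Proof. by case: sl2P. Qed.

Lemma sl2_wtE x v : H v = x *: v -> H (E v) = (x + 2%:R) *: E v.
Proof. by case: sl2P => _ he _ hv; rewrite he hv linearZ scalerDl. Qed.

Lemma sl2_wtF x v : H v = x *: v -> H (F v) = (x - 2%:R) *: F v.
Proof. by case: sl2P => _ _ hf hv; rewrite hf hv linearZ scalerBl. Qed.

Lemma sl2_wtEn x v n : H v = x *: v -> H (iter n E v) = (x + (2 * n)%:R) *: iter n E v.
Proof.
move=> hv; elim: n => [|n IH]; first by rewrite muln0 addr0.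
by rewrite iterS (sl2_wtE IH) (_ : x + (2 * n.+1)%:R = x + (2 * n)%:R + 2%:R) //; ring.
Qed.

Lemma sl2_wtFn x v n : H v = x *: v -> H (iter n F v) = (x - (2 * n)%:R) *: iter n F v.
Proof.
move=> hv; elim: n => [|n IH]; first by rewrite muln0 subr0.
by rewrite iterS (sl2_wtF IH) (_ : x - (2 * n.+1)%:R = x - (2 * n)%:R - 2%:R) //; ring.
Qed.

Lemma sl2_Enil x v : H v = x *: v -> exists N, iter N E v = 0.
Proof.
move=> hv; have [s sP] := eig_finite H.
apply: NNPP => nN; pose t := [seq x + (2 * i)%:R | i <- iota 0 (size s).+1].
have ts : {subset t <= s}.
  move=> _ /mapP[i _ ->]; apply: sP (sl2_wtEn i hv) _.
  by apply/eqP=> Ei; case: nN; exists i.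
have ut : uniq t.
  rewrite map_inj_uniq ?iota_uniq // => i j /addrI/natk_inj/eqP.
  by rewrite eqn_mul2l => /eqP.
by have := uniq_leq_size ut ts; rewrite size_map size_iota ltnn.
Qed.

Lemma sl2_EFn x v n : H v = x *: v ->
  E (iter n.+1 F v) = iter n.+1 F (E v) + (n.+1%:R * (x - n%:R)) *: iter n F v.
Proof.
move=> hv; elim: n => [|n IH].
  by rewrite /= sl2_EF hv subr0 mul1r.
rewrite iterS sl2_EF IH linearD /= linearZ /= (sl2_wtFn n.+1 hv) -addrA -scalerDl.
have -> // : n.+1%:R * (x - n%:R) + (x - (2 * n.+1)%:R) = n.+2%:R * (x - n.+1%:R) by ring.
Qed.

(** In weight p >= 0 the operator FE has no negative integer eigenvalue. For a counterexample v, the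
    vector Ev satisfies the same hypotheses with weight p + 2 and eigenvalue -(a + 1) - (p + 2), so
    Ev = 0 by induction on the nilpotency of E on v; then FEv = 0. *)
Lemma sl2_fe_neg p a v : H v = p%:R *: v -> F (E v) = - (a.+1%:R *: v) -> v = 0.
Proof.
move=> hv; have [N] := sl2_Enil hv.
elim: N p a v hv => [|N IH] p a v hv; first by [].
rewrite iterSr => EN fe.
have Ev0 : E v = 0.
  apply: (IH (p + 2)%N (a + (p + 2))%N) => //; first by rewrite natrD; apply: sl2_wtE.
  have := sl2_EF (E v); rewrite fe linearN linearZ /= (sl2_wtE hv) => /eqP.
  rewrite -subr_eq => /eqP <-; rewrite -opprD -scalerDl.
  by rewrite (_ : a.+1%:R + (p%:R + 2%:R) = (a + (p + 2)).+1%:R) //; ring.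
move: fe; rewrite Ev0 linear0 => /eqP; rewrite eq_sym oppr_eq0 scaler_eq0 natk_eq0 /=.
by move/eqP.
Qed.

(** Apply E to F^(t+1) v = 0: by [sl2_EFn], F^t kills (t+1)(p-t) v + FEv, which has the same weight
    and so is 0 by induction. Then FEv is a negative multiple of v, which [sl2_fe_neg] excludes. *)
Lemma sl2_Finj p t v : H v = p%:R *: v -> (t <= p)%N -> iter t F v = 0 -> v = 0.
Proof.
elim: t v => [//|t IH] v hv tp Fv.
have := sl2_EFn t hv; rewrite Fv linear0 => /esym.
have comm : iter t.+1 F (E v) = iter t F (F (E v)) by rewrite iterSr.
rewrite comm addrC -iter_lin => Ft; have ltp := ltnW tp.
have fev : H (F (E v)) = p%:R *: F (E v).
  by have := sl2_wtF (sl2_wtE hv); rewrite addrK.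
have u0 : (t.+1%:R * (p%:R - t%:R)) *: v + F (E v) = 0.
  by apply: IH => //; rewrite linearD linearZ /= hv fev scalerDr !scalerA mulrC.
apply: (@sl2_fe_neg p (t.+1 * (p - t)).-1) => //.
rewrite prednK ?muln_gt0 ?subn_gt0 // natrM natrB //.
by move/eqP: u0; rewrite addrC addr_eq0 => /eqP.
Qed.

End Sl2.

Section Sl2Sym.
Variables (k : closedFieldType) (V : vectType k).
Variable io : {rmorphism rat -> k}.
Variables E F H : 'End(V).
Hypothesis sl2P : sl2_ops E F H.
Let sl2N := sl2_sym sl2P.

Lemma opp_wt x v : H v = x *: v -> (- H) v = (- x) *: v.
Proof. by rewrite opp_lfunE => ->; rewrite scaleNr. Qed.

Lemma sl2_Fnil x v : H v = x *: v -> exists N, iter N F v = 0.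
Proof. by move/opp_wt; apply: sl2_Enil io _ _ _ sl2N _ _. Qed.

Lemma sl2_Einj p t v : H v = (- p%:R) *: v -> (t <= p)%N -> iter t E v = 0 -> v = 0.
Proof. by move/opp_wt; rewrite opprK; apply: sl2_Finj io _ _ _ sl2N _ _ _. Qed.

Lemma sl2_highest x v : H v = x *: v -> E v = 0 -> v != 0 -> exists p : nat, x = p%:R.
Proof.
move=> hv ev v0; have [N FN] := sl2_Fnil hv.
have [n [nz Fz]] : exists n, iter n F v != 0 /\ iter n.+1 F v = 0.
  elim: N FN => [/eqP|N IH FN]; first by rewrite /= (negPf v0).
  by have [/IH //|nz] := eqVneq (iter N F v) 0; exists N.
exists n; have := sl2_EFn sl2P n hv; rewrite Fz ev linear0 iter_lin0 add0r => /esym/eqP.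
by rewrite scaler_eq0 (negPf nz) orbF mulf_eq0 (natk_eq0 io) /= subr_eq0 => /eqP.
Qed.

Lemma sl2_integral x v : H v = x *: v -> v != 0 -> exists c : int, x = c%:~R.
Proof.
move=> hv v0; have [N EN] := sl2_Enil io sl2P hv.
have [n [nz Ez]] : exists n, iter n E v != 0 /\ iter n.+1 E v = 0.
  elim: N EN => [/eqP|N IH EN]; first by rewrite /= (negPf v0).
  by have [/IH //|nz] := eqVneq (iter N E v) 0; exists N.
have [p pE] := sl2_highest (sl2_wtEn sl2P n hv) Ez nz.
exists (p%:Z - (2 * n)%:Z); rewrite intrD intrN -!pmulrn -pE addrK.
by [].
Qed.

Lemma sl2_Fpos p v : H v = p.+1%:R *: v -> F v = 0 -> v = 0.
Proof. by move=> hv; apply: (sl2_Finj io sl2P (t := 1) hv). Qed.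

Lemma sl2_Eneg p v : H v = (- p.+1%:R) *: v -> E v = 0 -> v = 0.
Proof. by move=> hv; apply: (sl2_Einj (t := 1) hv). Qed.

Lemma sl2_lowest q v : H v = (- q%:R) *: v -> F v = 0 -> iter q.+1 E v = 0.
Proof.
move=> hv Fv; apply: (@sl2_Fpos q.+1).
  rewrite (sl2_wtEn sl2P _ hv) (_ : - q%:R + (2 * q.+1)%:R = q.+2%:R) //; ring.
have := sl2_EFn sl2N q (opp_wt hv).
by rewrite Fv iter_lin0 add0r opprK subrr mulr0 scale0r.
Qed.

(** For c + 2 > 0, F is injective on the weight of w. Otherwise c < 0, so Eu is a nonzero multiple
    of w. If Fw = 0, then w is a lowest weight vector of weight -q, so E^(q+1) w = 0 and E^(q+2) u =
    0, although E^(q+2) is injective in weight -(q+2). *)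
Lemma sl2_adjacent (c : int) a u w : H u = c%:~R *: u -> u != 0 ->
  H w = (c + 2)%:~R *: w -> w != 0 -> E u = a *: w -> F w != 0.
Proof.
move=> hu u0 hw w0 Eu; have [c2|c2] := lerP (c + 2) 0; last first.
  apply: contraNneq w0 => Fw; apply/eqP; apply: (@sl2_Fpos (absz (c + 1)) w _ Fw).
  by rewrite hw pmulrn (_ : c + 2 = (absz (c + 1)).+1%:Z) //; lia.
pose q := absz (c + 2); have cE : c = - (q.+2)%:Z by rewrite /q; lia.
have hu' : H u = (- q.+2%:R) *: u by rewrite hu cE rmorphN.
have Eu0 : E u != 0 by apply: contraNneq u0 => Ez; apply/eqP/(sl2_Eneg hu' Ez).
have a0 : a != 0 by apply: contraNneq Eu0 => a0; rewrite Eu a0 scale0r.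
apply: contraNneq u0 => Fw; apply/eqP/(sl2_Einj hu' (leqnn _)).
rewrite iterSr; apply: sl2_lowest; last by rewrite Eu linearZ /= Fw scaler0.
by rewrite (sl2_wtE sl2P hu') (_ : - q.+2%:R + 2%:R = - q%:R) //; ring.
Qed.

End Sl2Sym.

(** Cartan integers of q_i = e_i - e_(i+1), where e_0, ..., e_(l-1) are orthogonal of square length
    [D] and e_l = 0; the tests against [l] account for the vanishing e_l. *)
Lemma BCartan_quotient (D : rat) (i j l : nat) : D != 0 -> (i < l)%N -> (j < l)%N ->
  2%:R * ((if i == j then D else 0) - (if i == j.+1 then D else 0) -
   ((if (i.+1 == j) && (i.+1 < l)%N then D else 0) -
    (if (i == j) && (i.+1 < l)%N then D else 0))) /
  (D - 0 - (0 - (if (j.+1 < l)%N then D else 0))) =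
  (if i == j then 2 else
    if (i.+1 == j) && (j == l.-1) then -2
    else if (i.+1 == j) || (i == j.+1) then -1 else 0)%:~R.
Proof.
move=> D0 il jl; have DD : D + D != 0 by rewrite -mulr2n -mulr_natl mulf_neq0.
have [ij|ij] := eqVneq i j.
  rewrite ij (ltn_eqF (ltnSn j)) (gtn_eqF (ltnSn j)) /=.
  by case: ifP => _; rewrite !subr0 ?sub0r ?opprK mulfK.
have -> : (j == l.-1)%N = ~~ (j.+1 < l)%N by lia.
have [ij1|ij1] := eqVneq i.+1 j.
  have -> : (i == j.+1)%N = false by lia.
  have -> : (i.+1 < l)%N by lia.
  case: ifP => _ /=; rewrite !subr0 ?sub0r ?opprK ?andbF /=.
    by apply: (canLR (mulfK DD)); ring.
  by apply: (canLR (mulfK D0)); ring.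
have [ij2|ij2] := eqVneq i j.+1; last by rewrite /= !subr0 mulr0 mul0r.
have -> : (j.+1 < l)%N by lia.
rewrite /= !subr0 ?sub0r ?opprK.
by apply: (canLR (mulfK DD)); ring.
Qed.

Lemma count_lt (T : eqType) (s : seq T) (P Q : pred T) y :
  (forall x, P x -> Q x) -> y \in s -> Q y -> ~~ P y -> (count P s < count Q s)%N.
Proof.
move=> PQ ys Qy nPy; elim: s ys => //= x s IH; rewrite inE => /orP[/eqP <-|/IH lt].
  by rewrite Qy (negPf nPy) add0n add1n ltnS; apply: sub_count.
by rewrite -addnS leq_add //; case: (P x) (PQ x) => // ->.
Qed.

(** * Root systems, possibly non-reduced *)

Section Dot.
Variable N : nat.
Implicit Types (u v w : 'rV[rat]_N) (a : rat).

Definition dot u v : rat := \sum_i u 0 i * v 0 i.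

Lemma dotC u v : dot u v = dot v u.
Proof. by apply: eq_bigr => i _; rewrite mulrC. Qed.
Lemma dotDl u v w : dot (u + v) w = dot u w + dot v w.
Proof. by rewrite -big_split; apply: eq_bigr => i _; rewrite mxE mulrDl. Qed.
Lemma dotZl a u w : dot (a *: u) w = a * dot u w.
Proof. by rewrite mulr_sumr; apply: eq_bigr => i _; rewrite mxE mulrA. Qed.
Lemma dotNl u w : dot (- u) w = - dot u w.
Proof. by rewrite -scaleN1r dotZl mulN1r. Qed.
Lemma dotDr u v w : dot w (u + v) = dot w u + dot w v.
Proof. by rewrite dotC dotDl !(dotC w). Qed.
Lemma dotZr a u w : dot w (a *: u) = a * dot w u.
Proof. by rewrite dotC dotZl (dotC w). Qed.
Lemma dotNr u w : dot w (- u) = - dot w u.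
Proof. by rewrite dotC dotNl (dotC w). Qed.
Definition dotE := (dotDl, dotDr, dotNl, dotNr, dotZl, dotZr).
Lemma dot0l w : dot 0 w = 0.
Proof. by rewrite -(scale0r (0 : 'rV_N)) dotZl mul0r. Qed.
Lemma dot0r w : dot w 0 = 0.
Proof. by rewrite dotC dot0l. Qed.
Lemma dot_suml (I : Type) (r : seq I) (P : pred I) (F : I -> 'rV[rat]_N) w :
  dot (\sum_(i <- r | P i) F i) w = \sum_(i <- r | P i) dot (F i) w.
Proof. by elim/big_rec2: _ => [|i y x _ <-]; rewrite ?dot0l ?dotDl. Qed.
Lemma dot_sumr (I : Type) (r : seq I) (P : pred I) (F : I -> 'rV[rat]_N) w :
  dot w (\sum_(i <- r | P i) F i) = \sum_(i <- r | P i) dot w (F i).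
Proof. by elim/big_rec2: _ => [|i y x _ <-]; rewrite ?dot0r ?dotDr. Qed.
Lemma dot_ge0 u : 0 <= dot u u.
Proof. by apply: sumr_ge0 => i _; rewrite -expr2 sqr_ge0. Qed.
Lemma dot_eq0 u : (dot u u == 0) = (u == 0).
Proof.
apply/eqP/eqP=> [|->]; last exact: dot0l.
move/eqP; rewrite psumr_eq0 => [/allP u0|i _]; last by rewrite -expr2 sqr_ge0.
apply/rowP=> i; have := u0 i (mem_index_enum _); rewrite mulf_eq0 orbb => /eqP->.
by rewrite mxE.
Qed.
Lemma dot_gt0 u : (0 < dot u u) = (u != 0).
Proof. by rewrite lt_neqAle dot_ge0 andbT eq_sym dot_eq0. Qed.
Lemma dot_CS u v : dot u v ^+ 2 <= dot u u * dot v v.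
Proof.
have [->|v0] := eqVneq v 0; first by rewrite !dot0r expr0n mulr0.
have := dot_ge0 (dot v v *: u - dot u v *: v); rewrite !dotE (dotC v u).
have : 0 < dot v v by rewrite dot_gt0.
move: (dot v v) (dot u v) (dot u u) => x y z x0 H.
rewrite -subr_ge0 -(pmulr_rge0 _ x0); apply: le_trans H _.
by rewrite le_eqVlt; apply/orP; left; apply/eqP; ring.
Qed.

(** The Cartan number of [u] against the coroot of [v]; it is 0 for v = 0, by the convention for
    inverses. *)
Definition cn u v : rat := 2%:R * dot u v / dot v v.
Definition refl v u : 'rV[rat]_N := u - cn u v *: v.

Lemma cnDl u v w : cn (u + v) w = cn u w + cn v w.
Proof. by rewrite /cn dotDl; ring. Qed.
Lemma cnZl a u w : cn (a *: u) w = a * cn u w.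
Proof. by rewrite /cn dotZl; ring. Qed.
Lemma cnNl u w : cn (- u) w = - cn u w.
Proof. by rewrite -scaleN1r cnZl mulN1r. Qed.
Lemma cnxx u : u != 0 -> cn u u = 2%:R.
Proof. by rewrite -dot_eq0 => u0; rewrite /cn mulfK. Qed.
Lemma cnZr a u w : a != 0 -> cn u (a *: w) = a^-1 * cn u w.
Proof.
move=> a0; rewrite /cn !dotZr dotZl; have [->|w0] := eqVneq (dot w w) 0.
  by rewrite !mulr0 invr0 !mulr0.
by field; rewrite a0 w0.
Qed.
Lemma cn_dot u v : cn u v * dot v v = 2%:R * dot u v.
Proof.
rewrite /cn; have [/eqP|v0] := eqVneq (dot v v) 0; last by rewrite divfK.
by rewrite dot_eq0 => /eqP->; rewrite !dot0r invr0 !mulr0.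
Qed.
Lemma cn_gt0 u v : v != 0 -> (0 < cn u v) = (0 < dot u v).
Proof. by rewrite -dot_gt0 => v0; rewrite /cn pmulr_lgt0 ?invr_gt0 // pmulr_rgt0. Qed.

Lemma reflD v x y : refl v (x + y) = refl v x + refl v y.
Proof. by rewrite /refl cnDl scalerDl opprD addrACA. Qed.
Lemma reflZ v a x : refl v (a *: x) = a *: refl v x.
Proof. by rewrite /refl cnZl scalerBr scalerA. Qed.
Lemma reflN v x : refl v (- x) = - refl v x.
Proof. by rewrite -scaleN1r reflZ scaleN1r. Qed.
Lemma reflK v x : v != 0 -> refl v (refl v x) = x.
Proof.
move=> v0; have E : cn (refl v x) v = - cn x v.
  by rewrite /refl cnDl cnNl cnZl cnxx //; ring.
by rewrite {1}/refl E scaleNr opprK /refl subrK.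
Qed.
Lemma refl_scale v a x : a != 0 -> refl (a *: v) x = refl v x.
Proof. by move=> a0; rewrite /refl cnZr // scalerA mulrC mulVKf. Qed.
Lemma refl_opp v x : refl (- v) x = refl v x.
Proof. by rewrite -scaleN1r refl_scale // oppr_eq0 oner_eq0. Qed.
Lemma reflvv v : v != 0 -> refl v v = - v.
Proof. by move=> v0; rewrite /refl cnxx // scaler_nat mulr2n opprD addNKr. Qed.
Lemma dot_refl v x y : v != 0 -> dot (refl v x) (refl v y) = dot x y.
Proof.
rewrite -dot_eq0 => v0; rewrite /refl !dotE /cn (dotC v y); field.
by rewrite v0.
Qed.
Lemma refl_orth v x : dot x v = 0 -> refl v x = x.
Proof. by move=> xv; rewrite /refl /cn xv mulr0 mul0r scale0r subr0. Qed.

(** Read each vector as the coefficients of a polynomial: evaluation at a rational number that is a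
    root of none of these polynomials is the required linear form. *)
Lemma generic_functional (s : seq 'rV[rat]_N) : 0 \notin s ->
  exists f : 'rV[rat]_N -> rat, (forall a u v, f (a *: u + v) = a * f u + f v) /\
    forall v, v \in s -> f v != 0.
Proof.
move=> s0; pose q : {poly rat} := \prod_(v <- s) rVpoly v.
have q0 : q != 0.
  rewrite prodf_seq_neq0; apply/allP=> v vs /=.
  by apply: contraNneq s0 => v0; rewrite -(rVpolyK v) v0 linear0 in vs.
have [t tq] : exists t : rat, ~~ root q t.
  apply: NNPP => nt; pose r : seq rat := [seq i%:R | i <- iota 0 (size q)].
  have rr : all (root q) r by apply/allP=> t _; apply/negPn/negP=> tq; case: nt; exists t.
  have ur : uniq r.
    by rewrite map_inj_uniq ?iota_uniq // => i j /eqP; rewrite eqr_nat => /eqP.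
  by have := max_poly_roots q0 rr ur; rewrite size_map size_iota ltnn.
exists (fun v => (rVpoly v).[t]); split=> [a u v|v vs].
  by rewrite linearP hornerD hornerZ.
apply: contra tq => /eqP vt; rewrite /root horner_prod.
by rewrite (big_rem v) //= vt mul0r.
Qed.

End Dot.

Section Roots.
Variables (N : nat) (Phi : seq 'rV[rat]_N).
Local Notation V := 'rV[rat]_N.

(** Neither reducedness nor spanning is imposed: the weights of [h] on [g] may form a system of type
    BC, and they sit in a space of dimension dim g. *)
Record root_system : Prop := RootSystem {
  rs_0 : 0 \notin Phi;
  rs_refl : forall a b, a \in Phi -> b \in Phi -> refl a b \in Phi;
  rs_int : forall a b, a \in Phi -> b \in Phi -> exists c : int, cn b a = c%:~R;
  rs_string : forall a b, a \in Phi -> b \in Phi -> 0 < dot a b -> a != b -> a - b \in Phi;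
  rs_irr : forall P : V -> bool,
    (forall a b, a \in Phi -> b \in Phi -> P a -> ~~ P b -> dot a b = 0) ->
    (exists2 a, a \in Phi & P a) -> forall a, a \in Phi -> P a }.

Hypothesis RS : root_system.

Lemma root_neq0 a : a \in Phi -> a != 0.
Proof. by apply: contraTneq => ->; exact: rs_0. Qed.

Lemma root_opp a : a \in Phi -> - a \in Phi.
Proof. by move=> aP; rewrite -(reflvv (root_neq0 aP)) rs_refl. Qed.

Definition indivisible a := forall b, b \in Phi -> a != 2%:R *: b.

Record base l (p : 'I_l -> V) (cf : 'I_l -> V -> rat) : Prop := Base {
  base_root : forall i, p i \in Phi;
  base_lin : forall i a x y, cf i (a *: x + y) = a * cf i x + cf i y;
  base_dual : forall i j, cf i (p j) = (i == j)%:R;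
  base_span : forall a, a \in Phi -> a = \sum_i cf i a *: p i;
  base_sign : forall a, a \in Phi ->
    (forall i, exists n : nat, cf i a = n%:R) \/
    (forall i, exists n : nat, cf i a = - n%:R) }.

(** Simple roots are the indecomposable positive roots for a generic linear form. They are pairwise
    obtuse, since the difference of two acute ones would be a root and decompose one of them; obtuse
    vectors on one side of a hyperplane are independent. *)
Lemma ex_base : exists l (p : 'I_l -> V) (cf : 'I_l -> V -> rat), base p cf.
Proof.
have [f [fL f0]] := generic_functional (rs_0 RS).
have f00 : f 0 = 0 by have := fL (-1) 0 0; rewrite scaler0 addr0 mulN1r addNr.
have fD x y : f (x + y) = f x + f y by rewrite -[x]scale1r fL mul1r scale1r.
have fZ a x : f (a *: x) = a * f x by rewrite -[a *: x]addr0 fL f00 addr0.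
have fN x : f (- x) = - f x by rewrite -scaleN1r fZ mulN1r.
pose Pos := [seq a <- Phi | 0 < f a].
have PosP a : a \in Pos = (0 < f a) && (a \in Phi) by rewrite mem_filter.
pose Pi := undup [seq a <- Pos | ~~ has (fun b => a - b \in Pos) Pos].
pose l := size Pi; pose p (i : 'I_l) := Pi`_i.
have pPi i : p i \in Pi by apply: mem_nth.
have PiP a : a \in Pi -> a \in Pos /\ forall b, b \in Pos -> a - b \notin Pos.
  by rewrite mem_undup mem_filter => /andP[/hasPn H aP]; split.
have comb a : a \in Pos -> exists n : 'I_l -> nat, a = \sum_i (n i)%:R *: p i.
  have [d] := ubnP (count (fun z => f z < f a) Pos).
  elim: d a => // d IH a da aPos.
  case: (boolP (has (fun b => a - b \in Pos) Pos)) => [/hasP[b bP abP]|nh].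
    have lt z y : z \in Pos -> y \in Pos -> z + y = a ->
        (count (fun x => (f x < f z)%R) Pos < d)%N.
      move=> zP yP zya; rewrite -ltnS; apply: leq_trans da; rewrite ltnS.
      have fza : f z < f a.
        by rewrite -zya fD ltrDl; move: yP; rewrite PosP => /andP[].
      apply: (@count_lt _ _ _ _ z) => //; last by rewrite ltxx.
      by move=> x xz; apply: lt_trans fza.
    have [n nE] := IH _ (lt b (a - b) bP abP (subrKC _ _)) bP.
    have [n' nE'] := IH _ (lt (a - b) b abP bP (subrK _ _)) abP.
    exists (fun i => (n i + n' i)%N).
    rewrite -[LHS](subrKC b) {1}nE nE' -big_split; apply: eq_bigr => i _.
    by rewrite natrD scalerDl.
  have aPi : a \in Pi by rewrite mem_undup mem_filter nh.
  have ilt : (index a Pi < l)%N by rewrite index_mem.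
  exists (fun i => (i == Ordinal ilt) : nat).
  rewrite (bigD1 (Ordinal ilt)) //= eqxx scale1r /p nth_index // big1 ?addr0 // => i.
  by move=> /negPf->; rewrite scale0r.
have pPos i : p i \in Pos by case: (PiP _ (pPi i)).
have pPhi i : p i \in Phi by move: (pPos i); rewrite PosP => /andP[].
have fp i : 0 < f (p i) by move: (pPos i); rewrite PosP => /andP[].
have obt i j : i != j -> dot (p i) (p j) <= 0.
  move=> ij; rewrite leNgt; apply/negP=> pij.
  have pd : p i != p j by rewrite /p nth_uniq ?undup_uniq ?ltn_ord.
  have dP := rs_string RS (pPhi i) (pPhi j) pij pd.
  have := f0 _ dP; rewrite neq_lt => /orP[lt0|gt0].
    have dP' : p j - p i \in Pos by rewrite PosP -opprB fN oppr_gt0 lt0 root_opp.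
    by have [_ /(_ _ dP')] := PiP _ (pPi j); rewrite opprB subrKC pPos.
  have dP' : p i - p j \in Pos by rewrite PosP gt0.
  by have [_ /(_ _ (pPos j))] := PiP _ (pPi i); rewrite dP'.
have indep (c : 'I_l -> rat) : \sum_i c i *: p i = 0 -> forall i, c i = 0.
  move=> c0; pose x := \sum_(i | 0 < c i) c i *: p i.
  have xE : x = \sum_(i | ~~ (0 < c i)) (- c i) *: p i.
    apply/eqP; rewrite -subr_eq0 -sumrN.
    under [X in _ + X]eq_bigr => i _ do rewrite scaleNr opprK.
    by rewrite /x -(bigID (fun i => 0 < c i) xpredT (fun i => c i *: p i)) /= c0.
  have fsum (P : pred 'I_l) F : f (\sum_(i | P i) F i) = \sum_(i | P i) f (F i).
    by elim/big_rec2: _ => [//|i y1 y2 _ <-]; rewrite fD.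
  have x0 : x = 0.
    apply/eqP; rewrite -dot_eq0 eq_le dot_ge0 andbT {2}xE /x.
    rewrite dot_suml; apply: sumr_le0 => i ci; rewrite dot_sumr; apply: sumr_le0 => j cj.
    rewrite dotZl dotZr mulrA; apply: mulr_ge0_le0.
      by rewrite mulr_ge0 ?(ltW ci) // oppr_ge0 leNgt.
    by apply: obt; apply: contraNneq cj => ij; rewrite -ij.
  have fx := f00; rewrite -{1}x0 /x fsum in fx.
  have fx' := f00; rewrite -{1}x0 xE fsum in fx'.
  move=> i; case: (ltrP 0 (c i)) => ci.
    move/eqP: fx; rewrite psumr_eq0 => [/allP/(_ i (mem_index_enum _))|j cj].
      by rewrite ci fZ mulf_eq0 (gt_eqF (fp i)) orbF => /eqP.
    by rewrite fZ mulr_ge0 // ltW.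
  move/eqP: fx'; rewrite psumr_eq0 => [/allP/(_ i (mem_index_enum _))|j].
    by rewrite -leNgt ci fZ mulf_eq0 (gt_eqF (fp i)) orbF oppr_eq0 => /eqP.
  by rewrite -leNgt => cj; rewrite fZ mulr_ge0 ?oppr_ge0 // ltW.
pose P := \matrix_(i < l) p i.
have rfP : row_free P.
  rewrite -kermx_eq0; apply/eqP/row_matrixP => i; rewrite row0.
  have : row i (kermx P) *m P = 0 by rewrite -row_mul mulmx_ker row0.
  rewrite mulmx_sum_row => uP; apply/rowP=> j; rewrite [RHS]mxE.
  by apply: (indep (fun j => row i (kermx P) 0 j)); rewrite -[RHS]uP; apply: eq_bigr => t _; rewrite rowK.
pose cf (i : 'I_l) (x : V) := (x *m pinvmx P) 0 i.
have cfL i a x y : cf i (a *: x + y) = a * cf i x + cf i y.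
  by rewrite /cf mulmxDl -scalemxAl !mxE.
have cfp i j : cf i (p j) = (i == j)%:R.
  have -> : p j = row j P by rewrite rowK.
  by rewrite /cf -row_mul mulmxVp // row1 !mxE eqxx eq_sym.
have cf0 i : cf i 0 = 0 by rewrite /cf mul0mx mxE.
have cfs i (c : 'I_l -> rat) : cf i (\sum_j c j *: p j) = c i.
  transitivity (\sum_j c j * cf i (p j)).
    by elim/big_rec2: _ => [//|j y1 y2 _ <-]; rewrite cfL.
  rewrite (bigD1 i) //= cfp eqxx mulr1 big1 ?addr0 // => j ji.
  by rewrite cfp eq_sym (negPf ji) mulr0.
have dec a : a \in Phi -> exists n : 'I_l -> nat,
    a = \sum_i (n i)%:R *: p i \/ a = \sum_i (- (n i)%:R) *: p i.
  move=> aP; have := f0 _ aP; rewrite neq_lt => /orP[lt0|gt0].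
    have [|n nE] := comb (- a); first by rewrite PosP fN oppr_gt0 lt0 root_opp.
    exists n; right; rewrite -[a]opprK nE -sumrN.
    by apply: eq_bigr => i _; rewrite scaleNr.
  by have [|n nE] := comb a; [rewrite PosP gt0 | exists n; left].
exists l, p, cf; split=> // a /dec[n [->|->]].
- by apply: eq_bigr => i _; rewrite cfs.
- by apply: eq_bigr => i _; rewrite cfs.
- by left=> i; exists (n i); rewrite cfs.
by right=> i; exists (n i); rewrite cfs.
Qed.

(** Induction on height: some p_i is acute to a, and reflecting in it lowers the height. A root with
    a second nonzero coordinate stays positive; a multiple n p_i must be p_i itself, because 2/n is
    an integer and a is indivisible. *)
Lemma base_height l (p : 'I_l -> V) cf (S : V -> Prop) : base p cf ->
  (forall i, S (p i)) ->
  (forall i x, x \in Phi -> S x -> S (refl (p i) x)) ->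
  forall a, a \in Phi -> indivisible a -> (forall i, exists n : nat, cf i a = n%:R) -> S a.
Proof.
move=> B Sp Sr a; have [d] := ubnP (\sum_i Num.truncn (cf i a)).
elim: d a => // d IH a; rewrite ltnS => ad aP aI aN.
have cf0 i : cf i 0 = 0.
  by have := base_lin B i (-1) 0 0; rewrite scaler0 addr0 mulN1r addNr.
have cfB i x c y : cf i (x - c *: y) = cf i x - c * cf i y.
  by rewrite addrC -scaleNr (base_lin B) mulNr addrC.
have pn0 i : p i != 0 by apply/root_neq0/(base_root B).
have [i pi] : exists i, 0 < dot a (p i).
  apply: NNPP => np; have a0 := root_neq0 aP; move: a0; rewrite -dot_gt0.
  rewrite {2}(base_span B aP) dot_sumr ltNge sumr_le0 // => i _.
  rewrite dotZr; have [n ->] := aN i.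
  rewrite mulr_ge0_le0 ?ler0n // leNgt; apply/negP=> lt; apply: np; by exists i.
case: (classic (exists2 j, j != i & cf j a != 0)) => [[j ji cj]|nj]; last first.
  have aE : a = cf i a *: p i.
    rewrite {1}(base_span B aP) (bigD1 i) //= big1 ?addr0 // => j ji.
    have [->|cj] := eqVneq (cf j a) 0; first by rewrite scale0r.
    by case: nj; exists j.
  have [n nE] := aN i; have [c cE] := rs_int RS aP (base_root B i).
  have n0 : n%:R != 0 :> rat.
    by rewrite -nE; apply: contraTneq (root_neq0 aP) => c0; rewrite aE c0 scale0r eqxx.
  move: cE; rewrite aE cnZr nE // cnxx // => cE.
  have : (c * n)%:~R = 2%:R :> rat.
    by rewrite intrM -cE -pmulrn mulrAC mulVf // mul1r.
  move/eqP; rewrite (_ : 2%:R = 2%:~R) // eqr_int => /eqP cn2.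
  have [nE'|nE'] : n = 1%N \/ n = 2%N.
    clear - cn2; case: n cn2 => [|[|[|n]]] cn2; [|by left|by right|].
      by rewrite mulr0 in cn2.
    have [c0|c0] := lerP c 0; nia.
    by rewrite nE' scale1r; apply: Sp.
  by have /eqP := aI _ (base_root B i); rewrite {1}aE nE nE'.
pose b := refl (p i) a; have bP : b \in Phi by apply: rs_refl (base_root B i) _.
have bI : indivisible b.
  move=> c cP; apply/eqP=> bE; have := aI _ (rs_refl RS (base_root B i) cP).
  by rewrite -reflZ -bE /b reflK // eqxx.
have cfb t : cf t b = cf t a - cn a (p i) * (t == i)%:R.
  by rewrite /b /refl cfB (base_dual B).
have [c cE] := rs_int RS (base_root B i) aP.
have c0 : 0 < c by rewrite -(ltr0z rat) -cE cn_gt0.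
have bN : forall t, exists n : nat, cf t b = n%:R.
  have [//|bneg] := base_sign B bP.
  have [m mE] := bneg j; move: mE; rewrite cfb (negPf ji) mulr0 subr0.
  have [m' m'E] := aN j; rewrite m'E => mE.
  have : (m' + m)%:R == 0 :> rat by rewrite natrD mE addNr.
  rewrite pnatr_eq0 addn_eq0 => /andP[/eqP m'0 _].
  by move: cj; rewrite m'E m'0 eqxx.
rewrite -[a](reflK _ (pn0 i)); apply: Sr => //; apply: IH => //.
apply: leq_trans ad; rewrite (bigD1 i) //= [X in (_ < X)%N](bigD1 i) //=.
rewrite (eq_bigr (fun t => Num.truncn (cf t a))) => [|t ti]; last first.
  by rewrite cfb (negPf ti) mulr0 subr0.
rewrite ltn_add2r.
have [n nE] := aN i; have [n' n'E] := bN i; rewrite nE n'E !natrK.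
move: n'E; rewrite cfb eqxx mulr1 nE cE => /eqP.
rewrite -(ltr_nat rat) => /eqP <-; rewrite ltrBlDr ltrDl ltr0z //.
Qed.

Lemma base_orbit l (p : 'I_l -> V) cf (S : V -> Prop) : base p cf ->
  (forall i, S (p i)) -> (forall i, S (- p i)) ->
  (forall i x, x \in Phi -> S x -> S (refl (p i) x)) ->
  forall a, a \in Phi -> indivisible a -> S a.
Proof.
move=> B Sp SNp Sr a aP aI; have [aN|aN] := base_sign B aP.
  exact: (base_height B Sp Sr).
have cf0 i : cf i 0 = 0.
  by have := base_lin B i (-1) 0 0; rewrite scaler0 addr0 mulN1r addNr.
rewrite -[a]opprK; apply: (base_height (S := fun x => S (- x)) B SNp).
- by move=> i x xP; rewrite -reflN; apply: Sr; apply: root_opp.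
- exact: root_opp.
- by move=> b bP; rewrite eqr_oppLR -scalerN; apply: aI; apply: root_opp.
move=> i; have [n nE] := aN i; exists n.
by have := base_lin B i (-1) a 0; rewrite addr0 cf0 addr0 scaleN1r => ->; rewrite nE mulN1r opprK.
Qed.

(* If a reflection-stable set of roots were obtuse to b, the sum over it, being
   invariant, would vanish, so the set would be orthogonal to b. *)
Lemma orbit_acute (X : V -> bool) b :
  (forall g x, g \in Phi -> x \in Phi -> X x -> X (refl g x)) ->
  (exists2 x, x \in Phi & X x) -> b \in Phi ->
  exists x, [/\ x \in Phi, X x & 0 < dot x b].
Proof.
move=> Xr [x0 x0P Xx0] bP; apply: NNPP => nx.
pose xs := undup [seq x <- Phi | X x].
have xsP x : x \in xs = X x && (x \in Phi) by rewrite mem_undup mem_filter.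
have rxs g x : g \in Phi -> x \in xs -> refl g x \in xs.
  by move=> gP; rewrite !xsP => /andP[Xx xP]; rewrite Xr // rs_refl.
pose r := \sum_(x <- xs) x.
have rE g : g \in Phi -> refl g r = r.
  move=> gP; have -> : refl g r = \sum_(x <- map (refl g) xs) x.
    rewrite big_map /r; elim: (xs) => [|x s IH]; last by rewrite !big_cons reflD IH.
    by rewrite !big_nil -(scale0r (0 : V)) reflZ !scale0r.
  apply: perm_big; apply: uniq_perm; rewrite ?undup_uniq //.
    rewrite map_inj_uniq ?undup_uniq //.
    by apply: (can_inj (g := refl g)) => x; rewrite reflK // root_neq0.
  move=> x; apply/mapP/idP => [[y yx ->]|xx]; first exact: rxs.
  by exists (refl g x); rewrite ?rxs ?reflK // root_neq0.
have r0 : dot r b = 0.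
  have := rE b bP; rewrite /refl => /eqP; rewrite -subr_eq0 addrC addKr oppr_eq0 scaler_eq0.
  rewrite (negPf (root_neq0 bP)) orbF /cn mulf_eq0 invr_eq0 dot_eq0 (negPf (root_neq0 bP)).
  by rewrite orbF mulf_eq0 => /eqP.
have x0b x : x \in xs -> dot x b = 0.
  move=> xx; apply/eqP; move: r0; rewrite dot_suml => /eqP; rewrite -oppr_eq0 -sumrN.
  rewrite big_seq psumr_eq0 => [/allP/(_ x xx)|y].
    by rewrite xx oppr_eq0.
  rewrite xsP => /andP[Xy yP]; rewrite oppr_ge0 leNgt; apply/negP=> yb.
  by apply: nx; exists y.
have /hasP[x xx] : has (fun x => dot x b != 0) xs; last by rewrite x0b ?eqxx.
apply: (rs_irr RS (P := fun c => has (fun x => dot x c != 0) xs)) bP.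
  move=> a c aP cP /hasP[x xx xa] /hasPn nc.
  have /negPn/eqP xc := nc x xx; have /negPn/eqP := nc _ (rxs a x aP xx).
  rewrite /refl dotDl dotNl dotZl xc sub0r => /eqP; rewrite oppr_eq0 mulf_eq0.
  have an0 := root_neq0 aP; rewrite /cn !mulf_eq0 invr_eq0 dot_eq0 (negPf an0) (negPf xa).
  by rewrite orbF => /eqP.
by exists x0 => //; apply/hasP; exists x0; rewrite ?xsP ?Xx0 ?x0P ?dot_eq0 ?root_neq0.
Qed.

Lemma base_dual_combination l (p : 'I_l -> V) cf : base p cf ->
  exists C : 'M[rat]_l, forall j t, \sum_i C j i * dot (p i) (p t) = (j == t)%:R.
Proof.
move=> B; pose G := \matrix_(i < l, t < l) dot (p i) (p t).
have cf0 i : cf i 0 = 0.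
  by have := base_lin B i (-1) 0 0; rewrite scaler0 addr0 mulN1r addNr.
have ind (c : 'I_l -> rat) : \sum_i c i *: p i = 0 -> forall i, c i = 0.
  move=> c0 i; have := cf0 i; rewrite -{1}c0 => <-.
  transitivity (\sum_j c j * cf i (p j)).
    rewrite (bigD1 i) //= (base_dual B) eqxx mulr1 big1 ?addr0 // => j ji.
    by rewrite (base_dual B) eq_sym (negPf ji) mulr0.
  by elim/big_rec2: _ => [//|j y1 y2 _ ->]; rewrite (base_lin B).
have rfG : row_free G.
  rewrite -kermx_eq0; apply/eqP/row_matrixP => i; rewrite row0.
  set u := row i (kermx G).
  have uG : u *m G = 0 by rewrite -row_mul mulmx_ker row0.
  have /eqP : dot (\sum_t u 0 t *: p t) (\sum_t u 0 t *: p t) = 0.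
    rewrite dot_sumr big1 // => t _; rewrite dotZr.
    have := congr1 (fun M : 'rV_l => M 0 t) uG; rewrite /= mxE [RHS]mxE => ut.
    rewrite dot_suml (eq_bigr (fun j => u 0 j * G j t)) => [|j _]; first by rewrite ut mulr0.
    by rewrite dotZl !mxE.
  rewrite dot_eq0 => /eqP/ind u0; apply/rowP=> j.
  by rewrite u0 mxE.
exists (pinvmx G) => j t; have /matrixP/(_ j t) : pinvmx G *m G = 1%:M.
  by apply: mulVpmx; rewrite row_full_unit -row_free_unit.
rewrite !mxE => <-; apply: eq_bigr => i _.
by rewrite !mxE.
Qed.

Lemma base_diff l (p : 'I_l -> V) cf i j : base p cf -> i != j -> p i - p j \notin Phi.
Proof.
move=> B ij; apply/negP=> /(base_sign B).
have E t : cf t (p i - p j) = (t == i)%:R - (t == j)%:R.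
  by rewrite addrC -scaleN1r (base_lin B) !(base_dual B) mulN1r addrC.
case=> [/(_ j)|/(_ i)] [n].
  rewrite E eqxx eq_sym (negPf ij) => E'; have {}E' : 0 - 1 = n%:R :> rat := E'.
  by have := ler0n rat n; lra.
rewrite E eqxx (negPf ij) => E'; have {}E' : 1 - 0 = - n%:R :> rat := E'.
by have := ler0n rat n; lra.
Qed.

(** 2/(n+3) is never an integer. The case n = 1, a factor 4, shows that half of a divisible root is
    indivisible. *)
Lemma root_half_int a (n : nat) : a \in Phi -> n.+3%:R *: a \notin Phi.
Proof.
move=> aP; apply/negP=> naP; have [c] := rs_int RS naP aP.
rewrite cnZr ?pnatr_eq0 // cnxx ?root_neq0 // => E.
have : (c * n.+3)%:~R = 2%:R :> rat by rewrite intrM -E -pmulrn mulrAC mulVf ?mul1r ?pnatr_eq0.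
move/eqP; rewrite (_ : 2%:R = 2%:~R) // eqr_int => /eqP cn2.
have [c0|c0] := lerP c 0; nia.
Qed.

Lemma divisible_half a : a \in Phi -> ~ indivisible a ->
  exists2 b, b \in Phi & indivisible b /\ a = 2%:R *: b.
Proof.
move=> aP /not_all_ex_not[b nb]; have [bP /negP/negPn/eqP aE] := imply_to_and _ _ nb.
exists b => //; split=> // c cP; apply/eqP=> bE; case/negP: (root_half_int 1 cP).
by rewrite (_ : 4%:R *: c = a) // aE bE scalerA -natrM.
Qed.

(** In type BC these are the short roots e_i and -e_i. Cartan numbers against them are even, because
    those against the doubled root are integers. *)
Definition halfroot a := (a \in Phi) && (2%:R *: a \in Phi).

Lemma halfroot_refl a b : b \in Phi -> halfroot a -> halfroot (refl b a).
Proof. by move=> bP /andP[aP aaP]; rewrite /halfroot -reflZ !rs_refl. Qed.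

Lemma halfroot_opp a : halfroot a -> halfroot (- a).
Proof. by move=> /andP[aP aaP]; rewrite /halfroot scalerN !root_opp. Qed.

Lemma halfroot_root a : halfroot a -> a \in Phi. Proof. by case/andP. Qed.

Lemma halfroot_even e c : halfroot e -> c \in Phi -> exists u : int, cn c e = (2 * u)%:~R.
Proof.
move=> /andP[eP eeP] cP; have [u] := rs_int RS eeP cP; rewrite cnZr // => E.
by exists u; rewrite intrM -E mulVKf.
Qed.

(** Let 2u and v be the Cartan numbers of c against e and of e against c. Both are positive and uv
    <= 2 by Cauchy-Schwarz. The cases (1, 2), (2, 1), (1, 1) of (u, v) give c = e, c = 2e, and c = e
    + e' with e' a half-root orthogonal to e. *)
Lemma halfroot_acute e c : halfroot e -> c \in Phi -> 0 < dot e c ->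
  [\/ c = e, c = 2%:R *: e |
      [/\ halfroot (c - e), dot e (c - e) = 0, dot c c = 2%:R * dot e e & cn e c = 1]].
Proof.
move=> he cP ec; have eP := halfroot_root he.
have a0 : 0 < dot e e by rewrite dot_gt0 root_neq0.
have b0 : 0 < dot c c by rewrite dot_gt0 root_neq0.
have [u uE] := halfroot_even he cP; have [v vE] := rs_int RS cP eP.
have du : dot e c = u%:~R * dot e e.
  by have := cn_dot c e; rewrite uE intrM (dotC c) -mulrA => /mulfI->.
have dv : 2%:R * dot e c = v%:~R * dot c c by rewrite -cn_dot vE.
have u0 : 0 < u by move: ec; rewrite du pmulr_lgt0 // ltr0z.
have v0 : 0 < v.
  have : 0 < 2%:R * dot e c by rewrite pmulr_rgt0.
  by rewrite dv pmulr_lgt0 // ltr0z.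
have uv : u * v <= 2.
  have CS := dot_CS e c; rewrite -(ler_int rat) intrM.
  have : u%:~R * v%:~R * (dot e e * dot c c) <= 2%:R * (dot e e * dot c c).
    have -> : u%:~R * v%:~R * (dot e e * dot c c) = 2%:R * dot e c ^+ 2.
      by rewrite expr2 mulrA dv du; ring.
    by rewrite ler_pM2l.
  by rewrite ler_pM2r // mulr_gt0.
have [[uE1 vE1]|[uE1 vE1]|[uE1 vE1]] : [\/ u = 1 /\ v = 1, u = 1 /\ v = 2 | u = 2 /\ v = 1].
- have [u1|u1] : u = 1 \/ u = 2 by nia.
    have [v1|v1] : v = 1 \/ v = 2 by nia.
      by constructor 1.
    by constructor 2.
  by constructor 3; split=> //; nia.
- move: du dv; rewrite uE1 vE1 !mul1r => du dv.
  constructor 3; split.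
  + rewrite -[c - e]opprK opprB; apply: halfroot_opp.
    rewrite (_ : e - c = refl c e) ?halfroot_refl //.
    by rewrite /refl vE vE1 scale1r.
  + by rewrite dotDr dotNr du subrr.
  + by rewrite -du dv.
  by rewrite vE vE1.
- move: du dv; rewrite uE1 vE1 !mul1r => du dv.
  constructor 1; apply/eqP; rewrite -subr_eq0 -dot_eq0 !dotE (dotC c e) du.
  by move: dv; rewrite du (_ : 2%:~R = 2%:R) // => /mulfI->//; apply/eqP; ring.
move: du dv; rewrite uE1 vE1 !mul1r => du dv.
constructor 2; apply/eqP; rewrite -subr_eq0 -dot_eq0 !dotE (dotC c e) -dv du.
by rewrite (_ : 2%:~R = 2%:R) //; apply/eqP; ring.
Qed.

(** For an acute pair, f = 2e would make 4e a root, and the third case of [halfroot_acute] gives the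
    odd Cartan number 1 against a half-root. *)
Lemma halfroot_orth e f : halfroot e -> halfroot f -> [\/ dot e f = 0, f = e | f = - e].
Proof.
have key f' : halfroot e -> halfroot f' -> 0 < dot e f' -> f' = e.
  move=> he hf ef; have [//|fE|[_ _ _ E]] := halfroot_acute he (halfroot_root hf) ef.
    have /andP[eP _] := he; have /andP[_] := hf; rewrite fE scalerA -natrM => H.
    by have := root_half_int 1 eP; rewrite H.
  have [u] := halfroot_even hf (halfroot_root he); rewrite E => /eqP.
  by rewrite (_ : 1 = 1%:~R) // eqr_int; lia.
move=> he hf; case: (ltrgtP (dot e f) 0) => ef; last by constructor 1.
  constructor 3; rewrite -(key (- f)) ?opprK //; first exact: halfroot_opp.
  by rewrite dotNr oppr_gt0.
by constructor 2; apply: key.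
Qed.

(** The half-roots f with f = e, f = -e or e + f a root form a reflection-stable set. By
    [orbit_acute] one of them is acute to e', and two acute half-roots are equal. *)
Lemma halfroot_sum e e' : halfroot e -> halfroot e' -> dot e e' = 0 -> e + e' \in Phi.
Proof.
move=> he he' ee'; pose X f := halfroot f && [|| f == e, f == - e | e + f \in Phi].
have XN f : X f -> X (- f).
  move=> /andP[hf Xf]; rewrite /X halfroot_opp //=.
  have [ef|->|->] := halfroot_orth he hf; rewrite ?opprK ?eqxx ?orbT //.
  move: Xf => /or3P[/eqP->|/eqP->|efP]; rewrite ?opprK ?eqxx ?orbT //.
  have := rs_refl RS (halfroot_root hf) efP.
  rewrite reflD (reflvv (root_neq0 (halfroot_root hf))) refl_orth // => ->.
  by rewrite !orbT.
have key f g : g \in Phi -> X f -> 0 < dot f g -> X (refl g f).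
  move=> gP Xf fg; have /andP[hf fX] := Xf; have fP := halfroot_root hf.
  have [->|->|] := halfroot_acute hf gP fg; rewrite ?refl_scale ?reflvv ?root_neq0 ?XN //.
  (* Here g = f + f' with f' a half-root orthogonal to f, and the reflection in g sends f to -f'. *)
  have gE : g = f + (g - f) by rewrite subrKC.
  move: (g - f) gE => f' gE [hf' ff' gg cfg].
  have -> : refl g f = - f' by rewrite /refl cfg scale1r {1}gE opprD addNKr.
  rewrite /X halfroot_opp //=.
  case/or3P: fX => [/eqP fe|/eqP fe|efP].
  - have -> : e + - f' = refl f' g.
      by rewrite gE reflD (reflvv (root_neq0 (halfroot_root hf'))) refl_orth // fe.
    by rewrite rs_refl ?orbT // halfroot_root.
  - rewrite (_ : e + - f' = - g) ?root_opp ?orbT //.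
    by rewrite gE fe opprD opprK.
  have [ef|fe|fe] := halfroot_orth he hf; last 2 first.
  - have -> : e + - f' = refl f' g.
      by rewrite gE reflD (reflvv (root_neq0 (halfroot_root hf'))) refl_orth // fe.
    by rewrite rs_refl ?orbT // halfroot_root.
  - rewrite (_ : e + - f' = - g) ?root_opp ?orbT //.
    by rewrite gE fe opprD opprK.
  have [ef'|->|->] := halfroot_orth he hf'; rewrite ?opprK ?eqxx ?orbT //.
  have -> : e + - f' = refl g (e + f).
    rewrite reflD refl_orth; last by rewrite gE dotDr ef ef' addr0.
    by congr (_ + _); rewrite /refl cfg scale1r {1}gE opprD addNKr.
  by rewrite rs_refl ?orbT.
have [||x [xP Xx xe]] := @orbit_acute X e' _ _ (halfroot_root he').
- move=> g x gP xP Xx; case: (ltrgtP (dot x g) 0) => xg.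
  + by rewrite -refl_opp; apply: key; rewrite ?root_opp // dotNr oppr_gt0.
  + exact: key.
  by rewrite refl_orth.
- by exists e; [apply: halfroot_root | rewrite /X he eqxx].
have /andP[hx Xx'] := Xx; have e'0 := root_neq0 (halfroot_root he').
have xe' : x = e'.
  have [x0|<- //|E] := halfroot_orth hx he'; first by rewrite x0 ltxx in xe.
  by move: xe; rewrite E dotNr oppr_gt0 ltNge dot_ge0.
move: Xx'; rewrite xe' => /or3P[/eqP E|/eqP E|//].
  by move: e'0; rewrite -dot_eq0 {1}E ee' eqxx.
by move: e'0; rewrite -dot_eq0 {1}E dotNl ee' oppr0 eqxx.
Qed.

(** Dual coordinates written as rational combinations of pairings with roots. In this form they can
    be evaluated on functionals of [h], which gives independence of the base over [k] and not only
    over the rationals. *)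
Definition dual_comb l (q : 'I_l -> V) : Prop :=
  exists (e : 'I_l -> V) (C : 'I_l -> 'I_l -> rat), (forall s, e s \in Phi) /\
    forall j t, \sum_s C j s * dot (e s) (q t) = (j == t)%:R.

Lemma halfroot_indivisible e : halfroot e -> indivisible e.
Proof.
move=> /andP[_ eeP] b bP; apply/eqP=> eE; case/negP: (root_half_int 1 bP).
by rewrite (_ : 4%:R *: b = 2%:R *: e) // eE scalerA -natrM.
Qed.

(* With half-roots the root system is of type BC: orthogonal half-roots e_1, ..., e_l
   give the base e_i - e_(i+1), e_l of the indivisible roots, of type B. *)
Lemma typeB_base b : halfroot b -> exists l (q : 'I_l -> V),
  [/\ (0 < l)%N, (forall i, q i \in Phi /\ indivisible (q i)), dual_comb q,
      (forall a, a \in Phi -> indivisible a -> exists n : 'I_l -> nat,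
         a = \sum_i (n i)%:R *: q i \/ a = - \sum_i (n i)%:R *: q i) &
      (forall i j, cn (q i) (q j) = (BCartan i j)%:~R)].
Proof.
move=> hb; have [f [fL f0]] := generic_functional (rs_0 RS).
have f00 : f 0 = 0 by have := fL (-1) 0 0; rewrite scaler0 addr0 mulN1r addNr.
have fN x : f (- x) = - f x by have := fL (-1) x 0; rewrite addr0 f00 addr0 scaleN1r mulN1r.
pose es := undup [seq x <- Phi | halfroot x && (0 < f x)].
have esP x : x \in es = halfroot x && (0 < f x).
  rewrite mem_undup mem_filter andbAC; case: (boolP (halfroot x)) => //= hx.
  by rewrite halfroot_root.
(* The default value gives e_l = 0, so the family q_i = e_i - e_(i+1) ends with q_(l-1) =
   e_(l-1). *)
pose l := size es; pose e i : V := es`_i.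
have he i : (i < l)%N -> halfroot (e i).
  by move=> il; have := mem_nth 0 il; rewrite esP => /andP[].
have fe i : (i < l)%N -> 0 < f (e i).
  by move=> il; have := mem_nth 0 il; rewrite esP => /andP[].
have el : e l = 0 by rewrite /e nth_default.
have sgn x : halfroot x -> exists2 i, (i < l)%N & x = e i \/ x = - e i.
  move=> hx; have := f0 x (halfroot_root hx); rewrite neq_lt => /orP[fx|fx].
    have xs : - x \in es by rewrite esP halfroot_opp //= fN oppr_gt0.
    exists (index (- x) es); first by rewrite index_mem.
    by right; rewrite /e nth_index // opprK.
  have xs : x \in es by rewrite esP hx.
  by exists (index x es); [rewrite index_mem | left; rewrite /e nth_index].
have l0 : (0 < l)%N by have [i il _] := sgn _ hb; apply: leq_ltn_trans il.
have orth i j : (i < l)%N -> (j < l)%N -> i != j -> dot (e i) (e j) = 0.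
  move=> il jl ij; have [//|E|E] := halfroot_orth (he i il) (he j jl).
    by move/eqP: E; rewrite /e nth_uniq ?undup_uniq // eq_sym (negPf ij).
  have := fe j jl; rewrite E fN oppr_gt0 => lt.
  by have := lt_trans lt (fe i il); rewrite ltxx.
pose D := dot (e 0%N) (e 0%N).
(* All half-roots have one length: for orthogonal ones the root e + f has square length 2(e, e), and
   equally 2(f, f). *)
have De i : (i < l)%N -> dot (e i) (e i) = D.
  have len a c : halfroot a -> halfroot c -> dot a c = 0 -> dot (a + c) (a + c) = 2%:R * dot a a.
    move=> ha hc ac; have a0 := root_neq0 (halfroot_root ha).
    have c0 := root_neq0 (halfroot_root hc).
    have := halfroot_acute ha (halfroot_sum ha hc ac).
    rewrite dotDr ac addr0 dot_gt0 => /(_ a0)[E|E|[]//].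
      by move/eqP: E; rewrite -subr_eq0 addrC addKr (negPf c0).
    move/eqP: E; rewrite -subr_eq0 scaler_nat mulr2n opprD addrACA subrr add0r subr_eq0.
    move/eqP=> ca; move: ac; rewrite ca => /eqP; rewrite dot_eq0.
    by rewrite (negPf a0).
  case: i => [//|i] il; have o := orth 0%N i.+1 l0 il isT.
  have o' : dot (e i.+1) (e 0%N) = 0 by rewrite dotC.
  have := len _ _ (he _ il) (he _ l0) o'; rewrite addrC (len _ _ (he _ l0) (he _ il) o).
  by move/mulfI => /(_ isT).
have D0 : D != 0 by rewrite dot_eq0 root_neq0 // halfroot_root // he.
have dde i j : (i <= l)%N -> (j <= l)%N ->
    dot (e i) (e j) = if (i == j) && (i < l)%N then D else 0.
  rewrite leq_eqVlt => /orP[/eqP->|il]; first by rewrite el dot0l ltnn andbF.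
  rewrite leq_eqVlt => /orP[/eqP->|jl]; first by rewrite el dot0r (ltn_eqF il).
  by rewrite il andbT; case: eqP => [<-|/eqP ij]; [exact: De | exact: orth].
pose q (i : 'I_l) := e i - e i.+1.
have qP (i : 'I_l) : q i \in Phi.
  rewrite /q; have [il|il] := ltnP i.+1 l.
    apply: halfroot_sum; rewrite ?halfroot_opp ?he // dotNr orth ?oppr0 //.
    by rewrite ltn_eqF.
  have -> : i.+1 = l by apply/eqP; rewrite eqn_leq il ltn_ord.
  by rewrite el subr0 halfroot_root // he.
have qI (i : 'I_l) : indivisible (q i).
  rewrite /q; have [il|il] := ltnP i.+1 l; last first.
    have -> : i.+1 = l by apply/eqP; rewrite eqn_leq il ltn_ord.
    by rewrite el subr0; apply/halfroot_indivisible/he.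
  move=> c cP; apply/eqP=> qE.
  have hc : halfroot c by rewrite /halfroot cP -qE qP.
  have [j jl cj] := sgn _ hc.
  have E t : (t < l)%N -> dot (e i - e i.+1) (e t) != 0 -> t = j.
    move=> tl; rewrite qE dotZl; case: cj => ->; rewrite ?dotNl dde ?(ltnW jl) ?(ltnW tl) //.
      by case: (eqVneq j t) => //= _; rewrite mulr0 eqxx.
    by case: (eqVneq j t) => //= _; rewrite oppr0 mulr0 eqxx.
  have i1 : nat_of_ord i = j.
    apply: E => //; rewrite dotDl dotNl !dde ?(ltnW il) ?(ltnW (ltn_ord i)) //.
    by rewrite eqxx (gtn_eqF (ltnSn i)) /= ?ltn_ord ?subr0.
  have i2 : i.+1 = j.
    apply: E => //; rewrite dotDl dotNl !dde ?(ltnW il) ?(ltnW (ltn_ord i)) //.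
    by rewrite eqxx il (ltn_eqF (ltnSn i)) /= sub0r oppr_eq0.
  by move: i2; rewrite -i1 => /esym/eqP; rewrite ltn_eqF.
have tele i j : (i <= j <= l)%N ->
    e i - e j = \sum_(t < l) ((i <= t < j)%N : nat)%:R *: q t.
  move=> /andP[ij]; rewrite -(subnKC ij); elim: (j - i)%N => [|d IH] dl.
    by rewrite addn0 subrr big1 // => t _; rewrite ltnNge andbN scale0r.
  rewrite -(subrKA (e (i + d)%N)) IH; last by rewrite ltnW // -addnS.
  rewrite addnS in dl *; rewrite [e (i + d)%N - _](_ : _ = q (Ordinal dl)) //.
  rewrite (bigD1 (Ordinal dl)) //= ltnn andbF scale0r add0r.
  rewrite [RHS](bigD1 (Ordinal dl)) //= ltnSn leq_addr scale1r addrC; congr (_ + _).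
  apply: eq_bigr => t td; rewrite ltnS (leq_eqVlt t).
  by have /negPf-> : t != (i + d)%N :> nat by move: td; rewrite -val_eqE.
exists l, q; split=> //.
(* The j-th dual coordinate is D^-1 times the pairing with e_0 + ... + e_j. *)
- exists (fun s : 'I_l => e s), (fun j s : 'I_l => if (s <= j)%N then D^-1 else 0).
  split=> [s|j t]; first exact/halfroot_root/he.
  rewrite (bigD1 t) //=.
  have E s : (s < l)%N -> dot (e s) (q t) =
      (if s == t then D else 0) - (if s == t.+1 then D else 0).
    by move=> sl; rewrite /q dotDr dotNr !dde ?(ltnW (ltn_ord _)) ?ltn_ord ?(ltnW sl) // sl !andbT.
  rewrite E // eqxx (ltn_eqF (ltnSn t)) subr0.
  have [tl|tl] := ltnP t.+1 l.
    rewrite (bigD1 (Ordinal tl)) //=; last by rewrite -val_eqE /= gtn_eqF.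
    rewrite E // eqxx gtn_eqF // sub0r big1 ?addr0 => [|s]; last first.
      by rewrite -!val_eqE E // => /andP[/negPf /= -> /negPf /= ->]; rewrite subrr mulr0.
    rewrite -val_eqE /=; case: (ltngtP t j) => tj; rewrite ?mulVf // ?mulrN ?mul0r ?oppr0 ?addr0 //.
    by rewrite mulVf // subrr.
  rewrite big1 ?addr0 => [|s]; last first.
    rewrite -val_eqE /= => /negPf st.
    rewrite E // st sub0r (_ : (s == t.+1 :> nat) = false) ?oppr0 ?mulr0 //.
    by apply: ltn_eqF; apply: leq_trans tl.
  have jt : (j <= t)%N by rewrite -ltnS; apply: leq_trans tl.
  rewrite -val_eqE /=; case: (ltngtP t j) jt => // tj _; rewrite ?mulVf ?mul0r //.
- move=> a aP aI.
  have key x i j : (i <= l)%N -> (j <= l)%N -> x = e i + e j \/ x = e i - e j ->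
      exists n : 'I_l -> nat, x = \sum_i (n i)%:R *: q i \/ x = - \sum_i (n i)%:R *: q i.
    move=> il jl [->|->].
      exists (fun t => (i <= t < l)%N + (j <= t < l)%N)%N; left.
      have := tele i l; have := tele j l; rewrite el !subr0 il jl leqnn => -> // -> //.
      by rewrite -big_split; apply: eq_bigr => t _; rewrite natrD scalerDl.
    case/orP: (leq_total i j) => ij.
      by exists (fun t => (i <= t < j)%N); left; rewrite tele ?ij.
    by exists (fun t => (j <= t < i)%N); right; rewrite -tele ?ij // opprB.
  (* A half-root x acute to the indivisible root a shows that a is x or x + x' with x' a half-root,
     hence a signed sum of at most two of the e_i. *)
  have [|||x [xP Xx xa]] := @orbit_acute halfroot a.
  + by move=> g x gP _; apply: halfroot_refl.
  + by exists b => //; apply: halfroot_root.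
  + by [].
  have key2 y : (exists n : 'I_l -> nat, y = \sum_i (n i)%:R *: q i \/ y = - \sum_i (n i)%:R *: q i) ->
      exists n : 'I_l -> nat, - y = \sum_i (n i)%:R *: q i \/ - y = - \sum_i (n i)%:R *: q i.
    by move=> [n [->|->]]; exists n; [right|left]; rewrite ?opprK.
  have [i il xE] := sgn _ Xx.
  have [aE|aE|[ha' _ _ _]] := halfroot_acute Xx aP xa.
  + have ki : exists n : 'I_l -> nat, e i = \sum_i (n i)%:R *: q i \/ e i = - \sum_i (n i)%:R *: q i.
      by apply: (key _ i l (ltnW il) (leqnn l)); left; rewrite el addr0.
    by rewrite aE; case: xE => ->; [|apply: key2].
  + by have := aI x xP; rewrite -aE eqxx.
  have [j jl x'E] := sgn _ ha'; rewrite -(subrKC x a).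
  case: xE x'E => -> [] ->.
  + by apply: (key _ i j (ltnW il) (ltnW jl)); left.
  + by apply: (key _ i j (ltnW il) (ltnW jl)); right.
  + by rewrite addrC; apply: (key _ j i (ltnW jl) (ltnW il)); right.
  by rewrite -opprD; apply: key2; apply: (key _ i j (ltnW il) (ltnW jl)); left.
move=> i j; have il := ltn_ord i; have jl := ltn_ord j.
rewrite /cn /q !dotDl !dotNl !dotDr !dotNr !dde ?(ltnW il) ?(ltnW jl) //.
rewrite /BCartan il jl eqSS !eqxx (ltn_eqF (ltnSn j)) (gtn_eqF (ltnSn j)) /= -val_eqE /=.
rewrite ![j.+1 == _]eq_sym !andbT; exact: (BCartan_quotient D0 il jl).
Qed.

(** The root c, which is a or b + x with x a half-root acute to a, links b to a by nonorthogonal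
    pairs. The Killing form of the degree-zero algebra will be compared with [dot] along such
    pairs. *)
Lemma halfroot_length b a : halfroot b -> a \in Phi -> indivisible a ->
  (dot a a = dot b b \/ dot a a = 2%:R * dot b b) /\
  exists c, [/\ c \in Phi, indivisible c, dot b c != 0 & dot c a != 0].
Proof.
have len e f : halfroot e -> halfroot f -> dot e e = dot f f /\
    (f = e \/ f = - e \/ (dot e f = 0 /\ dot (e + f) (e + f) = 2%:R * dot e e)).
  move=> he hf; have [ef|->|->] := halfroot_orth he hf; last 2 first.
  - by split=> //; left.
  - by rewrite dotNl dotNr opprK; split=> //; right; left.
  have fe : dot f e = 0 by rewrite dotC.
  have E x y : halfroot x -> halfroot y -> dot x y = 0 ->
      dot (x + y) (x + y) = 2%:R * dot x x.
    move=> hx hy xy; have x0 := root_neq0 (halfroot_root hx).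
    have y0 := root_neq0 (halfroot_root hy).
    have := halfroot_acute hx (halfroot_sum hx hy xy).
    rewrite dotDr xy addr0 dot_gt0 => /(_ x0)[E|E|[]//].
      by move/eqP: E; rewrite -subr_eq0 addrC addKr (negPf y0).
    move/eqP: E; rewrite -subr_eq0 scaler_nat mulr2n opprD addrACA subrr add0r subr_eq0.
    move/eqP=> yx; move: xy; rewrite yx => /eqP; rewrite dot_eq0.
    by rewrite (negPf x0).
  split; last by right; right; rewrite E.
  by have := E _ _ he hf ef; rewrite addrC (E _ _ hf he fe) => /mulfI ->.
move=> hb aP aI.
have [||x [xP Xx xa]] := @orbit_acute halfroot a _ _ aP.
- by move=> g x gP _; apply: halfroot_refl.
- by exists b => //; apply: halfroot_root.
have [bx bxc] := len b x hb Xx.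
have x0 := root_neq0 (halfroot_root Xx).
have aa : dot a a = dot b b \/ dot a a = 2%:R * dot b b.
  have [->|aE|[_ _ -> _]] := halfroot_acute Xx aP xa; rewrite -?bx; [by left| |by right].
  by have := aI x xP; rewrite -aE eqxx.
split=> //; case: bxc => [xb|[xb|[bx0 _]]].
- by exists a; split=> //; rewrite ?dot_eq0 ?root_neq0 // -xb (gt_eqF xa).
- exists a; split=> //; rewrite ?dot_eq0 ?root_neq0 //.
  by rewrite -[b]opprK -xb dotNl oppr_eq0 (gt_eqF xa).
have [ba|ba] := eqVneq (dot b a) 0; last first.
  by exists a; split=> //; rewrite ?dot_eq0 ?root_neq0.
have b0 := root_neq0 (halfroot_root hb).
exists (b + x); have bxP := halfroot_sum hb Xx bx0.
split=> //; rewrite ?dotDr ?dotDl ?bx0 ?addr0 ?dot_eq0 ?ba ?add0r ?(gt_eqF xa) //.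
move=> c cP; apply/eqP=> cE; have hc : halfroot c by rewrite /halfroot cP -cE.
have key y : halfroot y -> dot (b + x) y != 0 -> y = c \/ y = - c.
  move=> hy; rewrite cE dotZl => ny.
  have [cy|->|->] := halfroot_orth hc hy; [|by left|by right].
  by rewrite cy mulr0 eqxx in ny.
have kb : b = c \/ b = - c by apply: key; rewrite // dotDl (dotC x) bx0 addr0 dot_eq0.
have kx : x = c \/ x = - c by apply: key; rewrite // dotDl bx0 add0r dot_eq0.
have c0 := root_neq0 cP.
by case: kb bx0 => -> []; case: kx => ->; rewrite ?dotNl ?dotNr ?opprK => /eqP;
  rewrite ?oppr_eq0 dot_eq0 (negPf c0).
Qed.

End Roots.

(** * Doubly graded simple Lie algebras *)

Lemma ad_sl2 (k : closedFieldType) (g : vectType k) (br : g -> g -> g) e f h :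
  is_lie br -> br e f = h -> br h e = 2%:R *: e -> br h f = - (2%:R *: f) ->
  sl2_ops (ad br e) (ad br f) (ad br h).
Proof.
move=> L ef he hf; split=> v; rewrite !adE //.
- by rewrite (jacobi L e) ef addrC.
- by rewrite (jacobi L h e) he brZl // addrC.
- by rewrite (jacobi L h f) hf brNl // brZl // addrC.
Qed.

Section Graded.
Variables (k : closedFieldType) (g : vectType k) (br : g -> g -> g).
Variable io : {rmorphism rat -> k}.
Variables (L : zmodType) (N : nat) (Phi : seq 'rV[rat]_N).
Variable G : 'rV[rat]_N -> L -> {vspace g}.
Variable tau : g.
Variable phi : 'rV[rat]_N -> rat.

(* G a l is the part of weight a and degree l; the rational functional phi separates
   the weights, so that the Cartan element tau is regular. *)
Record graded : Prop := Graded {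
  gr_lie : is_lie br;
  gr_simple : simple_in br fullv;
  gr_roots : root_system Phi;
  gr_br : forall a b l m x y, x \in G a l -> y \in G b m -> br x y \in G (a + b) (l + m);
  gr_sum : forall v, sum_of (fun x => exists a l, x \in G a l) v;
  gr_supp : forall a l x, x \in G a l -> x != 0 -> a \in 0 :: Phi;
  gr_root : forall a, a \in Phi -> exists l x, x \in G a l /\ x != 0;
  gr_tau : tau \in G 0 0;
  gr_tauE : forall a l x, x \in G a l -> br tau x = io (phi a) *: x;
  gr_phi : forall a b, a \in 0 :: Phi -> b \in 0 :: Phi -> phi a = phi b -> a = b;
  gr_cart : forall y a, y \in G 0 0 -> exists c, (a = 0 -> c = 0) /\
    forall l x, x \in G a l -> br y x = c *: x;
  gr_kf : forall a l x, x \in G a l -> (forall y, y \in G (- a) (- l) -> kf br x y = 0) -> x = 0;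
  gr_kf0 : forall a b l m x y, x \in G a l -> y \in G b m -> a + b != 0 -> kf br x y = 0;
  gr_sl2 : forall a l e, a \in Phi -> e \in G a l -> e != 0 ->
    exists2 f, f \in G (- a) (- l) &
      forall b m x, x \in G b m -> br (br e f) x = io (cn b a) *: x;
  gr_dim : forall a l x y, a \in Phi -> x \in G a l -> x != 0 -> y \in G a l ->
    exists c, y = c *: x }.

Hypothesis GR : graded.
Let lieP := gr_lie GR.
Let RS := gr_roots GR.

Definition wts := 0 :: undup Phi.

Lemma mem_wts a : (a \in wts) = (a \in 0 :: Phi).
Proof. by rewrite !inE mem_undup. Qed.

Lemma uniq_wts : uniq wts.
Proof. by rewrite /= undup_uniq mem_undup (rs_0 RS). Qed.

Definition comps l (x : g) (c : 'rV[rat]_N -> g) : Prop :=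
  (forall a, c a \in G a l) /\ x = \sum_(a <- wts) c a.

Lemma gr_vanish a l x : a \notin 0 :: Phi -> x \in G a l -> x = 0.
Proof. by move=> aP xG; apply/eqP; apply: contraNT aP => /(gr_supp GR xG). Qed.

(** [tau] acts on the summands by distinct scalars, so [tau] minus the scalar of the first summand
    removes that summand; induction puts the other components in W. *)
Lemma comps_stable (W : {vspace g}) (s : seq 'rV[rat]_N) l (c : 'rV[rat]_N -> g) :
  (forall x, x \in W -> br tau x \in W) -> uniq s -> {subset s <= wts} ->
  (forall a, c a \in G a l) -> \sum_(a <- s) c a \in W -> forall a, a \in s -> c a \in W.
Proof.
move=> Wt; elim: s c => // a0 s IH c /= /andP[a0s us] sw cG; rewrite big_cons => xW.
have cs a : a \in s -> c a \in W.
  move=> as_; have nz : io (phi a) - io (phi a0) != 0.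
    rewrite subr_eq0 (inj_eq (fmorph_inj io)); apply: contraNneq a0s => E.
    by rewrite -(gr_phi GR _ _ E) // -mem_wts sw // inE ?eqxx ?as_ ?orbT.
  suff : (io (phi a) - io (phi a0)) *: c a \in W.
    by move/(memvZ (io (phi a) - io (phi a0))^-1); rewrite scalerA mulVf ?scale1r.
  apply: (IH (fun a => (io (phi a) - io (phi a0)) *: c a)) => //.
  - by move=> b bs; apply: sw; rewrite inE bs orbT.
  - by move=> b; apply: memvZ.
  have -> : \sum_(b <- s) (io (phi b) - io (phi a0)) *: c b =
      br tau (c a0 + \sum_(b <- s) c b) - io (phi a0) *: (c a0 + \sum_(b <- s) c b).
    rewrite brDr // (gr_tauE GR (cG a0)) scalerDr opprD addrACA subrr add0r br_sumr //.
    rewrite scaler_sumr -sumrB; apply: eq_bigr => b _.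
    by rewrite (gr_tauE GR (cG b)) scalerBl.
  by rewrite memvB ?memvZ ?Wt.
move=> a; rewrite inE => /orP[/eqP->|/cs //].
rewrite -(addrK (\sum_(b <- s) c b) (c a0)) memvB //.
by rewrite big_seq memv_suml // => b /cs.
Qed.

Lemma comps_indep (s : seq 'rV[rat]_N) l (c : 'rV[rat]_N -> g) :
  uniq s -> (forall a, c a \in G a l) -> {subset s <= wts} -> \sum_(a <- s) c a = 0 ->
  forall a, a \in s -> c a = 0.
Proof.
move=> us cG sw c0 a as_; apply/eqP; rewrite -memv0.
apply: (comps_stable (s := s) (l := l)) => //; last by rewrite c0 mem0v.
by move=> x; rewrite memv0 => /eqP->; rewrite br0r ?mem0v.
Qed.

Definition sum_comp l x := exists c, comps l x c.

Lemma comps1 a l x : x \in G a l -> comps l x (fun b => if b == a then x else 0).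
Proof.
move=> xG; split=> [b|]; first by case: eqP => [->|_]; rewrite ?mem0v.
have [aw|aw] := boolP (a \in wts).
  by rewrite (bigD1_seq a) ?uniq_wts //= eqxx big1 ?addr0 // => b /negPf->.
have -> : x = 0 by apply: gr_vanish xG; rewrite -mem_wts.
by rewrite big1 // => b _; case: ifP.
Qed.

Variable D : L -> {vspace g}.
Hypothesis DP : forall l x, x \in D l <-> sum_comp l x.

Lemma G_D a l x : x \in G a l -> x \in D l.
Proof. by move=> xG; apply/DP; exists (fun b => if b == a then x else 0); apply: comps1. Qed.

Lemma D_ind l (P : g -> Prop) : P 0 -> (forall x y, P x -> P y -> P (x + y)) ->
  (forall a x, x \in G a l -> P x) -> forall x, x \in D l -> P x.
Proof.
move=> P0 PD PG x /DP[c [cG ->]]; elim/big_rec: _ => // a y _ Py.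
by apply: PD => //; apply: PG (cG a).
Qed.

Lemma D_br l m x y : x \in D l -> y \in D m -> br x y \in D (l + m).
Proof.
move=> xD yD; move: x xD; apply: D_ind.
- by rewrite br0l ?mem0v.
- by move=> x1 x2 h1 h2; rewrite brDl ?memvD.
move=> a x xG; move: y yD; apply: D_ind.
- by rewrite br0r ?mem0v.
- by move=> x1 x2 h1 h2; rewrite brDr ?memvD.
by move=> b y yG; apply: G_D (gr_br GR xG yG).
Qed.

Lemma D_br0 l x y : x \in D 0 -> y \in D l -> br x y \in D l.
Proof. by move=> xD yD; rewrite -[l]add0r D_br. Qed.

Variables (l0 : nat) (p : 'I_l0 -> 'rV[rat]_N) (cf : 'I_l0 -> 'rV[rat]_N -> rat).
Hypothesis BP : base Phi p cf.
Hypothesis p0 : forall i, exists2 e, e \in G (p i) 0 & e != 0.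
Hypothesis Phi_n0 : exists a, a \in Phi.

Lemma deg0_sl2 a e : a \in Phi -> e \in G a 0 -> e != 0 -> exists f,
  [/\ f \in G (- a) 0, sl2_ops (ad br e) (ad br f) (ad br (br e f)) &
      forall b m x, x \in G b m -> br (br e f) x = io (cn b a) *: x].
Proof.
move=> aP eG e0; have [f fG fE] := gr_sl2 GR aP eG e0; exists f.
rewrite oppr0 in fG; split=> //; apply: ad_sl2 => //.
  by rewrite (fE _ _ _ eG) cnxx ?(root_neq0 RS) // rmorph_nat.
by rewrite (fE _ _ _ fG) cnNl cnxx ?(root_neq0 RS) // rmorphN rmorph_nat scaleNr.
Qed.

Lemma iter_br_G a l e (t : nat) b m x : e \in G a l -> x \in G b m ->
  iter t (ad br e) x \in G (t%:R *: a + b) (l *+ t + m).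
Proof.
move=> eG xG; elim: t => [|t IH]; first by rewrite scale0r mulr0n !add0r.
rewrite iterS adE // -natr1 [_ + 1]addrC scalerDl scale1r mulrS -!addrA.
exact: (gr_br GR).
Qed.

(** A reflection lifted to [g]: a power of f or of e, by the sign of the Cartan number, maps weight
    b injectively to its reflection and keeps the degree, since e and f have degree 0. One power
    serves all degrees. *)
Lemma refl_op a e f b : a \in Phi -> b \in Phi -> e \in G a 0 -> f \in G (- a) 0 ->
  sl2_ops (ad br e) (ad br f) (ad br (br e f)) ->
  (forall b m x, x \in G b m -> br (br e f) x = io (cn b a) *: x) ->
  exists z t, (z = e \/ z = f) /\ forall m x, x \in G b m ->
    iter t (ad br z) x \in G (refl a b) m /\ (iter t (ad br z) x = 0 -> x = 0).
Proof.
move=> aP bP eG fG sl2 hE; have [c cE] := rs_int RS aP bP.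
have [c0|c0] := lerP 0 c.
  exists f, (absz c); split; first by right.
  have cE' : cn b a = (absz c)%:R by rewrite cE pmulrn gez0_abs.
  move=> m x xG; split.
    have := iter_br_G (absz c) fG xG; rewrite mul0rn add0r -cE' scalerN addrC.
    by [].
  apply: (sl2_Finj io sl2 _ (leqnn (absz c))).
  by rewrite adE // (hE _ _ _ xG) cE' rmorph_nat.
exists e, (absz c); split; first by left.
have cE' : cn b a = - (absz c)%:R by rewrite cE pmulrn ltz0_abs // rmorphN opprK.
move=> m x xG; split.
  have := iter_br_G (absz c) eG xG; rewrite mul0rn add0r addrC.
  by rewrite (_ : (absz c)%:R = - cn b a) ?scaleNr // cE' opprK.
apply: (sl2_Einj io sl2 _ (leqnn (absz c))).
by rewrite adE // (hE _ _ _ xG) cE' rmorphN rmorph_nat.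
Qed.

Lemma deg0_indivisible a : a \in Phi -> indivisible Phi a -> exists2 e, e \in G a 0 & e != 0.
Proof.
apply: (base_orbit RS (S := fun a => exists2 e, e \in G a 0 & e != 0) BP p0).
- move=> i; have [e eG e0] := p0 i; have pP := base_root BP i.
  have [f [fG sl2 fE]] := deg0_sl2 pP eG e0; exists f => //.
  apply: contraNneq e0 => f0; have := fE _ _ _ eG.
  rewrite f0 br0r // br0l // cnxx ?(root_neq0 RS) // rmorph_nat => /esym/eqP.
  by rewrite scaler_eq0 (natk_eq0 io).
move=> i x xP [v vG v0]; have [e eG e0] := p0 i; have pP := base_root BP i.
have [f [fG sl2 fE]] := deg0_sl2 pP eG e0.
have [z [t [_ zt]]] := refl_op pP xP eG fG sl2 fE.
have [tG t0] := zt _ _ vG; exists (iter t (ad br z) v) => //.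
by apply: contraNneq v0 => /t0->.
Qed.

(** If x <> 0, then [f, x] <> 0 has weight a and degree 0, so it is proportional to e. Then f^4 x is
    a multiple of f^3 e = 0, whereas f^4 is injective in weight 4. *)
Lemma deg0_divisible a x : a \in Phi -> x \in G (2%:R *: a) 0 -> indivisible Phi a -> x = 0.
Proof.
move=> aP xG aI; apply/eqP/negPn/negP => x0.
have [e eG e0] := deg0_indivisible aP aI.
have [f [fG sl2 fE]] := deg0_sl2 aP eG e0.
have a0 := root_neq0 RS aP.
have hx : ad br (br e f) x = 4%:R *: x.
  by rewrite adE // (fE _ _ _ xG) cnZl cnxx // -natrM rmorph_nat.
have fx : br f x != 0.
  by apply: contraNneq x0 => fx; apply/eqP/(sl2_Finj io sl2 (t := 1) hx) => //=; rewrite adE.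
have fxG : br f x \in G a 0.
  by have := gr_br GR fG xG; rewrite addr0 scaler_nat mulr2n addKr.
have [c eE] := gr_dim GR aP fxG fx eG.
have f3 : iter 4 (ad br f) x = 0.
  have c0 : c != 0 by apply: contraNneq e0 => c0; rewrite eE c0 scale0r.
  have fE' : br f x = c^-1 *: e by rewrite eE scalerA mulVf ?scale1r.
  rewrite /= !adE // fE' !brZr // (brC lieP f e) !brNr //.
  by rewrite (brC lieP f (br e f)) (fE _ _ _ fG) !brNr // !brZr // brxx // !(scaler0, oppr0).
by move/eqP: x0; apply; apply: (sl2_Finj io sl2 hx (leqnn 4) f3).
Qed.

Lemma commute_iter x z t y : br z x = 0 -> br (iter t (ad br z) y) x = iter t (ad br z) (br y x).
Proof.
move=> zx; elim: t => // t IH; rewrite !iterS -IH !adE //.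
by rewrite (jacobi lieP z) addrC (brC lieP (iter _ _ _) (br z x)) zx br0l // oppr0 add0r.
Qed.

Definition p_killed l x := x \in G 0 l /\ forall i e, e \in G (p i) 0 -> br e x = 0.

(** Such an x is killed by the f_i too, since [f_i, x] has weight -2 and is killed by e_i. That
    [G a 0] kills x passes along the operators of [refl_op], which commute with ad x, from the
    simple roots to all indivisible ones; divisible roots do not occur in degree 0. *)
Lemma p_killed_central l x : p_killed l x -> forall y, y \in D 0 -> br y x = 0.
Proof.
move=> [xG xk].
have trip i : exists e f, [/\ e \in G (p i) 0, e != 0, f \in G (- p i) 0 &
    sl2_ops (ad br e) (ad br f) (ad br (br e f))] /\
    (forall b m x, x \in G b m -> br (br e f) x = io (cn b (p i)) *: x).
  have [e eG e0] := p0 i; have [f [fG sl2 fE]] := deg0_sl2 (base_root BP i) eG e0.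
  by exists e, f.
have kf_ i e f : e \in G (p i) 0 -> f \in G (- p i) 0 ->
    sl2_ops (ad br e) (ad br f) (ad br (br e f)) ->
    (forall b m x, x \in G b m -> br (br e f) x = io (cn b (p i)) *: x) -> br f x = 0.
  move=> eG fG sl2 fE; have fxG := gr_br GR fG xG.
  apply: (sl2_Eneg io sl2 (p := 1)).
    rewrite adE // (fE _ _ _ fxG) addr0 cnNl cnxx ?(root_neq0 RS) ?(base_root BP) //.
    by rewrite rmorphN rmorph_nat.
  rewrite !adE // (jacobi lieP) (xk i e eG) br0r // addr0 (fE _ _ _ xG).
  by rewrite /cn dot0l mulr0 mul0r rmorph0 scale0r.
have ind a : a \in Phi -> indivisible Phi a -> forall y, y \in G a 0 -> br y x = 0.
  apply: (base_orbit RS (S := fun a => forall y, y \in G a 0 -> br y x = 0) BP).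
  - by move=> i y yG; apply: (xk i).
  - move=> i y yG; have [e [f [[eG e0 fG sl2] fE]]] := trip i.
    have f0 : f != 0.
      apply: contraNneq e0 => f0; have := fE _ _ _ eG.
      rewrite f0 br0r // br0l // cnxx ?(root_neq0 RS) ?(base_root BP) // rmorph_nat => /esym/eqP.
      by rewrite scaler_eq0 (natk_eq0 io).
    have [c ->] := gr_dim GR (root_opp RS (base_root BP i)) fG f0 yG.
    by rewrite brZl // (kf_ i e) ?scaler0.
  move=> i b bP Sb y yG; have [e [f [[eG e0 fG sl2] fE]]] := trip i.
  have pP := base_root BP i; have rP := rs_refl RS pP bP.
  have [z [t [zef zt]]] := refl_op pP rP eG fG sl2 fE.
  have zx : br z x = 0 by case: zef => ->; [apply: (xk i) | apply: (kf_ i e)].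
  have [tG t0] := zt _ _ yG; rewrite reflK ?(root_neq0 RS) // in tG.
  have yxG : br y x \in G (refl (p i) b) (0 + l).
    by rewrite -[refl _ b]addr0; apply: (gr_br GR yG xG).
  by apply: (zt _ _ yxG).2; rewrite -commute_iter // Sb.
apply: D_ind.
- by rewrite br0l.
- by move=> y1 y2 h1 h2; rewrite brDl // h1 h2 addr0.
move=> a y yG; have [aw|aw] := boolP (a \in 0 :: Phi); last first.
  by rewrite (gr_vanish aw yG) br0l.
move: aw; rewrite inE => /orP[/eqP a0|aP].
  have [c [c0 cE]] := gr_cart GR (y := y) 0 (etrans (congr1 (fun a => y \in G a 0) (esym a0)) yG).
  by rewrite (cE _ _ xG) c0 ?scale0r.
case: (classic (indivisible Phi a)) => [aI|/(divisible_half RS aP)[b bP [bI aE]]].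
  exact: ind yG.
rewrite (_ : y = 0) ?br0l //; apply: (deg0_divisible bP _ bI).
by rewrite -aE.
Qed.

Lemma simple_inj : injective p.
Proof.
move=> i j E; apply/eqP; have := base_dual BP i i; rewrite E (base_dual BP) eqxx.
by move=> /eqP; rewrite eqr_nat eqb1.
Qed.

Lemma simple_diff i j : j != i -> p i - p j \notin 0 :: Phi.
Proof.
move=> ji; rewrite inE negb_or subr_eq0 (inj_eq simple_inj) eq_sym ji /=.
by apply: (base_diff BP); rewrite eq_sym.
Qed.

(** The e_i and scaled f_i are summed so that every simple root takes the value 2 on [H]. Cross
    terms [e_i, f_j] vanish, as p_i - p_j is neither 0 nor a root. *)
Lemma principal_sl2 : exists (e f : 'I_l0 -> g) (r : 'I_l0 -> rat) (H : g),
  let E := \sum_i e i in let F := \sum_i io (r i) *: f i in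
  [/\ forall i, e i \in G (p i) 0 /\ e i != 0, forall i, f i \in G (- p i) 0,
      sl2_ops (ad br E) (ad br F) (ad br H),
      forall l x, x \in G 0 l -> br H x = 0 &
      forall i l x, x \in G (p i) l -> br H x = 2%:R *: x].
Proof.
have trip i : exists ef : g * g, [/\ ef.1 \in G (p i) 0, ef.1 != 0, ef.2 \in G (- p i) 0 &
    forall b m x, x \in G b m -> br (br ef.1 ef.2) x = io (cn b (p i)) *: x].
  have [e eG e0] := p0 i; have [f [fG sl2 fE]] := deg0_sl2 (base_root BP i) eG e0.
  by exists (e, f).
pose ef i := projT1 (constructive_indefinite_description _ (trip i)).
have efP i : [/\ (ef i).1 \in G (p i) 0, (ef i).1 != 0, (ef i).2 \in G (- p i) 0 &
    forall b m x, x \in G b m -> br (br (ef i).1 (ef i).2) x = io (cn b (p i)) *: x].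
  exact: projT2 (constructive_indefinite_description _ (trip i)).
have [C CE] := base_dual_combination BP.
(* [C] is inverse to the Gram matrix, so the sum over i of r_i times the Cartan number of p_t
   against p_i equals 2. *)
pose r i := dot (p i) (p i) * \sum_j C j i.
pose e i := (ef i).1; pose f i := (ef i).2.
pose H := \sum_i io (r i) *: br (e i) (f i).
have eG i : e i \in G (p i) 0 by case: (efP i).
have fG i : f i \in G (- p i) 0 by case: (efP i).
have HE b m x : x \in G b m -> br H x = io (\sum_i r i * cn b (p i)) *: x.
  move=> xG; rewrite br_suml // rmorph_sum scaler_suml; apply: eq_bigr => i _.
  by rewrite brZl //; case: (efP i) => _ _ _ h; rewrite (h _ _ _ xG) scalerA -rmorphM.
have Hp t : \sum_i r i * cn (p t) (p i) = 2%:R.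
  rewrite (eq_bigr (fun i => \sum_j 2%:R * (C j i * dot (p i) (p t)))) => [|i _].
    rewrite exchange_big /= (eq_bigr (fun j => 2%:R * (j == t)%:R)) => [|j _]; last first.
      by rewrite -mulr_sumr CE.
    by rewrite (bigD1 t) //= eqxx mulr1 big1 ?addr0 // => j /negPf->; rewrite mulr0.
  have pn0 : dot (p i) (p i) != 0 by rewrite dot_eq0 (root_neq0 RS) ?(base_root BP).
  rewrite -mulr_sumr -mulr_suml /r /cn (dotC (p t)); field.
  by rewrite pn0.
have H0 l x : x \in G 0 l -> br H x = 0.
  move=> xG; rewrite (HE _ _ _ xG) big1 ?rmorph0 ?scale0r // => i _.
  by rewrite /cn dot0l mulr0 mul0r mulr0.
have H2 t l x : x \in G (p t) l -> br H x = 2%:R *: x.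
  by move=> xG; rewrite (HE _ _ _ xG) Hp rmorph_nat.
have H2' t l x : x \in G (- p t) l -> br H x = - (2%:R *: x).
  move=> xG; rewrite (HE _ _ _ xG) -(rmorph_nat io) -scaleNr -rmorphN -(Hp t) -sumrN.
  by congr (io _ *: _); apply: eq_bigr => i _; rewrite cnNl mulrN.
exists e, f, r, H; split=> //.
- by move=> i; case: (efP i).
apply: ad_sl2 => //.
- rewrite br_suml //; apply: eq_bigr => i _; rewrite br_sumr // (bigD1 i) //= brZr //.
  rewrite big1 ?addr0 // => j ji; rewrite brZr //.
  have efG : br (e i) (f j) \in G (p i - p j) (0 + 0) by apply: (gr_br GR).
  by rewrite (gr_vanish (simple_diff ji) efG) scaler0.
- by rewrite br_sumr // scaler_sumr; apply: eq_bigr => i _; rewrite (H2 i 0).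
rewrite br_sumr // scaler_sumr -sumrN; apply: eq_bigr => i _.
by rewrite brZr // (H2' i 0) // scalerN !scalerA mulrC.
Qed.

Definition invariant_space l (U : {vspace g}) := forall x, x \in U <-> p_killed l x.

Lemma ex_invariant_space l : exists U, invariant_space l U.
Proof.
apply: ex_vspace; first by split; [exact: mem0v | move=> i e _; rewrite br0r].
move=> c x y [xG xk] [yG yk]; split; first by rewrite memvD ?memvZ.
by move=> i e eG; rewrite br_lin_r // (xk i) // (yk i) // scaler0 addr0.
Qed.

(* Weight 0 of degree l splits under the principal sl2 as ker E + im F. *)
Lemma zero_weight_split l x : x \in G 0 l -> exists u s,
  [/\ p_killed l u, x = u + s &
      exists (f m : 'I_l0 -> g), (forall i, f i \in G (- p i) 0 /\ m i \in G (p i) l) /\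
         s = \sum_i br (f i) (m i)].
Proof.
move=> xG; have [e [f [r [H [eG fG sl2 H0 H2]]]]] := principal_sl2.
set E := \sum_i e i in sl2; set F := \sum_i io (r i) *: f i in sl2.
pose M2 := (\sum_i G (p i) l)%VS.
have FM (m : 'I_l0 -> g) : (forall i, m i \in G (p i) l) ->
    br F (\sum_i m i) = \sum_i br (io (r i) *: f i) (m i).
  move=> mG; rewrite br_suml //; apply: eq_bigr => j _; rewrite br_sumr // (bigD1 j) //=.
  rewrite big1 ?addr0 // => i ij; rewrite brZl //.
  have fmG : br (f j) (m i) \in G (p i - p j) (0 + l).
    by rewrite addrC; apply: (gr_br GR); [exact: fG | exact: mG].
  by rewrite (gr_vanish _ fmG) ?scaler0 // simple_diff // eq_sym.
have FM0 m : m \in M2 -> br F m \in G 0 l.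
  move=> /memv_sumP[c cG ->]; rewrite FM => [|i]; last exact: cG.
  apply: memv_suml => i _; rewrite brZl // memvZ //.
  by have := gr_br GR (fG i) (cG i isT); rewrite addNr add0r.
have EM y : y \in G 0 l -> br E y \in M2.
  move=> yG; rewrite br_suml //; apply: memv_sumr => i _.
  by have := gr_br GR (eG i).1 yG; rewrite addr0 add0r.
have HM m : m \in M2 -> br H m = 2%:R *: m.
  move=> /memv_sumP[c cG ->]; rewrite br_sumr // scaler_sumr.
  by apply: eq_bigr => i _; apply: H2; apply: cG.
have FF y : y \in G 0 l -> br E y = 0 -> br F y = 0.
  move=> yG Ey; have [EF HE HF] := sl2.
  have Hy : br H y = 0 by apply: H0 yG.
  apply: (sl2_Eneg io sl2 (p := 1)).
    have := HF y; rewrite !adE // => ->; rewrite Hy br0r // sub0r scaleNr.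
    by [].
  by have := EF y; rewrite !adE // => ->; rewrite Ey br0r // add0r Hy.
(* EF is injective on M2, where H acts by 2: if EFm = 0, then Fm has weight 0 and is killed by E,
   hence by F, whereas F^2 is injective in weight 2. So EF is onto M2, and some Fm has the same
   image under E as x. *)
pose T := (ad br E \o ad br F)%VF.
have Tinj : (M2 :&: lker T = 0)%VS.
  apply/eqP; rewrite -subv0; apply/subvP=> m; rewrite memv_cap memv_ker memv0.
  rewrite comp_lfunE !adE // => /andP[mM /eqP EFm]; apply/eqP.
  apply: (sl2_Finj io sl2 (p := 2) (t := 2)) => //; first by rewrite adE // HM.
  by rewrite /= !adE //; apply: FF => //; apply: FM0.
have TM : (T @: M2)%VS = M2.
  apply/eqP; rewrite eqEdim (limg_dim_eq Tinj) leqnn andbT.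
  apply/subvP=> _ /memv_imgP[m mM ->]; rewrite comp_lfunE !adE //.
  by apply/EM/FM0.
have /memv_imgP[m mM mE] : br E x \in (T @: M2)%VS by rewrite TM EM.
rewrite comp_lfunE !adE // in mE.
have uG : x - br F m \in G 0 l by rewrite memvB ?FM0.
have Eu : br E (x - br F m) = 0 by rewrite brDr // brNr // mE subrr.
exists (x - br F m), (br F m); split; last first.
- have /memv_sumP[c cG cE] := mM; exists (fun i => io (r i) *: f i), c; split.
    by move=> i; split; [rewrite memvZ | apply: cG].
  by rewrite cE FM // => i; apply: cG.
- by rewrite subrK.
split=> // i e' e'G; have [c ->] := gr_dim GR (base_root BP i) (eG i).1 (eG i).2 e'G.
rewrite brZl //; set u := x - _ in uG Eu *.
suff -> : br (e i) u = 0 by rewrite scaler0.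
(* Eu = 0 separates into weight components because the simple roots are distinct; hence every e_i
   kills u. *)
pose w a := \sum_(j | p j == a) br (e j) u.
have wG a : w a \in G a l.
  apply: memv_suml => j /eqP <-.
  by have := gr_br GR (eG j).1 uG; rewrite addr0 add0r.
have ws : \sum_(a <- undup [seq p j | j <- enum 'I_l0]) w a = 0.
  rewrite -[RHS]Eu br_suml // undup_id; last by rewrite (map_inj_uniq simple_inj) enum_uniq.
  rewrite big_map big_enum; apply: eq_bigr => j _; rewrite /w (bigD1 j) //= big1 ?addr0 // => t.
  by case/andP=> /eqP/simple_inj ->; rewrite eqxx.
have := comps_indep (undup_uniq _) wG _ ws (a := p i).
rewrite mem_undup map_f ?mem_enum // /w (bigD1 i) //= big1 ?addr0 => [->|t] //.
  move=> a; rewrite mem_undup => /mapP[j _ ->]; rewrite mem_wts inE (base_root BP).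
  by rewrite orbT.
by case/andP=> /eqP/simple_inj ->; rewrite eqxx.
Qed.

Lemma kf_sym0 x : kf br x 0 = 0.
Proof. by rewrite kfC -(scale0r (0 : g)) kfZl // mul0r. Qed.

Lemma kf_p_killed l u y z : p_killed l u -> y \in D 0 -> kf br u (br y z) = 0.
Proof.
move=> uk yD; rewrite -kf_inv // (brC lieP) (p_killed_central uk yD) oppr0 kfC.
exact: kf_sym0.
Qed.

Lemma kf_killed_split l u f m : p_killed l u ->
  (forall i : 'I_l0, f i \in G (- p i) 0 /\ m i \in G (p i) (- l)) ->
  kf br u (\sum_i br (f i) (m i)) = 0.
Proof.
move=> uk fm; elim/big_rec: _ => [|i y _ yE]; first exact: kf_sym0.
rewrite kfC kfDl // kfC (kfC _ y) yE addr0; apply: (kf_p_killed _ uk).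
by apply: G_D (fm i).1.
Qed.

(** Sums of brackets [f_i, m_i] are orthogonal to invariants, so by [zero_weight_split] only the
    invariants of degree -l are left to pair with u. *)
Lemma kf_p_killed_nondeg l u : p_killed l u ->
  (forall u', p_killed (- l) u' -> kf br u u' = 0) -> u = 0.
Proof.
move=> uk H; apply: (gr_kf GR uk.1) => y; rewrite oppr0 => yG.
have [u' [s [u'k -> [f [m [fm ->]]]]]] := zero_weight_split yG.
by rewrite kfC kfDl // kfC (H _ u'k) add0r kfC; apply: (kf_killed_split uk).
Qed.

(** Defined as an orthogonal complement, it is a submodule by invariance of the form, and
    nondegeneracy on invariants makes it a complement of the invariants of degree l. *)
Definition nontrivial_part l (V : {vspace g}) := forall x,
  x \in V <-> x \in D l /\ forall u, p_killed (- l) u -> kf br u x = 0.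

Lemma ex_nontrivial_part l : exists V, nontrivial_part l V.
Proof.
apply: ex_vspace; first by split; [exact: mem0v | move=> u _; exact: kf_sym0].
move=> c x y [xD xK] [yD yK]; split; first by rewrite memvD ?memvZ.
by move=> u uk; rewrite kfC kf_lin // kfC (kfC _ y) (xK u uk) (yK u uk) mulr0 addr0.
Qed.

Section Degree.
Variables (l : L) (U V : {vspace g}).
Hypothesis UP : invariant_space l U.
Hypothesis VP : nontrivial_part l V.

Lemma invariant_nontrivial0 : (U :&: V = 0)%VS.
Proof.
apply/eqP; rewrite -subv0; apply/subvP=> x; rewrite memv_cap memv0.
case/andP=> /UP xk /VP[_ xK]; apply/eqP; apply: (kf_p_killed_nondeg xk) => u uk.
by rewrite kfC xK.
Qed.

Lemma nonzero_weight_nontrivial a x : a \in Phi -> x \in G a l -> x \in V.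
Proof.
move=> aP xG; apply/VP; split; first exact: G_D xG.
by move=> u [uG _]; apply: (gr_kf0 GR uG xG); rewrite add0r (root_neq0 RS).
Qed.

Lemma split_nontrivial f m : (forall i : 'I_l0, f i \in G (- p i) 0 /\ m i \in G (p i) l) ->
  \sum_i br (f i) (m i) \in V.
Proof.
move=> fm; apply/VP; split.
  apply: memv_suml => i _; have [fG mG] := fm i.
  by apply: D_br0; [apply: G_D fG | apply: G_D mG].
by move=> u uk; apply: (kf_killed_split uk); rewrite opprK.
Qed.

Lemma invariant_nontrivial : (U + V)%VS = D l.
Proof.
apply/eqP; rewrite eqEsubv; apply/andP; split.
  rewrite subv_add; apply/andP; split; apply/subvP=> x.
    by move/UP=> [xG _]; apply: G_D xG.
  by case/VP.
apply/subvP; apply: D_ind.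
- exact: mem0v.
- by move=> x y; apply: memvD.
move=> a x xG; have [aw|aw] := boolP (a \in 0 :: Phi); last first.
  by rewrite (gr_vanish aw xG) mem0v.
move: aw; rewrite inE => /orP[/eqP a0|aP].
  rewrite a0 in xG; have [u [s [uk -> [f [m [fm ->]]]]]] := zero_weight_split xG.
  by rewrite memv_add ?split_nontrivial //; apply/UP.
by rewrite -[x]add0r memv_add ?mem0v // (nonzero_weight_nontrivial aP).
Qed.

Lemma nontrivial_submod x v : x \in D 0 -> v \in V -> br x v \in V.
Proof.
move=> xD /VP[vD vK]; apply/VP; split; first exact: D_br0.
by move=> u uk; apply: kf_p_killed uk xD.
Qed.

Variable W : {vspace g}.
Hypothesis WV : (W <= V)%VS.
Hypothesis Wsub : forall x v, x \in D 0 -> v \in W -> br x v \in W.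
Hypothesis Wn0 : W != 0%VS.

Lemma sub_comps x c : x \in W -> comps l x c -> forall a, c a \in W.
Proof.
move=> xW [cG xE] a; have [aw|aw] := boolP (a \in wts).
  apply: (@comps_stable W wts l c _ uniq_wts _ cG) => //; last by rewrite -xE.
  by move=> y yW; apply: Wsub => //; apply: G_D (gr_tau GR).
by rewrite (gr_vanish _ (cG a)) ?mem0v // -mem_wts.
Qed.

Definition sub_weight a : bool :=
  if excluded_middle_informative (exists x, [/\ x \in W, x \in G a l & x != 0]) then true else false.

Lemma sub_weightP a : sub_weight a <-> exists x, [/\ x \in W, x \in G a l & x != 0].
Proof. by rewrite /sub_weight; case: excluded_middle_informative. Qed.

(** A submodule of V with weight 0 only is killed by the simple root vectors, hence lies in U as
    well. *)
Lemma sub_weight_n0 : exists2 a, a \in Phi & sub_weight a.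
Proof.
apply: NNPP => nW; pose x := vpick W.
have xW : x \in W by apply: memv_pick.
have x0 : x != 0 by rewrite vpick0.
have none a y : a \in Phi -> y \in W -> y \in G a l -> y = 0.
  move=> aP yW yG; apply/eqP/negPn/negP => y0; apply: nW; exists a => //.
  by apply/sub_weightP; exists y.
have /VP[xD _] := subvP WV _ xW; have [c cx] := (DP l x).1 xD.
have xE : x = c 0.
  rewrite {1}cx.2 /wts big_cons big_seq big1 ?addr0 // => a.
  rewrite mem_undup => aP; apply: (none a) => //; first exact: sub_comps cx _.
  exact: cx.1.
have xG : x \in G 0 l by rewrite xE; apply: cx.1.
case/eqP: x0; apply/eqP; rewrite -memv0 -invariant_nontrivial0 memv_cap (subvP WV) // andbT.
apply/UP; split=> // i e eG; apply: (none (p i)); first exact: base_root BP i.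
  by apply: Wsub => //; apply: G_D eG.
by have := gr_br GR eG xG; rewrite addr0 add0r.
Qed.

Lemma ind_sl2 a : a \in Phi -> exists b e f, [/\ b \in Phi, a = b \/ a = 2%:R *: b,
   e \in G b 0 /\ f \in G (- b) 0, sl2_ops (ad br e) (ad br f) (ad br (br e f)) &
   forall b' m x, x \in G b' m -> br (br e f) x = io (cn b' b) *: x].
Proof.
move=> aP; have [b [bP bI ab]] : exists b, [/\ b \in Phi, indivisible Phi b & a = b \/ a = 2%:R *: b].
  case: (classic (indivisible Phi a)) => [aI|/(divisible_half RS aP)[b bP [bI aE]]].
    by exists a; split=> //; left.
  by exists b; split=> //; right.
have [e eG e0] := deg0_indivisible bP bI; have [f [fG sl2 fE]] := deg0_sl2 bP eG e0.
by exists b, e, f.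
Qed.

Lemma sub_weight_refl a b : a \in Phi -> b \in Phi -> sub_weight b -> sub_weight (refl a b).
Proof.
move=> aP bP /sub_weightP[x [xW xG x0]].
have [a' [e [f [a'P aa' [eG fG] sl2 hE]]]] := ind_sl2 aP.
have [z [t [zef zt]]] := refl_op a'P bP eG fG sl2 hE; have [tG t0] := zt _ _ xG.
apply/sub_weightP; exists (iter t (ad br z) x); split.
- have zD : z \in D 0 by case: zef => ->; [apply: G_D eG | apply: G_D fG].
  by elim: t {zt tG t0} => //= t IH; rewrite adE // Wsub.
- by case: aa' => ->; rewrite ?refl_scale.
by apply: contraNneq x0 => /t0->.
Qed.

(** The weights of W are reflection-stable, so some weight a of W is acute to b. Then a = b or a - b
    is a root, and lowering operators of degree 0 lead from a to b. Weight spaces in a fixed degree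
    are lines, so reaching a nonzero vector suffices. *)
Lemma sub_weight_all b z : b \in Phi -> z \in G b l -> z \in W.
Proof.
move=> bP zG; have [->|z0] := eqVneq z 0; first exact: mem0v.
have [||a [aP /sub_weightP[w [wW wG w0]] ab]] := orbit_acute RS (X := sub_weight) _ _ bP.
- by move=> *; apply: sub_weight_refl.
- exact: sub_weight_n0.
have done_ b' v : b' \in Phi -> v \in W -> v \in G b' l -> v != 0 ->
    forall z', z' \in G b' l -> z' \in W.
  by move=> b'P vW vG v0 z' z'G; have [c ->] := gr_dim GR b'P vG v0 z'G; rewrite memvZ.
have [E|nab] := eqVneq a b; first by apply: (done_ a w) => //; rewrite E.
have cP := rs_string RS aP bP ab nab.
have [d [e [f [dP cd [eG fG] sl2 hE]]]] := ind_sl2 cP.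
have eD : e \in D 0 by apply: G_D eG.
have fD : f \in D 0 by apply: G_D fG.
have upG b' v : v \in G b' l -> br e v \in G (b' + d) l.
  by move=> vG; have := gr_br GR eG vG; rewrite add0r addrC.
have dnG b' v : v \in G (b' + d) l -> br f v \in G b' l.
  by move=> vG; have := gr_br GR fG vG; rewrite add0r addrC addrK.
have d0 := root_neq0 RS dP.
have step b' u v : b' \in Phi -> b' + d \in Phi -> u \in G b' l -> u != 0 ->
    v \in G (b' + d) l -> v != 0 -> br f v != 0.
  move=> b'P bdP uG u0 vG v0; have [c cE] := rs_int RS dP b'P.
  have [t tE] := gr_dim GR bdP vG v0 (upG _ _ uG).
  rewrite -adE //; apply: (sl2_adjacent io sl2 (c := c) (a := t) (u := u)) => //.
  - by rewrite adE // (hE _ _ _ uG) cE rmorph_int.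
  - by rewrite adE // (hE _ _ _ vG) cnDl cnxx // cE rmorphD rmorph_int rmorph_nat intrD.
  by rewrite adE.
case: cd => cd.
  have aE : a = b + d by rewrite -cd subrKC.
  rewrite aE in aP wG; apply: (done_ b (br f w)) => //; first exact: Wsub.
    exact: dnG.
  exact: (step b z w).
(* Degree 0 has root vectors for d but not for a - b = 2d, so the passage takes two steps through b
   + d, whose space must first be shown nonzero. *)
have aE : a = b + d + d by rewrite -addrA -mulr2n -scaler_nat -cd subrKC.
have bd0 : b + d != 0.
  apply: contraTneq ab => bd0; move: bd0 aE => /eqP; rewrite addr_eq0 => /eqP bE.
  rewrite bE addNr add0r => ->; rewrite dotNr oppr_gt0 -leNgt.
  exact: dot_ge0.
have [c cE] := rs_int RS dP bP.
(* For c < 0, raising z works; for c >= 0 the Cartan number of a against d is c + 4 > 0, so lowering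
   w works. *)
have [v vG v0] : exists2 v, v \in G (b + d) l & v != 0.
  have [c0|c0] := ltrP c 0.
    exists (br e z); first exact: upG.
    apply: contraNneq z0 => ez; apply/eqP; apply: (sl2_Eneg io sl2 (p := (absz c).-1)); last by rewrite adE.
    have cE' : cn b d = - ((absz c).-1.+1)%:R.
      by rewrite prednK ?absz_gt0 ?lt_eqF // cE pmulrn ltz0_abs // rmorphN opprK.
    by rewrite adE // (hE _ _ _ zG) cE' rmorphN rmorph_nat.
  exists (br f w); first by apply: dnG; rewrite -aE.
  apply: contraNneq w0 => fw; apply/eqP; apply: (sl2_Fpos io sl2 (p := (absz c).+3)); last by rewrite adE.
  have cE' : cn a d = ((absz c).+4)%:R.
    by rewrite aE !cnDl !cnxx // cE -[in LHS](gez0_abs c0) -addn4 natrD -addrA -natrD.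
  by rewrite adE // (hE _ _ _ wG) cE' rmorph_nat.
have bdP : b + d \in Phi by have := gr_supp GR vG v0; rewrite inE (negPf bd0).
have fw0 : br f w != 0 by apply: (step (b + d) v w) => //; rewrite -aE.
have fwG : br f w \in G (b + d) l by apply: dnG; rewrite -aE.
apply: (done_ b (br f (br f w))) => //; first by do 2!apply: Wsub => //.
  exact: dnG.
exact: (step b z (br f w)).
Qed.

Lemma sub_nontrivial : W = V.
Proof.
apply/eqP; rewrite eqEsubv WV; apply/subvP=> x xV.
have /VP[xD _] := xV; have [c [cG xE]] := (DP l x).1 xD.
have rest : \sum_(a <- undup Phi) c a \in W.
  rewrite big_seq; apply: memv_suml => a; rewrite mem_undup => aP.
  exact: sub_weight_all (cG a).
have [u [s [uk c0E [f [m [fm sE]]]]]] := zero_weight_split (cG 0).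
have sW : s \in W.
  rewrite sE; apply: memv_suml => i _; apply: Wsub; first by apply: G_D (fm i).1.
  by apply: sub_weight_all (base_root BP i) (fm i).2.
have xuW : x - u \in W.
  by rewrite xE /wts big_cons c0E addrAC [u + s]addrC addrK memvD.
suff u0 : u = 0 by rewrite -(subrK u x) u0 addr0 -u0.
apply/eqP; rewrite -memv0 -invariant_nontrivial0 memv_cap; apply/andP; split; first exact/UP.
by rewrite -(subKr x u) memvB // (subvP WV).
Qed.

Lemma sub_nontrivial_dim : (1 < \dim V)%N.
Proof.
have [a aP sa] := sub_weight_n0; have /sub_weightP[x [xW xG x0]] := sa.
have := sub_weight_refl aP aP sa; rewrite reflvv ?(root_neq0 RS) // => /sub_weightP[y [yW yG y0]].
have xy : (<[x]> :&: <[y]> = 0)%VS.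
  apply/eqP; rewrite -subv0; apply/subvP=> z; rewrite memv_cap memv0.
  case/andP=> /vlineP[s ->] /vlineP[t E].
  have a0 := root_neq0 RS aP.
  have nE : a != - a.
    by rewrite -subr_eq0 opprK -mulr2n -scaler_nat scaler_eq0 (negPf a0).
  pose C b := if b == a then s *: x else if b == - a then - (s *: x) else 0.
  have : C a = 0; last by rewrite /C eqxx => ->.
  apply: (@comps_indep [:: a; - a] l C); rewrite ?mem_head //.
  - by rewrite /= inE nE.
  - move=> b; rewrite /C; case: eqP => [->|_]; first by rewrite memvZ.
    by case: eqP => [->|_]; rewrite ?mem0v // memvN E memvZ.
  - by move=> b; rewrite !inE mem_undup => /orP[] /eqP->; rewrite ?root_opp ?aP ?orbT.
  by rewrite big_cons big_seq1 /C !eqxx [- a == a]eq_sym (negPf nE) subrr.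
have : (<[x]> + <[y]> <= V)%VS.
  by rewrite subv_add -!memvE !(subvP WV).
by move/dimvS; rewrite dimv_disjoint_sum // !dim_vline x0 y0.
Qed.
End Degree.

Theorem graded_module_decomposition l : exists U V : {vspace g},
  [/\ (U + V)%VS = D l, (U :&: V)%VS = 0%VS,
      (forall x u, x \in D 0 -> u \in U -> br x u = 0),
      (forall x v, x \in D 0 -> v \in V -> br x v \in V) &
      (V = 0%VS \/ (1 < \dim V)%N /\
         forall W : {vspace g}, (W <= V)%VS ->
           (forall x v, x \in D 0 -> v \in W -> br x v \in W) -> W = 0%VS \/ W = V)].
Proof.
have [U UP] := ex_invariant_space l; have [V VP] := ex_nontrivial_part l.
exists U, V; split.
- exact: invariant_nontrivial UP VP.
- exact: invariant_nontrivial0 UP VP.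
- by move=> x u xD /UP uk; apply: p_killed_central uk _ xD.
- by move=> x v xD vV; apply: (nontrivial_submod VP).
have [V0|V0] := eqVneq V 0%VS; first by left.
right; split=> //.
  apply: (sub_nontrivial_dim UP VP (subvv V) _ V0) => x v xD vV.
  exact: (nontrivial_submod VP).
move=> W WV Wsub; have [W0|W0] := eqVneq W 0%VS; first by left.
by right; apply: (sub_nontrivial UP VP).
Qed.

(** An invariant x of degree 0 commutes with all of [g]: a power of f maps [x, w] injectively into
    [x, weight 0], which is 0. So x = 0, degree 0 equals its nontrivial part, and irreducibility
    says that its ideals are trivial. *)
Theorem graded_deg0_simple : simple_in br (D 0).
Proof.
have l0p : exists i : 'I_l0, True.
  have [a aP] := Phi_n0; apply: NNPP => no.
  have := root_neq0 RS aP; rewrite (base_span BP aP) big1 ?eqxx // => i _.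
  by case: no; exists i.
split; first by move=> x y; apply: D_br0.
split.
  have [i _] := l0p; have [e eG e0] := p0 i.
  have [f [fG sl2 fE]] := deg0_sl2 (base_root BP i) eG e0.
  exists e, f; split; [exact: G_D eG | exact: G_D fG |].
  apply: contraNneq e0 => ef0; have := fE _ _ _ eG.
  rewrite ef0 br0l // cnxx ?(root_neq0 RS) ?(base_root BP) // rmorph_nat => /esym/eqP.
  by rewrite scaler_eq0 (natk_eq0 io).
have [U UP] := ex_invariant_space 0; have [V VP] := ex_nontrivial_part 0.
have central x : p_killed 0 x -> x = 0.
  move=> xk; have xG := xk.1; apply: (simple_center lieP (gr_simple GR)) => z.
  have [s sG ->] := gr_sum GR z; rewrite br_sumr // big_seq big1 // => w /sG[a [l wG]].
  have xk0 y : y \in D 0 -> br y x = 0 := p_killed_central xk (y := y).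
  have G0 m y : y \in G 0 m -> br x y = 0.
    by move=> yG; have [c [c0 cE]] := gr_cart GR 0 xG; rewrite (cE _ _ yG) c0 ?scale0r.
  have [aw|aw] := boolP (a \in 0 :: Phi); last by rewrite (gr_vanish aw wG) br0r.
  move: aw; rewrite inE => /orP[/eqP a0|aP]; first by rewrite a0 in wG; apply: G0 wG.
  have [b [e [f [bP ab [eG fG] sl2 hE]]]] := ind_sl2 aP.
  have [t [t12 aE]] : exists t : nat, (t.+1 <= t.+1 * 2)%N /\ a = t.+1%:R *: b.
    by case: ab => ->; [exists 0%N; rewrite scale1r | exists 1%N].
  have fx : br f x = 0 by apply: xk0; apply: G_D fG.
  have xwG : br x w \in G a l by have := gr_br GR xG wG; rewrite !add0r.
  have b0 := root_neq0 RS bP.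
  apply: (sl2_Finj io sl2 (p := (t.+1 * 2)%N) (t := t.+1)) => //.
    by rewrite adE // (hE _ _ _ xwG) aE cnZl cnxx // -natrM rmorph_nat.
  have E : iter t.+1 (ad br f) (br x w) = br x (iter t.+1 (ad br f) w).
    have iN n v : iter n (ad br f) (- v) = - iter n (ad br f) v.
      by elim: n => //= n ->; rewrite linearN.
    by rewrite (brC lieP x w) (brC lieP x (iter _ _ _)) (commute_iter _ _ fx) iN.
  rewrite E; apply: (G0 l).
  have := iter_br_G t.+1 fG wG; rewrite mul0rn add0r aE scalerN addNr.
  by [].
move=> I ID Isub.
have VD : V = D 0.
  rewrite -(invariant_nontrivial UP VP); suff -> : U = 0%VS by rewrite add0v.
  by apply/eqP; rewrite -subv0; apply/subvP=> x /UP/central->; rewrite mem0v.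
have [I0|I0] := eqVneq I 0%VS; first by left.
by right; rewrite -VD; apply: (sub_nontrivial UP VP) => //; rewrite VD.
Qed.
End Graded.

(** * Adapted bases of lattices *)

(* The rows of C form a basis of the lattice spanned by the rows of A, adapted to the
   sublattice m_1 Z + ... + m_n Z; this takes two Smith normal forms. *)
Lemma adapted_basis (n r : nat) (A : 'M[int]_(r, n)) (m : 'I_n -> nat) (B : 'M[int]_(n, r)) :
  (forall i, (0 < m i)%N) -> \matrix_(i, j) ((m i)%:Z *+ (i == j)) = B *m A ->
  exists (C : 'M[int]_n) (d : 'I_n -> nat) (A' : 'M[int]_(r, n)) (C' : 'M[int]_(n, r)),
  [/\ forall i, (0 < d i)%N, A = A' *m C, C = C' *m A,
      forall y : 'rV[int]_n, (forall i, ((m i)%:Z %| (y *m C) ord0 i)%Z) <->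
        (forall i, ((d i)%:Z %| y ord0 i)%Z)
    & forall y : 'rV[int]_n, y *m C = 0 -> y = 0].
Proof.
move=> m0 mE; set M := \matrix_(i, j) _ in mE.
have MdE : M = diag_mx (\row_i (m i)%:Z) by apply/matrixP=> i j; rewrite !mxE.
have detM : \det M != 0.
  rewrite MdE det_diag; apply/prodf_neq0 => i _; rewrite mxE.
  by rewrite -lt0n m0.
have [Lx Lu [R Ru [s _ AE]]] := int_Smith_normal_form A.
(* The Smith form of [A] is rectangular. The truncated identities [T] and [T'] trade it for the
   square [Dg], and the rows of Dg R span the same lattice as those of [A]. *)
pose T : 'M[int]_(r, n) := \matrix_(i, j) ((i == j :> nat)%:R).
pose T' : 'M[int]_(n, r) := \matrix_(i, j) ((i == j :> nat)%:R).
pose Dg : 'M[int]_n := \matrix_(i, j) ((if (i < r)%N then s`_i else 0) *+ (i == j)).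
set S := \matrix_(i, j) _ in AE.
have ST : S = T *m Dg.
  apply/matrixP=> i j; rewrite !mxE; have [ij|ij] := eqVneq (i : nat) j.
    rewrite (bigD1 j) //= big1 => [|t tj]; last by rewrite !mxE (negPf tj) mulr0n mulr0.
    by rewrite !mxE ij !eqxx mul1r addr0 (_ : (j < r)%N) // -ij ltn_ord.
  rewrite mulr0n big1 // => t _; rewrite !mxE; have [it|it] := eqVneq (i : nat) t.
    by rewrite (_ : (t == j) = false) ?mulr0n ?mulr0 //; apply/negbTE; rewrite -val_eqE /= -it.
  by rewrite mul0r.
have TS : T' *m S = Dg.
  apply/matrixP=> i j; rewrite !mxE; case: ifP => ir; last first.
    rewrite mul0rn big1 // => t _; rewrite !mxE (_ : (i == t :> nat) = false) ?mul0r //.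
    by apply: contraFF ir => /eqP->; rewrite ltn_ord.
  rewrite (bigD1 (Ordinal ir)) //= big1 ?addr0 => [|t ti].
    by rewrite !mxE /= eqxx mul1r -val_eqE.
  rewrite !mxE (_ : (i == t :> nat) = false) ?mul0r //.
  by apply: contraNF ti => /eqP it; apply/eqP/val_inj; rewrite /= it.
pose C0 := Dg *m R; pose B0 := B *m (Lx *m T).
have AC0 : A = (Lx *m T) *m C0 by rewrite /C0 mulmxA -(mulmxA Lx) -ST -AE.
have C0A : C0 = (T' *m invmx Lx) *m A.
  by rewrite AE !mulmxA mulmxKV // TS.
have MB : M = B0 *m C0 by rewrite mE /B0 -mulmxA -AC0.
(* [B0] expresses the vectors m_i e_i through the rows of [C0]. Its Smith form L1 D1 R1 changes
   these rows to C = R1 C0, in which the sublattice is given by the diagonal D1, as L1 is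
   unimodular. *)
have [L1 L1u [R1 R1u [d1 _ BE]]] := int_Smith_normal_form B0.
set D1 := \matrix_(i, j) _ in BE.
pose C := R1 *m C0.
have MC : M = L1 *m D1 *m C by rewrite /C mulmxA -BE.
have detD : \det D1 != 0 /\ \det C != 0.
  move: detM; rewrite MC !det_mulmx !mulf_eq0 !negb_or.
  by case/andP=> /andP[_ ->] ->.
have D1E : D1 = diag_mx (\row_i d1`_i) by apply/matrixP=> i j; rewrite !mxE.
have dn0 (i : 'I_n) : d1`_i != 0.
  have [+ _] := detD; rewrite D1E det_diag => /prodf_neq0/(_ i isT).
  by rewrite mxE.
have inj (y : 'rV[int]_n) : y *m C = 0 -> y = 0.
  move=> yC; have : y *m C *m \adj C = 0 by rewrite yC mul0mx.
  rewrite -mulmxA mul_mx_adj mul_mx_scalar => /rowP Cy; apply/rowP=> i.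
  have := Cy i; rewrite !mxE => /eqP; rewrite mulf_eq0.
  by have [_ /negPf->] := detD; move/eqP.
exists C, (fun i => absz d1`_i), (Lx *m T *m invmx R1), (R1 *m (T' *m invmx Lx)); split=> //.
- by move=> i; rewrite lt0n absz_eq0.
- by rewrite /C mulmxA mulmxKV.
- by rewrite /C C0A mulmxA.
move=> y; split=> [H i|H i].
  pose z : 'rV[int]_n := \row_i ((y *m C) ord0 i %/ (m i)%:Z)%Z.
  have zM : y *m C = z *m M.
    apply/rowP=> j; rewrite MdE mul_mx_diag !mxE divzK //.
    by have := H j; rewrite !mxE.
  have yE : y = z *m L1 *m D1.
    apply/eqP; rewrite -subr_eq0; apply/eqP/inj.
    by rewrite mulmxBl zM MC !mulmxA subrr.
  rewrite dvdzE absz_nat -dvdzE.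
  by rewrite yE D1E mul_mx_diag mxE [X in (_ %| _ * X)%Z]mxE dvdz_mull.
pose w : 'rV[int]_n := \row_i (y ord0 i %/ d1`_i)%Z.
have yE : y = w *m D1.
  apply/rowP=> j; rewrite D1E mul_mx_diag !mxE divzK //.
have -> : y *m C = (w *m invmx L1) *m M by rewrite MC !mulmxA mulmxKV // yE.
by rewrite MdE mul_mx_diag mxE [X in (_ %| _ * X)%Z]mxE dvdz_mull.
Qed.

(** * The root system of a multiloop datum *)

Lemma mem_leigenspace (k : fieldType) (g : vectType k) (f : 'End(g)) c x :
  (x \in passmx.leigenspace f c) = (f x == c *: x).
Proof.
by rewrite /passmx.leigenspace memv_ker add_lfunE opp_lfunE scale_lfunE id_lfunE subr_eq0.
Qed.

Lemma mem_geig (k : fieldType) (g : vectType k) n (sigma : 'I_n -> 'End(g)) m zeta lam x :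
  x \in geig sigma m zeta lam <->
  forall i, sigma i x = zeta (m i) ^ (lam ord0 i) *: x.
Proof.
rewrite memvE; split=> [/subv_bigcapP H i|H].
  by apply/eqP; rewrite -mem_leigenspace memvE H.
by apply/subv_bigcapP => i _; rewrite -memvE mem_leigenspace H.
Qed.

Lemma ex_hdual (k : fieldType) (g : vectType k) (br : g -> g -> g) (h : {vspace g}) x :
  is_lie br -> (forall t, t \in (vbasis h : seq g) -> exists c, br t x = c *: x) ->
  exists al : hdual h, wvec br al x.
Proof.
move=> L xh; have [->|x0] := eqVneq x 0.
  by exists 0 => y; rewrite br0r ?scaler0.
have xy y : y \in h -> exists c, br y x = c *: x.
  move=> yh; rewrite (coord_vbasis yh) br_suml //.
  elim/big_rec: _ => [|i z _ [c ->]]; first by exists 0; rewrite scale0r.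
  have [|d dE] := xh (vbasis h)`_i; first by rewrite mem_nth ?size_tuple.
  by exists (coord (vbasis h) i y * d + c); rewrite brZl // dE scalerA scalerDl.
have [i xi] : exists i, coord (vbasis {:g}) i x != 0.
  apply: NNPP => nx; case/eqP: x0; rewrite (coord_vbasis (memvf x)) big1 // => i _.
  by have [->|c] := eqVneq (coord (vbasis {:g}) i x) 0; [rewrite scale0r | case: nx; exists i].
pose ev (y : subvs_of h) : k^o := coord (vbasis {:g}) i (br (vsval y) x) / coord (vbasis {:g}) i x.
have lin : linear ev.
  move=> a u v; rewrite /ev linearP /= br_lin_l // linearP /=.
  by rewrite mulrDl -mulrA.
pose F : {linear subvs_of h -> k^o} := HB.pack ev (GRing.isLinear.Build _ _ _ _ _ lin).
exists (linfun F) => y; rewrite lfunE /= /ev.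
have [c ->] := xy _ (subvsP y); rewrite linearZ /= mulfK //.
Qed.

Section Datum.
Variables (k : closedFieldType) (g : vectType k) (br : g -> g -> g).
Variable io : {rmorphism rat -> k}.
Hypothesis lieP : is_lie br.
Hypothesis simpleP : simple_in br fullv.
Variables (n : nat) (sigma : 'I_n -> 'End(g)) (h : {vspace g}).
Hypothesis autP : forall i, is_lie_aut br (sigma i).
Hypothesis sigmaC : forall i j x, sigma i (sigma j x) = sigma j (sigma i x).
Hypothesis cartanP : cartan_sub br (gsig sigma) h.
Variables (zeta : nat -> k) (m : 'I_n -> nat).
Hypothesis zP : forall i, (m i).-primitive_root (zeta (m i)).
Hypothesis mP : forall i x, iter (m i) (sigma i) x = x.

Let sigma_diag i : diagop (sigma i).
Proof. exact: finite_order_diagop (zP i) (mP i). Qed.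

Local Notation geg := (geig sigma m zeta).

Let zeta_neq0 i : zeta (m i) != 0.
Proof. by rewrite (prim_root_eq0 (zP i)) -lt0n (prim_order_gt0 (zP i)). Qed.

Lemma geig_br l l' x y : x \in geg l -> y \in geg l' -> br x y \in geg (l + l').
Proof.
move=> /mem_geig xl /mem_geig yl; apply/mem_geig => i.
by rewrite (autP i).2 xl yl brZl // brZr // scalerA mxE expfzDr.
Qed.

Lemma geig0 : geg 0 = gsig sigma.
Proof.
apply/vspaceP=> x; apply/idP/idP => [/mem_geig H|/mem_gsig H]; [apply/mem_gsig|apply/mem_geig] => i.
  by rewrite H mxE expr0z scale1r.
by rewrite H mxE expr0z scale1r.
Qed.

Lemma geig_congr (l l' : 'rV[int]_n) : (forall i, (m i %| l ord0 i - l' ord0 i)%Z) -> geg l = geg l'.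
Proof.
have sub (u v : 'rV[int]_n) : (forall i, (m i %| u ord0 i - v ord0 i)%Z) -> {subset geg u <= geg v}.
  move=> H x /mem_geig xu; apply/mem_geig => i; rewrite xu.
  have /dvdzP[q qE] := H i; rewrite -(subrK (v ord0 i) (u ord0 i)) qE expfzDr //.
  have -> : zeta (m i) ^ (q * (m i)%:Z) = 1.
    by rewrite mulrC -exprz_exp -exprnP (prim_expr_order (zP i)) exp1rz.
  by rewrite mul1r.
move=> H; apply/vspaceP=> x; apply/idP/idP; apply: sub => // i.
by rewrite -opprB dvdzE abszN -dvdzE.
Qed.

Lemma geig_uniq (l l' : 'rV[int]_n) x : x != 0 -> x \in geg l -> x \in geg l' ->
  forall i, (m i %| l ord0 i - l' ord0 i)%Z.
Proof.
move=> x0 /mem_geig xl /mem_geig xl' i.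
have : zeta (m i) ^ (l ord0 i - l' ord0 i) = 1.
  have /eqP := xl i; rewrite xl' -subr_eq0 -scalerBl scaler_eq0 (negPf x0) orbF subr_eq0.
  by move=> /eqP E; rewrite expfzDr // -E -expfzDr // subrr.
move: (l ord0 i - l' ord0 i) => [] d; rewrite ?NegzE -?exprnN /= => /eqP.
  by rewrite -exprnP -(prim_order_dvd (zP i)).
by rewrite invr_eq1 -(prim_order_dvd (zP i)).
Qed.

Lemma hom_span v : sum_of (fun x => exists (al : hdual h) l, x \in geg l /\ wvec br al x) v.
Proof.
have [||s sP ->] := eig_list_span lieP autP sigmaC sigma_diag (ts := vbasis h) v.
- move=> t /vbasis_mem th; split; first exact: (cartan_gsig cartanP).
  exact: (cartan_diag io lieP simpleP autP sigmaC sigma_diag cartanP).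
- move=> t u /vbasis_mem th /vbasis_mem uh.
  exact: (cartan_abelian io lieP simpleP autP sigmaC sigma_diag cartanP).
exists s => // x /sP[xs xt]; have [al alP] := ex_hdual lieP xt.
have [x0|x0] := eqVneq x 0; first by exists al, 0; rewrite {1}x0 mem0v.
have xl i : exists e : nat, sigma i x = zeta (m i) ^+ e *: x.
  have [c xc] := xs i.
  have cm : c ^+ m i = 1.
    have E e : iter e (sigma i) x = c ^+ e *: x.
      elim: e => [|e IH]; first by rewrite scale1r.
      by rewrite iterS IH linearZ /= xc scalerA -exprSr.
    have /eqP := E (m i); rewrite mP -subr_eq0 -{1}[x]scale1r -scalerBl scaler_eq0 (negPf x0).
    by rewrite orbF subr_eq0 => /eqP <-.
  by have [e eE] := prim_rootP (zP i) cm; exists e; rewrite xc eE.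
pose e i := projT1 (constructive_indefinite_description _ (xl i)).
have eP i : sigma i x = zeta (m i) ^+ e i *: x.
  exact: projT2 (constructive_indefinite_description _ (xl i)).
exists al, (\row_i (e i)%:Z); split=> //; apply/mem_geig => i.
by rewrite mxE eP.
Qed.

Local Notation N := (\dim {:g}).
Variable b : N.-tuple g.
Variable al : 'I_N -> hdual h.
Variable de : 'I_N -> 'rV[int]_n.
Hypothesis bb : basis_of fullv b.
Hypothesis bG : forall j, tnth b j \in geg (de j).
Hypothesis bW : forall j, wvec br (al j) (tnth b j).

Let hab x y : x \in h -> y \in h -> br x y = 0.
Proof. exact: (cartan_abelian io lieP simpleP autP sigmaC sigma_diag cartanP). Qed.

Let b_neq0 j : tnth b j != 0.
Proof.
apply: contraTneq (basis_free bb) => b0; apply/negP=> /free_not0/(_ (mem_tnth j b)).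
by rewrite b0 eqxx.
Qed.

Definition hev (alpha : hdual h) (y : g) : k := alpha (vsproj h y).

Lemma hev_lin al' a x y : hev al' (a *: x + y) = a * hev al' x + hev al' y.
Proof. by rewrite /hev !linearP. Qed.

Lemma wvecE al' x y : wvec br al' x -> y \in h -> br y x = hev al' y *: x.
Proof. by move=> W yh; have := W (vsproj h y); rewrite vsprojK. Qed.

Lemma wvecP al' x : (forall y, y \in h -> br y x = hev al' y *: x) -> wvec br al' x.
Proof. by move=> H y; rewrite H ?subvsP // /hev vsvalK. Qed.

Lemma wvec_lin (al' : hdual h) a x y : wvec br al' x -> wvec br al' y -> wvec br al' (a *: x + y).
Proof. by move=> X Y z; rewrite br_lin_r // X Y scalerDr !scalerA mulrC. Qed.

Lemma wvec_br (a c : hdual h) x y : wvec br a x -> wvec br c y -> wvec br (a + c) (br x y).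
Proof.
by move=> X Y z; rewrite jacobi // X Y brZl // brZr // add_lfunE scalerDl.
Qed.

Lemma wvec_coord al' x j : wvec br al' x -> coord b j x != 0 -> al j = al'.
Proof.
move=> X xj; apply/lfunP => y; have := X y.
rewrite {1}(basis_coordE x bb) br_sumr // => E.
have := congr1 (coord b j) E; rewrite linearZ /=.
under eq_bigr => i _ do rewrite brZr // bW scalerA.
rewrite (coord_basisE (fun i => coord b i x * al i y)) ?(basis_free bb) //.
by rewrite mulrC => /mulIf; apply.
Qed.

Lemma geig_coord l x j : x \in geg l -> coord b j x != 0 ->
  forall i, (m i %| de j ord0 i - l ord0 i)%Z.
Proof.
move=> xl xj; apply: (geig_uniq (b_neq0 j) (bG j)); apply/mem_geig => i.
have /mem_geig/(_ i) sx := xl; have /mem_geig/(_ i) sb := bG j; rewrite sb; congr (_ *: _).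
have E : sigma i x = \sum_t (coord b t x * zeta (m i) ^ de t ord0 i) *: tnth b t.
  rewrite {1}(basis_coordE x bb) linear_sum; apply: eq_bigr => t _.
  by rewrite linearZ /=; have /mem_geig/(_ i) -> := bG t; rewrite scalerA.
have := congr1 (coord b j) E; rewrite sx linearZ /=.
rewrite (coord_basisE (fun t => coord b t x * zeta (m i) ^ de t ord0 i)) ?(basis_free bb) //.
by rewrite mulrC => /mulfI E'; apply/esym/E'.
Qed.

Lemma wvec0_h x : x \in gsig sigma -> wvec br (0 : hdual h) x -> x \in h.
Proof.
move=> xS X; apply: (cartan_norm cartanP) => // y yh.
by rewrite (brC lieP) (wvecE X yh) /hev zero_lfunE scale0r oppr0 mem0v.
Qed.

Lemma h_wvec0 x : x \in h -> wvec br (0 : hdual h) x.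
Proof. by move=> xh y; rewrite zero_lfunE scale0r hab ?subvsP. Qed.

(** Computed in the homogeneous basis, each weight counted with multiplicity. This sum of products
    becomes the dot product under [rv]. *)
Lemma kf_h x y : x \in h -> y \in h -> kf br x y = \sum_j hev (al j) x * hev (al j) y.
Proof.
move=> xh yh; rewrite /kf (trU_basis bb) => [|v _]; last exact: memvf.
apply: eq_bigr => j _; rewrite comp_lfunE !adE // (wvecE (bW j) yh) brZr //.
rewrite (wvecE (bW j) xh) scalerA linearZ /= (tnth_nth 0) coord_free ?(basis_free bb) //.
by rewrite eqxx mulr1 mulrC.
Qed.

Lemma kf_h_nondeg x : x \in h -> (forall y, y \in h -> kf br x y = 0) -> x = 0.
Proof. exact: (cartan_kf_nondeg io lieP simpleP autP sigmaC sigma_diag cartanP). Qed.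

Lemma dualv_ex al' : exists t, t \in h /\ forall y, y \in h -> kf br t y = hev al' y.
Proof.
have [||t th tE] := kf_repr lieP (U := h) (phi := hev al').
- exact: hev_lin.
- exact: kf_h_nondeg.
by exists t; split=> // y yh; rewrite tE.
Qed.

Definition dualv al' := projT1 (constructive_indefinite_description _ (dualv_ex al')).

Lemma dualv_h al' : dualv al' \in h.
Proof. by case: (projT2 (constructive_indefinite_description _ (dualv_ex al'))). Qed.

Lemma kf_dualv al' y : y \in h -> kf br (dualv al') y = hev al' y.
Proof. by case: (projT2 (constructive_indefinite_description _ (dualv_ex al'))) => _; apply. Qed.

Lemma hev_dualv a c : hev a (dualv c) = hev c (dualv a).
Proof. by rewrite -kf_dualv ?dualv_h // kfC kf_dualv ?dualv_h. Qed.

Lemma dualv_lin t a c : dualv (t *: a + c) = t *: dualv a + dualv c.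
Proof.
apply/eqP; rewrite -subr_eq0; apply/eqP/kf_h_nondeg.
  by rewrite memvB ?memvD ?memvZ ?dualv_h.
move=> y yh; rewrite addrC -scaleN1r kf_lin // kf_lin // !kf_dualv //.
by rewrite /hev add_lfunE scale_lfunE; apply/eqP; rewrite mulN1r addrC subr_eq0.
Qed.

Lemma dot_dualv a c : \sum_i hev (al i) (dualv a) * hev (al i) (dualv c) = hev a (dualv c).
Proof. by rewrite -kf_h ?dualv_h // kf_dualv ?dualv_h. Qed.

Lemma dualv_inj a : (forall i, hev (al i) (dualv a) = 0) -> a = 0.
Proof.
move=> H; have t0 : dualv a = 0.
  apply: kf_h_nondeg; first exact: dualv_h.
  by move=> y yh; rewrite kf_h ?dualv_h // big1 // => i _; rewrite H mul0r.
apply/lfunP=> y; rewrite zero_lfunE.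
have := kf_dualv a (subvsP y); rewrite t0 kfC kf0r // /hev vsvalK => <-.
by [].
Qed.

Lemma kf_pair (a : hdual h) l x : x \in geg l -> wvec br a x ->
  (forall y, y \in geg (- l) -> wvec br (- a) y -> kf br x y = 0) -> x = 0.
Proof.
move=> xl X H; apply: (kf_nondeg io lieP simpleP) => y.
rewrite (basis_coordE y bb); elim/big_rec: _ => [|j z _ zE]; first exact: kf0r.
rewrite kfDr // kfZr // zE addr0.
suff -> : kf br x (tnth b j) = 0 by rewrite mulr0.
have [aj|aj] := eqVneq (al j) (- a); last first.
  have [y0 yn] : exists y : subvs_of h, a y + al j y != 0.
    apply: NNPP => no; case/eqP: aj; apply/lfunP=> y0; rewrite opp_lfunE.
    apply/eqP; rewrite -addr_eq0 addrC; apply/negPn/negP => yn; apply: no.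
    by exists y0.
  exact: (kf_eig_orth lieP (X y0) (bW j y0) yn).
case: (classic (forall i, (m i %| de j ord0 i - (- l) ord0 i)%Z)) => [dj|ndj].
  by apply: H; [rewrite -(geig_congr dj) | rewrite -aj].
have [i ni] := not_all_ex_not _ _ ndj.
have /mem_geig/(_ i) sx := xl; have /mem_geig/(_ i) sb := bG j.
apply: (kf_sigma_orth lieP autP sx sb); rewrite -expfzDr //.
apply/eqP => E; apply: ni; rewrite mxE opprK addrC.
move: E; case: (l ord0 i + de j ord0 i) => d; rewrite ?NegzE -?exprnN /= => /eqP.
  by rewrite -exprnP -(prim_order_dvd (zP i)).
by rewrite invr_eq1 -(prim_order_dvd (zP i)).
Qed.

Lemma br_dualv (a : hdual h) l e f : e \in geg l -> wvec br a e -> f \in geg (- l) ->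
  wvec br (- a) f -> br e f = kf br e f *: dualv a.
Proof.
move=> el eW fl fW; have efh : br e f \in h.
  apply: wvec0_h; first by rewrite -geig0 -(subrr l) geig_br.
  by rewrite -(subrr a); apply: wvec_br.
apply/eqP; rewrite -subr_eq0; apply/eqP/kf_h_nondeg.
  by rewrite memvB ?memvZ ?dualv_h.
move=> y yh; rewrite addrC -scaleN1r scalerA kf_lin // kf_dualv // kf_inv // (brC lieP f).
rewrite (wvecE fW yh) -scaleNr kfZr // /hev opp_lfunE opprK.
by rewrite mulN1r mulNr mulrC addNr.
Qed.

(** If a vanished on its dual vector t, then e and f would commute with t, and [e, f], a nonzero
    multiple of t, would have trace 0 on each eigenspace of t. So every weight vanishes on t, and a
    = 0. *)
Lemma weight_norm_neq0 (a : hdual h) l e : a != 0 -> e \in geg l -> wvec br a e -> e != 0 ->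
  hev a (dualv a) != 0.
Proof.
move=> a0 el eW e0; have [f [fl fW ef]] : exists f, [/\ f \in geg (- l), wvec br (- a) f & kf br e f != 0].
  apply: NNPP => no; case/eqP: e0; apply: (kf_pair el eW) => f fl fW.
  by apply/eqP/negPn/negP => ef; apply: no; exists f.
apply: contra a0 => /eqP aa; apply/eqP/dualv_inj => j.
set c := hev (al j) (dualv a); set t := dualv a in aa c *.
have [||U UE] := @ex_vspace _ _ (fun v => br t v = c *: v).
- by rewrite br0r // scaler0.
- by move=> s u1 u2 e1 e2; rewrite br_lin_r // e1 e2 scalerDr !scalerA mulrC.
have th : t \in h by apply: dualv_h.
have te : br t e = 0 by rewrite (wvecE eW th) aa scale0r.
have tf : br t f = 0 by rewrite (wvecE fW th) /hev opp_lfunE -/(hev a t) aa oppr0 scale0r.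
have stab u : br t u = 0 -> forall v, v \in U -> ad br u v \in U.
  move=> tu u' /UE E; apply/UE; rewrite adE // jacobi // tu br0l // add0r E.
  by rewrite brZr.
have : trU U (ad br (br e f)) = 0.
  by rewrite ad_br // trUD trUN (trU_mulC (stab _ te) (stab _ tf)) subrr.
rewrite (trU_scal (c := kf br e f * c)) => [/eqP|u /UE uE]; last first.
  by rewrite adE // (br_dualv el eW fl fW) brZl // uE scalerA.
rewrite !mulf_eq0 (negPf ef) (natk_eq0 io) dimv_eq0 => /orP[/eqP//|/eqP U0].
have : tnth b j \in U by apply/UE; rewrite (wvecE (bW j) th).
by rewrite U0 memv0 (negPf (b_neq0 j)).
Qed.

Definition corootv (a : hdual h) : g := (2%:R / hev a (dualv a)) *: dualv a.

Lemma weight_sl2 (a : hdual h) l e : a != 0 -> e \in geg l -> wvec br a e -> e != 0 ->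
  exists f, [/\ f \in geg (- l), wvec br (- a) f, br e f = corootv a &
    sl2_ops (ad br e) (ad br f) (ad br (br e f))].
Proof.
move=> a0 el eW e0; have aa := weight_norm_neq0 a0 el eW e0.
have [f [fl fW ef]] : exists f, [/\ f \in geg (- l), wvec br (- a) f & kf br e f != 0].
  apply: NNPP => no; case/eqP: e0; apply: (kf_pair el eW) => f fl fW.
  by apply/eqP/negPn/negP => ef; apply: no; exists f.
pose c := 2%:R / hev a (dualv a) / kf br e f.
have fW' : wvec br (- a) (c *: f).
  by move=> y; rewrite brZr // fW !scalerA mulrC.
have E : br e (c *: f) = corootv a.
  by rewrite brZr // (br_dualv el eW fl fW) scalerA /c divfK.
have ch : corootv a \in h by rewrite memvZ ?dualv_h.
have aE : hev a (corootv a) = 2%:R.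
  have := hev_lin a (2%:R / hev a (dualv a)) (dualv a) 0; rewrite !addr0 => ->.
  by rewrite /hev !linear0 addr0 divfK.
exists (c *: f); split=> //; first by rewrite memvZ.
rewrite E; apply: ad_sl2 => //; first by rewrite (wvecE eW ch) aE.
by rewrite (wvecE fW' ch) /hev opp_lfunE -/(hev a (corootv a)) aE scaleNr.
Qed.

Lemma hev_coroot a c : hev c (corootv a) = 2%:R * hev c (dualv a) / hev a (dualv a).
Proof.
have := hev_lin c (2%:R / hev a (dualv a)) (dualv a) 0; rewrite !addr0 => ->.
by rewrite /hev !linear0 addr0; ring.
Qed.

Lemma weight_al (a : hdual h) x : wvec br a x -> x != 0 -> exists j, al j = a.
Proof.
move=> X x0; apply: NNPP => no; case/eqP: x0; rewrite (basis_coordE x bb) big1 // => j _.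
have [->|xj] := eqVneq (coord b j x) 0; first by rewrite scale0r.
by case: no; exists j; apply: wvec_coord X xj.
Qed.

Lemma coroot_int i j : al j != 0 -> exists c : int, hev (al i) (corootv (al j)) = c%:~R.
Proof.
move=> aj; have [f [fl fW E sl2]] := weight_sl2 aj (bG j) (bW j) (b_neq0 j).
apply: (sl2_integral io sl2 (v := tnth b i)) => //.
rewrite E adE // (wvecE (bW i)) ?memvZ ?dualv_h //.
Qed.

(** With c_t the integral values of the weights on the coroot of a = [al j] and q = (a, a), the
    pairings are c_t q / 2. Their squares sum to q, so q is 4 divided by the sum of the c_t^2. *)
Lemma rat_dualv i j : exists r : rat, io r = hev (al i) (dualv (al j)).
Proof.
have [->|aj] := eqVneq (al j) 0.
  by exists 0; rewrite rmorph0 hev_dualv /hev zero_lfunE.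
have aa := weight_norm_neq0 aj (bG j) (bW j) (b_neq0 j).
pose c t := projT1 (constructive_indefinite_description _ (coroot_int t aj)).
have cE t : hev (al t) (corootv (al j)) = (c t)%:~R.
  exact: projT2 (constructive_indefinite_description _ (coroot_int t aj)).
set q := hev (al j) (dualv (al j)) in aa *.
have tE t : hev (al t) (dualv (al j)) = (c t)%:~R * q / 2%:R.
  rewrite -cE hev_coroot -/q; field.
  by rewrite aa (natk_eq0 io).
pose s : rat := \sum_t (c t)%:~R ^+ 2.
have qE : q * io s = 4%:R.
  have := dot_dualv (al j) (al j); rewrite -/q.
  under eq_bigr => t _ do rewrite tE.
  have -> : \sum_t (c t)%:~R * q / 2%:R * ((c t)%:~R * q / 2%:R) = q ^+ 2 / 4%:R * io s.
    rewrite rmorph_sum mulr_sumr; apply: eq_bigr => t _.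
    rewrite rmorphXn /= rmorph_int; field.
    by rewrite !(natk_eq0 io).
  move=> E; have : q * (q * io s / 4%:R) = q * 1 by rewrite mulr1 -[RHS]E; ring.
  move/(mulfI aa) => E1; have := congr1 (fun z => z * 4%:R) E1.
  by rewrite /= mul1r divfK // (natk_eq0 io).
have s0 : io s != 0.
  by apply/eqP=> s0; have := natk_eq0 io 4; rewrite -qE s0 mulr0 eqxx.
exists ((c i)%:~R * 2%:R / s); rewrite tE fmorph_div rmorphM rmorph_int rmorph_nat.
have -> : q = 4%:R / io s by rewrite -qE mulfK.
field; rewrite s0 (natk_eq0 io).
by [].
Qed.

Definition rational_weight (a : hdual h) := forall i, exists r : rat, io r = hev (al i) (dualv a).

(** By [dot_dualv], recording all pairings with the basis weights makes the dot product the Killing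
    form transported to weights. An entry is arbitrary when the pairing is irrational. *)
Definition rv (a : hdual h) : 'rV[rat]_N :=
  \row_i epsilon (inhabits 0) (fun r : rat => io r = hev (al i) (dualv a)).

Lemma rvE a i : rational_weight a -> io (rv a 0 i) = hev (al i) (dualv a).
Proof. by move=> ra; rewrite mxE; apply: (epsilon_spec (inhabits (0 : rat)) _ (ra i)). Qed.

Lemma rational_al j : rational_weight (al j).
Proof. by move=> i; apply: rat_dualv. Qed.

Lemma hev_sum_lin i t a c : hev (al i) (dualv (t *: a + c)) = t * hev (al i) (dualv a) + hev (al i) (dualv c).
Proof. by rewrite dualv_lin hev_lin. Qed.

Lemma rational_lin (q : rat) a c : rational_weight a -> rational_weight c ->
  rational_weight (io q *: a + c).
Proof.
move=> ra rc i; have [r rE] := ra i; have [s sE] := rc i.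
by exists (q * r + s); rewrite hev_sum_lin rmorphD rmorphM rE sE.
Qed.

Lemma rv_lin (q : rat) a c : rational_weight a -> rational_weight c ->
  rv (io q *: a + c) = q *: rv a + rv c.
Proof.
move=> ra rc; apply/rowP=> i; apply: (fmorph_inj io).
rewrite rvE; last exact: rational_lin.
have -> : (q *: rv a + rv c) 0 i = q * rv a 0 i + rv c 0 i.
  by rewrite mxE [in X in X + _]mxE.
by rewrite hev_sum_lin -(rvE i ra) -(rvE i rc) rmorphD rmorphM.
Qed.

Lemma rational0 : rational_weight 0.
Proof. by move=> i; exists 0; rewrite rmorph0 hev_dualv /hev zero_lfunE. Qed.

Lemma rationalD a c : rational_weight a -> rational_weight c -> rational_weight (a + c).
Proof. by move=> ra rc; rewrite -[a]scale1r -(rmorph1 io); apply: rational_lin. Qed.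

Lemma rationalN a : rational_weight a -> rational_weight (- a).
Proof.
move=> ra; rewrite -scaleN1r -[_ *: a]addr0 -(rmorph1 io) -rmorphN.
by apply: rational_lin => //; apply: rational0.
Qed.

Lemma rv0 : rv 0 = 0.
Proof.
have := rv_lin (-1) rational0 rational0; rewrite scaler0 addr0 scaleN1r.
by rewrite addNr.
Qed.

Lemma rvD a c : rational_weight a -> rational_weight c -> rv (a + c) = rv a + rv c.
Proof. by move=> ra rc; have := rv_lin 1 ra rc; rewrite rmorph1 !scale1r. Qed.

Lemma rvN a : rational_weight a -> rv (- a) = - rv a.
Proof.
move=> ra; have := rv_lin (-1) ra rational0.
by rewrite rmorphN rmorph1 !scaleN1r !addr0 rv0 addr0.
Qed.

Lemma rv_inj a c : rational_weight a -> rational_weight c -> rv a = rv c -> a = c.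
Proof.
move=> ra rc ac; apply/eqP; rewrite -subr_eq0; apply/eqP/dualv_inj => i.
rewrite -[a - c]addrC -scaleN1r hev_sum_lin -!rvE // ac.
by rewrite mulN1r addNr.
Qed.

Lemma dot_rv a c : rational_weight a -> rational_weight c ->
  io (dot (rv a) (rv c)) = hev a (dualv c).
Proof.
move=> ra rc; rewrite -dot_dualv rmorph_sum; apply: eq_bigr => i _.
by rewrite rmorphM !rvE.
Qed.

Lemma eig_coord t c x j : t \in h -> br t x = c *: x -> coord b j x != 0 -> hev (al j) t = c.
Proof.
move=> th tx xj; have E : br t x = \sum_i (coord b i x * hev (al i) t) *: tnth b i.
  rewrite {1}(basis_coordE x bb) br_sumr //; apply: eq_bigr => i _.
  by rewrite brZr // (wvecE (bW i) th) scalerA.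
have := congr1 (coord b j) E; rewrite tx linearZ /=.
rewrite (coord_basisE (fun i => coord b i x * hev (al i) t)) ?(basis_free bb) //.
by rewrite mulrC => /mulfI E'; apply/esym/E'.
Qed.

(** Weights enter through the eigenvalues of the dual vectors of the [al i], so the space is defined
    for every rational vector, weight or not. *)
Definition Gr (a : 'rV[rat]_N) l : {vspace g} :=
  (geg l :&: \bigcap_(i < N) passmx.leigenspace (ad br (dualv (al i))) (io (a ord0 i)))%VS.

Lemma mem_Gr a l x : (x \in Gr a l) <->
  x \in geg l /\ forall i, br (dualv (al i)) x = io (a 0 i) *: x.
Proof.
rewrite memv_cap; split=> [/andP[xl H]|[xl H]].
  split=> // i; move: H; rewrite memvE => /subv_bigcapP/(_ i isT).
  by rewrite -memvE mem_leigenspace adE // => /eqP.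
rewrite xl memvE; apply/subv_bigcapP => i _.
by rewrite -memvE mem_leigenspace adE // H.
Qed.

Lemma Gr_al a l x : x \in Gr a l -> x != 0 -> exists j, a = rv (al j) /\ wvec br (al j) x.
Proof.
move=> /mem_Gr[xl H] x0.
have aE j : coord b j x != 0 -> a = rv (al j).
  move=> xj; apply/rowP=> i; apply: (fmorph_inj io); rewrite rvE; last exact: rational_al.
  by rewrite hev_dualv (eig_coord (dualv_h _) (H i) xj).
have [j xj] : exists j, coord b j x != 0.
  apply: NNPP => no; case/eqP: x0; rewrite (basis_coordE x bb) big1 // => j _.
  by have [->|xj] := eqVneq (coord b j x) 0; [rewrite scale0r | case: no; exists j].
exists j; split; first exact: aE.
apply: wvecP => y yh; rewrite {1}(basis_coordE x bb) br_sumr // [x in RHS](basis_coordE x bb).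
rewrite scaler_sumr; apply: eq_bigr => i _; rewrite brZr // (wvecE (bW i) yh) !scalerA.
have [->|xi] := eqVneq (coord b i x) 0; first by rewrite mul0r mulr0.
suff -> : al i = al j by rewrite mulrC.
by apply: rv_inj; rewrite -?aE //; apply: rational_al.
Qed.

Lemma Gr_wvec c l x : rational_weight c -> (x \in Gr (rv c) l) <-> (x \in geg l /\ wvec br c x).
Proof.
move=> rc; split=> [xG|[xl xc]]; last first.
  apply/mem_Gr; split=> // i.
  by rewrite (wvecE xc (dualv_h _)) rvE // hev_dualv.
have /mem_Gr[xl _] := xG; split=> //.
have [->|x0] := eqVneq x 0; first by move=> y; rewrite br0r // scaler0.
have [j [jE jW]] := Gr_al xG x0.
by rewrite (rv_inj rc (rational_al j) jE).
Qed.

Definition Phi : seq 'rV[rat]_N := [seq rv (al j) | j <- enum 'I_N & al j != 0].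

Lemma PhiP a : (a \in Phi) <-> exists2 j, al j != 0 & a = rv (al j).
Proof.
split=> [/mapP[j]|[j aj ->]]; first by rewrite mem_filter mem_enum andbT => aj ->; exists j.
by apply/mapP; exists j; rewrite // mem_filter mem_enum aj.
Qed.

Lemma weight_Phi (c : hdual h) x : wvec br c x -> x != 0 -> c != 0 -> rv c \in Phi /\ rational_weight c.
Proof.
move=> cx x0 c0; have [j jE] := weight_al cx x0.
by rewrite -jE; split; [apply/PhiP; exists j; rewrite // jE | apply: rational_al].
Qed.

Lemma cn_rv a c : rational_weight a -> rational_weight c -> io (cn (rv a) (rv c)) = hev a (corootv c).
Proof.
move=> ra rc; rewrite /cn fmorph_div rmorphM rmorph_nat !dot_rv //.
by rewrite hev_coroot.
Qed.

Lemma iter_weight z (c d : hdual h) t x : wvec br c z -> wvec br d x ->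
  wvec br (c *+ t + d) (iter t (ad br z) x).
Proof.
move=> cz dx; elim: t => [|t IH]; first by rewrite add0r.
by rewrite iterS adE // mulrS -addrA; apply: wvec_br.
Qed.

Lemma Phi_roots : root_system Phi.
Proof.
have dotn0 j : al j != 0 -> rv (al j) != 0.
  apply: contraNneq => r0; apply/eqP; apply: rv_inj; rewrite ?rv0 //.
    exact: rational_al.
  exact: rational0.
have rint a c : a \in Phi -> c \in Phi -> exists z : int, cn c a = z%:~R.
  move=> /PhiP[i ai ->] /PhiP[j aj ->].
  have [z zE] := coroot_int j ai; exists z; apply: (fmorph_inj io).
  by rewrite rmorph_int cn_rv ?zE //; apply: rational_al.
have sub_weight i j (q : rat) y : y != 0 ->
    wvec br (io (- q) *: al i + al j) y -> rv (al j) - q *: rv (al i) != 0 ->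
    rv (al j) - q *: rv (al i) \in Phi.
  move=> y0 yW nz.
  have E : rv (al j) - q *: rv (al i) = rv (io (- q) *: al i + al j).
    rewrite rv_lin; try exact: rational_al.
    by rewrite addrC scaleNr.
  rewrite E; apply: (weight_Phi yW y0 _).1.
  by apply: contraNneq nz => w0; rewrite E w0 rv0.
split.
- apply/negP=> /PhiP[j aj /esym/eqP]; apply/negP; exact: dotn0.
- move=> a c aP cP; have [z zE] := rint _ _ aP cP; move: aP cP zE => /PhiP[i ai ->] /PhiP[j aj ->] zE.
  have [f [fl fW E sl2]] := weight_sl2 ai (bG i) (bW i) (b_neq0 i).
  have ch : corootv (al i) \in h by rewrite memvZ ?dualv_h.
  have hE : ad br (br (tnth b i) f) (tnth b j) = io (cn (rv (al j)) (rv (al i))) *: tnth b j.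
    rewrite E adE // (wvecE (bW j) ch) -cn_rv //; exact: rational_al.
  have nz : refl (rv (al i)) (rv (al j)) != 0.
    by rewrite -dot_eq0 dot_refl ?dot_eq0 ?dotn0.
  move: nz hE; rewrite /refl; case: (lerP 0 z) => z0.
    have -> : cn (rv (al j)) (rv (al i)) = (absz z)%:R by rewrite zE -[in LHS](gez0_abs z0).
    rewrite rmorph_nat => nz hE.
    apply: (sub_weight _ _ _ (iter (absz z) (ad br f) (tnth b j))) => //.
      apply: contraNneq (b_neq0 j) => f0; apply/eqP.
      exact: (sl2_Finj io sl2 hE (leqnn (absz z)) f0).
    have := iter_weight (absz z) fW (bW j).
    by rewrite mulNrn rmorphN rmorph_nat scaleNr scaler_nat.
  have -> : cn (rv (al j)) (rv (al i)) = - (absz z)%:R.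
    by rewrite zE -[in LHS](opprK z) rmorphN -(ltz0_abs z0).
  rewrite rmorphN rmorph_nat => nz hE.
  apply: (sub_weight _ _ _ (iter (absz z) (ad br (tnth b i)) (tnth b j))) => //.
    apply: contraNneq (b_neq0 j) => f0; apply/eqP.
    exact: (sl2_Einj io sl2 hE (leqnn (absz z)) f0).
  have := iter_weight (absz z) (bW i) (bW j).
  by rewrite opprK rmorph_nat scaler_nat.
- exact: rint.
- move=> a c /PhiP[i ai ->] /PhiP[j aj ->] dij nij.
  have [f [fl fW E sl2]] := weight_sl2 aj (bG j) (bW j) (b_neq0 j).
  have ch : corootv (al j) \in h by rewrite memvZ ?dualv_h.
  have [z zE] : exists z : int, cn (rv (al i)) (rv (al j)) = z%:~R.
    by apply: rint; apply/PhiP; [exists j | exists i].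
  have z0 : 0 < z by rewrite -(ltr0z rat) -zE cn_gt0 // dotn0.
  have hE : ad br (br (tnth b j) f) (tnth b i) = (absz z).-1.+1%:R *: tnth b i.
    rewrite prednK ?absz_gt0 ?gt_eqF // E adE // (wvecE (bW i) ch).
    rewrite -cn_rv ?zE ?rmorph_int; [|exact: rational_al|exact: rational_al].
    by rewrite -[in LHS](gtz0_abs z0).
  have y0 : ad br f (tnth b i) != 0.
    by apply: contraNneq (b_neq0 i) => f0; apply/eqP; apply: (sl2_Fpos io sl2 hE f0).
  have := sub_weight j i 1 (ad br f (tnth b i)) y0.
  rewrite scale1r rmorphN rmorph1 scaleN1r; apply.
    by rewrite adE //; apply: wvec_br.
  by rewrite subr_eq0.
move=> P Port [a aP Pa] c cP; apply: contraT => nPc.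
(* Z is the centralizer of the root vectors outside P. It is an ideal and contains the root vectors
   of P, so it is all of g; a root vector outside P would then be central. *)
have [||Z ZE] := @ex_vspace _ _ (fun x => forall j, al j != 0 -> ~~ P (rv (al j)) -> br x (tnth b j) = 0).
- by move=> j _ _; rewrite br0l.
- by move=> t x y xZ yZ j aj nP; rewrite br_lin_l // xZ // yZ // scaler0 addr0.
have Zbr x y : x \in Z -> y \in Z -> br x y \in Z.
  move=> /ZE xZ /ZE yZ; apply/ZE => j aj nP.
  have := jacobi lieP x y (tnth b j); rewrite yZ // xZ // !(br0r lieP) addr0.
  by move=> <-.
have bP i : al i != 0 -> P (rv (al i)) -> tnth b i \in Z.
  move=> ai Pi; apply/ZE => j aj nPj; apply/eqP/negPn/negP => bij.
  have iP : rv (al i) \in Phi by apply/PhiP; exists i.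
  have jP : rv (al j) \in Phi by apply/PhiP; exists j.
  have ijW := wvec_br (bW i) (bW j).
  have oij := Port _ _ iP jP Pi nPj.
  have di : dot (rv (al i)) (rv (al i)) != 0 by rewrite dot_eq0 dotn0.
  have dj : dot (rv (al j)) (rv (al j)) != 0 by rewrite dot_eq0 dotn0.
  have [ij0|ij0] := eqVneq (al i + al j) 0.
    have jE : al j = - al i by apply/eqP; rewrite -addr_eq0 addrC ij0.
    by move: oij; rewrite jE rvN ?dotNr; [move/eqP; rewrite oppr_eq0 (negPf di) | exact: rational_al].
  have [sP _] := weight_Phi ijW bij ij0.
  rewrite rvD in sP; try exact: rational_al.
  have [Ps|nPs] := boolP (P (rv (al i) + rv (al j))).
    have := Port _ _ sP jP Ps nPj; rewrite dotDl oij add0r => /eqP.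
    by rewrite (negPf dj).
  have := Port _ _ iP sP Pi nPs; rewrite dotDr oij addr0 => /eqP.
  by rewrite (negPf di).
have weight_Z x c0 y : x \in Z -> c0 != 0 -> ~~ P (rv c0) -> wvec br c0 y -> br x y = 0.
  move=> /ZE xZ c00 nP yW; rewrite (basis_coordE y bb) br_sumr // big1 // => j _.
  have [->|yj] := eqVneq (coord b j y) 0; first by rewrite scale0r br0r.
  by rewrite brZr // xZ ?scaler0 // (wvec_coord yW yj).
have Zid x y : y \in Z -> br x y \in Z.
  move=> yZ; rewrite (basis_coordE x bb) br_suml //; apply: memv_suml => i _.
  rewrite brZl // memvZ //.
  have [ai|ai] := eqVneq (al i) 0.
    apply/ZE => j aj nP; have := jacobi lieP (tnth b i) y (tnth b j).
    have bij : wvec br (al j) (br (tnth b i) (tnth b j)).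
      by have := wvec_br (bW i) (bW j); rewrite ai add0r.
    rewrite (weight_Z _ _ _ yZ aj nP bij) (weight_Z _ _ _ yZ aj nP (bW j)) (br0r lieP) addr0.
    by move=> <-.
  have [Pi|nPi] := boolP (P (rv (al i))); first by apply: Zbr => //; apply: bP.
  by rewrite (brC lieP) (weight_Z _ _ _ yZ ai nPi (bW i)) oppr0 mem0v.
have /PhiP[i ai aE] := aP; have /PhiP[j aj cE] := cP.
have biZ : tnth b i \in Z by apply: bP => //; rewrite -aE.
have [Z0|ZT] := simple_ideal simpleP Zid.
  by move: biZ; rewrite Z0 memv0 (negPf (b_neq0 i)).
case/eqP: (b_neq0 j); apply: (simple_center lieP simpleP) => x.
rewrite (brC lieP); have /ZE -> // : x \in Z by rewrite ZT memvf.
  by rewrite oppr0.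
by rewrite -cE.
Qed.

Lemma Gr00_h y : y \in Gr 0 0 -> y \in h.
Proof.
rewrite -rv0 => /(Gr_wvec 0 y rational0)[y0 yW].
by apply: wvec0_h => //; rewrite -geig0.
Qed.

Lemma rv_wts a : a \in 0 :: Phi -> exists2 c : hdual h, rational_weight c & a = rv c.
Proof.
rewrite inE => /orP[/eqP->|/PhiP[j _ ->]].
  by exists 0; [exact: rational0 | rewrite rv0].
by exists (al j) => //; apply: rational_al.
Qed.

Lemma Gr_supp a l x : x \in Gr a l -> x != 0 -> a \in 0 :: Phi.
Proof.
move=> xG x0; have [j [-> _]] := Gr_al xG x0.
have [->|aj] := eqVneq (al j) 0; first by rewrite rv0 mem_head.
by rewrite inE; apply/orP; right; apply/PhiP; exists j.
Qed.

Lemma Gr_br a c l l' x y : x \in Gr a l -> y \in Gr c l' -> br x y \in Gr (a + c) (l + l').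
Proof.
move=> /mem_Gr[xl xW] /mem_Gr[yl yW]; apply/mem_Gr; split; first exact: geig_br.
move=> i; rewrite jacobi // xW yW brZl // brZr // -scalerDl -rmorphD.
by rewrite [in RHS]mxE.
Qed.

Theorem ex_graded : exists tau phi, graded br io Phi Gr tau phi.
Proof.
(* A linear form nonzero on all differences of distinct weights separates the weights; [tau] is the
   element of [h] on which each weight takes the value of that form. *)
pose ds := [seq ac.1 - ac.2 | ac <- [seq (a, c) | a <- 0 :: Phi, c <- 0 :: Phi] & ac.1 != ac.2].
have [|f [fL f0]] := @generic_functional _ ds.
  apply/negP=> /mapP[[a c]]; rewrite mem_filter => /andP[/= ac _] /esym/eqP.
  by rewrite subr_eq0 (negPf ac).
have f00 : f 0 = 0 by have := fL (-1) 0 0; rewrite scaler0 addr0 mulN1r addNr.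
pose tau := \sum_i io (f (delta_mx 0 i)) *: dualv (al i).
have fE (a : 'rV[rat]_N) : f a = \sum_i a 0 i * f (delta_mx 0 i).
  rewrite {1}(row_sum_delta a); elim/big_rec2: _ => [//|i y1 y2 _ <-].
  by rewrite fL.
have th : tau \in h by apply: memv_suml => i _; rewrite memvZ ?dualv_h.
exists tau, f; split=> //.
- exact: Phi_roots.
- exact: Gr_br.
- move=> v; exists [seq coord b j v *: tnth b j | j <- enum 'I_N].
    move=> _ /mapP[j _ ->]; exists (rv (al j)), (de j).
    by rewrite memvZ //; apply/(Gr_wvec (de j) (tnth b j) (rational_al j)).
  by rewrite big_map big_enum -basis_coordE.
- exact: Gr_supp.
- move=> a /PhiP[j aj ->]; exists (de j), (tnth b j); split=> //.
  by apply/(Gr_wvec (de j) (tnth b j) (rational_al j)).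
- rewrite -rv0; apply/(Gr_wvec 0 tau rational0); split.
    by rewrite geig0; apply: (cartan_gsig cartanP).
  exact: h_wvec0.
- move=> a l x /mem_Gr[_ xW]; rewrite br_suml // fE rmorph_sum scaler_suml.
  apply: eq_bigr => i _; rewrite brZl // xW scalerA mulrC.
  by rewrite rmorphM mulrC.
- move=> a c aw cw fac; apply/eqP/negPn/negP => ac.
  have : a - c \in ds.
    apply/mapP; exists (a, c) => //; rewrite mem_filter.
    by apply/andP; split; [exact: ac | exact: allpairs_f].
  move/f0; rewrite -scaleN1r addrC fL fac mulN1r addNr.
  by rewrite eqxx.
- move=> y a /Gr00_h yh; have [aw|aw] := boolP (a \in 0 :: Phi); last first.
    exists 0; split=> // l x xG; rewrite scale0r.
    have [->|x0] := eqVneq x 0; first by rewrite br0r.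
    by rewrite (Gr_supp xG x0) in aw.
  have [c rc ac] := rv_wts aw.
  exists (hev c y); split.
    move=> a0; have -> : c = 0 by apply: rv_inj => //; [exact: rational0 | rewrite -ac a0 rv0].
    by rewrite /hev zero_lfunE.
  by move=> l x; rewrite ac => /(Gr_wvec l x rc)[_ xW]; rewrite (wvecE xW yh).
- move=> a l x xG xK; apply/eqP/negPn/negP => x0; have [j [aE jW]] := Gr_al xG x0.
  case/eqP: x0; have /mem_Gr[xl _] := xG; apply: (kf_pair xl jW) => y yl yW.
  apply: xK; rewrite aE -rvN; last exact: rational_al.
  by apply/(Gr_wvec (- l) y (rationalN (rational_al j))).
- move=> a c l l' x y /mem_Gr[_ xW] /mem_Gr[_ yW] ac.
  have [i aci] : exists i, (a + c) 0 i != 0.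
    by apply: NNPP => no; case/eqP: ac; apply/rowP=> i; rewrite [RHS]mxE;
      apply/eqP/negPn/negP => aci; apply: no; exists i.
  apply: (kf_eig_orth lieP (xW i) (yW i)); rewrite -rmorphD fmorph_eq0.
  by move: aci; rewrite mxE.
- move=> a l e aP eG e0; have [j [aE jW]] := Gr_al eG e0; have /mem_Gr[el _] := eG.
  have aj : al j != 0.
    by apply: contraTneq aP => aj; rewrite aE aj rv0 (rs_0 Phi_roots).
  have [f' [fl fW E _]] := weight_sl2 aj el jW e0; exists f'.
    rewrite aE -rvN; last exact: rational_al.
    by apply/(Gr_wvec (- l) f' (rationalN (rational_al j))).
  move=> c l' x xG; have [->|x0] := eqVneq x 0; first by rewrite br0r // scaler0.
  have [i [cE iW]] := Gr_al xG x0; rewrite E (wvecE iW) ?memvZ ?dualv_h // cE aE cn_rv //.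
    exact: rational_al.
  exact: rational_al.
(* One-dimensionality: z is y minus the multiple of x that makes it orthogonal to f'. Then [z, f'] =
   0, but z has weight 2 and ad f' is injective there. *)
move=> a l x y aP xG x0 yG; have [j [aE jW]] := Gr_al xG x0; have /mem_Gr[xl _] := xG.
have aj : al j != 0.
  by apply: contraTneq aP => aj; rewrite aE aj rv0 (rs_0 Phi_roots).
have [f' [fl fW E sl2]] := weight_sl2 aj xl jW x0.
have kxf : kf br x f' != 0.
  apply: contraNneq (x0) => kxf; have [_ _ hf] := sl2.
  have := br_dualv xl jW fl fW; rewrite kxf scale0r => ef0.
  have := wvecE jW (_ : corootv (al j) \in h); rewrite -E ef0 mem0v br0l // => /(_ isT).
  have -> : hev (al j) 0 = 0 :> k by rewrite /hev !linear0.
  have ch : corootv (al j) = 0 by rewrite -E ef0.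
  have := hev_coroot (al j) (al j); rewrite ch /hev !linear0 mulfK; last first.
    exact: (weight_norm_neq0 aj xl jW x0).
  by move/eqP; rewrite eq_sym (natk_eq0 io).
have yW : wvec br (al j) y.
  by have := (Gr_wvec l y (rational_al j)).1; rewrite -aE => /(_ yG)[].
have /mem_Gr[yl _] := yG.
exists (kf br y f' / kf br x f'); apply/eqP; rewrite -subr_eq0; apply/eqP.
set z := y - _; have zW : wvec br (al j) z.
  by rewrite /z addrC -scaleNr; apply: wvec_lin.
have zl : z \in geg l by rewrite memvB ?memvZ.
have zf : br z f' = 0.
  rewrite (br_dualv zl zW fl fW) /z addrC -scaleNr kf_lin // mulNr divfK // addNr.
  by rewrite scale0r.
apply: (sl2_Fpos io sl2 (p := 1)); last by rewrite adE // (brC lieP) zf oppr0.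
rewrite adE // E (wvecE zW) ?memvZ ?dualv_h // hev_coroot mulfK //.
exact: (weight_norm_neq0 aj xl jW x0).
Qed.
End Datum.

(** * Loop algebras *)

Lemma in_genP (G : zmodType) (S : G -> Prop) x : in_gen S x <->
  exists ps : seq (G * int), (forall p, p \in ps -> S p.1) /\ x = \sum_(p <- ps) p.1 *~ p.2.
Proof.
have InP (s : seq G) y : List.In y s <-> y \in s.
  elim: s => //= z s IH; rewrite inE; split=> [[->|/IH->]|/orP[/eqP->|/IH]]; rewrite ?eqxx ?orbT //.
    by left.
  by right.
split=> [[s [c [sS ->]]]|[ps [pS ->]]].
  exists [seq (s`_i, c`_i) | i <- iota 0 (size s)]; split.
    move=> _ /mapP[i + ->]; rewrite mem_iota /= => si; apply: sS; apply/InP.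
    by rewrite mem_nth.
  by rewrite big_map -(big_mkord xpredT (fun i => s`_i *~ c`_i)) /index_iota subn0.
exists (map fst ps), (map snd ps); split.
  by move=> y /InP/mapP[p pp ->]; apply: pS.
rewrite size_map (big_nth (0, 0)) big_mkord; apply: eq_bigr => i _.
by rewrite !(nth_map (0, 0)).
Qed.

Lemma in_gen0 (G : zmodType) (S : G -> Prop) : in_gen S 0.
Proof. by apply/in_genP; exists [::]; rewrite big_nil. Qed.

Lemma mem_in_gen (G : zmodType) (S : G -> Prop) x : S x -> in_gen S x.
Proof.
move=> Sx; apply/in_genP; exists [:: (x, 1)]; split=> [p|]; last by rewrite big_seq1.
by rewrite inE => /eqP->.
Qed.

Lemma in_genB (G : zmodType) (S : G -> Prop) x y : in_gen S x -> in_gen S y -> in_gen S (x - y).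
Proof.
move=> /in_genP[s [sS ->]] /in_genP[t [tS ->]]; apply/in_genP.
exists (s ++ [seq (p.1, - p.2) | p <- t]); split.
  by move=> p; rewrite mem_cat => /orP[/sS//|/mapP[q /tS qS ->]].
rewrite big_cat big_map -sumrN; congr (_ + _); apply: eq_bigr => p _.
by rewrite mulrNz.
Qed.

Lemma in_gen_ind (G : zmodType) (S P : G -> Prop) : P 0 -> (forall x, S x -> P x) ->
  (forall x y, P x -> P y -> P (x - y)) -> forall x, in_gen S x -> P x.
Proof.
move=> P0 PS PB x /in_genP[ps [pS ->]].
have PN y : P y -> P (- y) by rewrite -sub0r; apply: PB.
have PD y z : P y -> P z -> P (y + z) by move=> Py /PN; rewrite -{2}[z]opprK; apply: PB.
have PM y z : P y -> P (y *~ z).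
  move=> Py; have Pn (t : nat) : P (y *+ t) by elim: t => [|t IH]; rewrite ?mulr0n // mulrS; apply: PD.
  by case: z => t; [rewrite -pmulrn | rewrite NegzE mulrNz; apply: PN; rewrite -pmulrn].
rewrite big_seq; elim/big_rec: _ => // p y /pS/PS pP Py.
by apply: PD => //; apply: PM.
Qed.

Lemma supp_seqP (k : fieldType) (g : vectType k) n (u : 'rV[int]_n -> g) :
  fin_supp u -> forall lam, u lam != 0 -> lam \in supp_seq u.
Proof. exact: epsilon_spec. Qed.

Lemma cartan_zero_centralizer (k : fieldType) (g : vectType k) (br : g -> g -> g) (S h : {vspace g}) :
  is_lie br -> cartan_sub br S h -> S != 0%VS -> h != 0%VS.
Proof.
move=> L [hS _ _ nor]; apply: contraNneq => h0; apply/eqP.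
apply/vspaceP => x; rewrite memv0; apply/idP/eqP=> [xS|->]; last exact: mem0v.
apply/eqP; rewrite -memv0 -h0; apply: nor => // y; rewrite h0 memv0 => /eqP->.
by rewrite br0r // mem0v.
Qed.

Lemma nilpotent_center (k : fieldType) (g : vectType k) (br : g -> g -> g) (h : {vspace g}) :
  is_lie br -> (forall x y, x \in h -> y \in h -> br x y \in h) -> nilpotent_sub br h ->
  h != 0%VS -> exists z, [/\ z \in h, z != 0 & forall y, y \in h -> br y z = 0].
Proof.
move=> L hbr [N]; elim: N => [|N IH] nil h0.
  have := nil [::] (vpick h) erefl; rewrite /= => H.
  by case/eqP: h0; apply/eqP; rewrite -vpick0; apply/eqP/H => //; apply: memv_pick.
have [ex|no] := classic (exists xs y, [/\ size xs = N, forall x, x \in xs -> x \in h, y \in h &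
    foldr br y xs != 0]).
  have [xs [y [sx xh yh n0]]] := ex; exists (foldr br y xs); split=> //.
    elim: {sx n0} xs xh => //= x xs IHx xh; apply: hbr; first by rewrite xh ?mem_head.
    by apply: IHx => z zs; apply: xh; rewrite inE zs orbT.
  move=> t th; apply: (nil (t :: xs)) => //=; first by rewrite sx.
  by move=> x; rewrite inE => /orP[/eqP->|/xh].
apply: IH => // xs y sx xh yh; apply/eqP/negPn/negP => n0.
by apply: no; exists xs, y.
Qed.

Lemma torus_gsig_neq0 (k : closedFieldType) (zeta : nat -> k) (n : nat)
    (g : vectType k) (br : g -> g -> g) (sigma : 'I_n -> 'End(g)) (m : 'I_n -> nat) (h : {vspace g})
    (g' : vectType k) (br' : g' -> g' -> g') (sigma' : 'I_n -> 'End(g'))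
    (m' : 'I_n -> nat) (h' : {vspace g'}) :
  multiloop_data br' sigma' m' h' -> lie_torus br' sigma' m' h' zeta ->
  support_iso zeta br sigma m h br' sigma' m' h' -> gsig sigma != 0%VS.
Proof.
move=> [L' [_ [_ [_ [_ cart']]]]] [_ [_ [[x [y [xS _ xy]]] _]] _ _].
case=> phi [psi [[phiL phi_lin _ _ _] [_ psiD _ _ hom]]].
have S0 : gsig sigma' != 0%VS.
  apply: contraNneq xy => S0; move: xS; rewrite S0 memv0 => /eqP->.
  by rewrite br0l.
have h0 := cartan_zero_centralizer L' cart' S0.
have [hS hbr nil _] := cart'.
have [z [zh z0 zc]] := nilpotent_center L' hbr nil h0.
(* z t^0 has degree (0, 0) = psi 0, because z is central in h' and fixed. Its preimage again has
   degree (0, 0), so the only coefficient of the preimage lies in the fixed algebra. *)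
pose w (mu : 'rV[int]_n) := if mu == 0 then z else 0.
have psi0 : psi 0 = 0.
  have := psiD 0 0 (in_gen0 _) (in_gen0 _); rewrite addr0 => /eqP.
  by rewrite -subr_eq subrr eq_sym => /eqP.
have wc : loop_comp br' sigma' m' h' zeta (psi 0) w.
  rewrite psi0; split=> [mu /negPf mu0||]; rewrite /w /=.
  - by rewrite mu0.
  - rewrite eqxx; apply/mem_geig => i; rewrite mxE expr0z scale1r.
    have := subvP hS z zh; rewrite memvE => /subv_bigcapP/(_ i isT).
    by rewrite -memvE => /fixedSpaceP.
  rewrite eqxx => t; rewrite zero_lfunE scale0r; exact: zc (subvsP t).
have [_ /(_ _ wc)[u [[u0 ue _] uw]]] := hom 0 (in_gen0 _).
apply: contraNneq z0 => S00; have uz mu : u mu = 0.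
  have [->|mu0] := eqVneq mu 0; last exact: u0.
  apply/eqP; rewrite -memv0 -S00 memvE; apply/subv_bigcapP => i _; rewrite -memvE.
  by apply/fixedSpaceP; move/mem_geig: ue => /(_ i) /=; rewrite mxE expr0z scale1r.
have Lz : in_loop br sigma m h zeta (fun=> 0).
  split; first by exists [::] => lam; rewrite eqxx.
  by move=> lam; exists [::]; rewrite big_nil.
have uE : u = fun=> 0 by apply: functional_extensionality.
have : w 0 = 0.
  rewrite -uw uE; have := phi_lin (-1) _ _ Lz Lz.
  have -> : (fun mu : 'rV[int]_n => -1 *: (0 : g) + 0) = (fun=> 0).
    by apply: functional_extensionality => mu; rewrite scaler0 addr0.
  by move/(congr1 (fun f => f 0)) => ->; rewrite scaleN1r addNr.
by rewrite /w eqxx => ->.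
Qed.

(** * Twisted automorphisms *)

Section HomogeneousBasis.
Variables (k : closedFieldType) (g : vectType k) (br : g -> g -> g).
Hypothesis lieP : is_lie br.
Variables (n : nat) (sigma : 'I_n -> 'End(g)) (h : {vspace g}).
Variables (zeta : nat -> k) (m : 'I_n -> nat).
Hypothesis zP : forall i, (m i).-primitive_root (zeta (m i)).
Local Notation N := (\dim {:g}).
Variable b : N.-tuple g.
Variable al : 'I_N -> hdual h.
Variable de : 'I_N -> 'rV[int]_n.
Hypothesis bb : basis_of fullv b.
Hypothesis bG : forall j, tnth b j \in geig sigma m zeta (de j).
Hypothesis bW : forall j, wvec br (al j) (tnth b j).

Lemma coord_ext x y : (forall j, coord b j x = coord b j y) -> x = y.
Proof.
by move=> E; rewrite (basis_coordE x bb) (basis_coordE y bb); apply: eq_bigr => j _; rewrite E.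
Qed.

Lemma ex_coord_neq0 x : x != 0 -> exists j, coord b j x != 0.
Proof.
move=> x0; apply: NNPP => no; case/eqP: x0; apply: coord_ext => j; rewrite linear0.
by apply/eqP/negPn/negP => xj; apply: no; exists j.
Qed.

Lemma coord_basis_vec i j : coord b i (tnth b j) = (i == j)%:R.
Proof. by rewrite (tnth_nth 0) coord_free ?(basis_free bb) // eq_sym. Qed.

Lemma geigP l x : x \in geig sigma m zeta l <->
  forall j, coord b j x != 0 -> forall i, (m i %| de j ord0 i - l ord0 i)%Z.
Proof.
split=> [xl j|H]; first exact: (geig_coord zP bb bG xl).
rewrite (basis_coordE x bb); apply: memv_suml => j _.
have [->|/H xj] := eqVneq (coord b j x) 0; first by rewrite scale0r mem0v.
by rewrite memvZ // -(geig_congr _ zP xj).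
Qed.

Lemma wvecP_coord (a : hdual h) x : wvec br a x <-> forall j, coord b j x != 0 -> al j = a.
Proof.
split=> [X j|H]; first exact: (wvec_coord lieP bb bW X).
move=> y; rewrite {1}(basis_coordE x bb) br_sumr // [x in RHS](basis_coordE x bb) scaler_sumr.
apply: eq_bigr => j _; rewrite brZr // bW !scalerA mulrC.
by have [->|/H ->] := eqVneq (coord b j x) 0; rewrite ?mulr0 // mul0r.
Qed.

Lemma in_loopP u : in_loop br sigma m h zeta u <->
  fin_supp u /\ forall l, u l \in geig sigma m zeta l.
Proof.
split=> -[uf H]; split=> // l.
  have [ps [psP ->]] := H l; rewrite big_seq memv_suml // => p /psP[].
  by [].
exists [seq (al j, coord b j (u l) *: tnth b j) | j <- enum 'I_N]; split.
  move=> _ /mapP[j _ ->] /=; split; last first.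
    by move=> y; rewrite brZr // bW !scalerA mulrC.
  have [->|uj] := eqVneq (coord b j (u l)) 0; first by rewrite scale0r mem0v.
  rewrite memvZ // -(geig_congr _ zP (_ : forall i, (m i %| de j ord0 i - l ord0 i)%Z)) //.
  exact: (geig_coord zP bb bG (H l)).
by rewrite big_map big_enum -basis_coordE.
Qed.

Lemma loop_suppP (a : hdual h) l : loop_supp br sigma m h zeta (a, l) <->
  exists j, al j = a /\ forall i, (m i %| de j ord0 i - l ord0 i)%Z.
Proof.
split=> [[u [[u0 /geigP ul /wvecP_coord uw] [mu umu]]]|[j [ja jl]]].
  have mul : mu = l by apply/eqP; apply: contraNT umu => /u0 ->.
  by move: umu; rewrite mul => /ex_coord_neq0[j uj]; exists j; split; [exact: uw | exact: ul].
exists (fun mu => if mu == l then tnth b j else 0); split; last first.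
  exists l; rewrite eqxx; apply/eqP => bj0; have := coord_basis_vec j j.
  by rewrite bj0 linear0 eqxx => /eqP; rewrite eq_sym oner_eq0.
split=> [mu /negPf->//||]; rewrite /= eqxx; last by rewrite -ja.
by rewrite -(geig_congr _ zP jl).
Qed.

(** Terms with u l = 0 vanish, so any duplicate-free list covering the support computes the bracket,
    whatever list [supp_seq] chose. *)
Lemma loop_brE (u v : 'rV[int]_n -> g) s mu : fin_supp u -> uniq s ->
  (forall l, u l != 0 -> l \in s) ->
  loop_br br u v mu = \sum_(l <- s) br (u l) (v (mu - l)).
Proof.
move=> uf us H; rewrite /loop_br.
have drop (t : seq 'rV[int]_n) : \sum_(l <- t) br (u l) (v (mu - l)) =
    \sum_(l <- [seq l <- t | u l != 0]) br (u l) (v (mu - l)).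
  rewrite big_filter [RHS]big_mkcond; apply: eq_bigr => l _.
  by case: eqP => //= ->; rewrite br0l.
rewrite drop [RHS]drop; apply: perm_big; apply: uniq_perm; rewrite ?filter_uniq ?undup_uniq //.
move=> l; rewrite !mem_filter mem_undup; have [//|ul] := eqVneq (u l) 0.
by rewrite H // (supp_seqP uf).
Qed.

Definition dop (c : 'I_N -> k) : 'End(g) :=
  linfun (fun v => \sum_j (c j * coord b j v) *: tnth b j).

Lemma coord_dop c j v : coord b j (dop c v) = c j * coord b j v.
Proof.
pose f v := \sum_j (c j * coord b j v) *: tnth b j.
have lin : linear f.
  move=> a x y; rewrite /f scaler_sumr -big_split; apply: eq_bigr => i _ /=.
  by rewrite linearP /= mulrDr scalerDl scalerA mulrCA.
pose F : {linear g -> g} := HB.pack f (GRing.isLinear.Build _ _ _ _ _ lin).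
have -> : dop c v = f v by rewrite /dop -[linfun _]/(linfun F) lfunE.
exact: (coord_basisE (fun j => c j * coord b j v)) (basis_free bb).
Qed.

Lemma dop_comp c c' : (dop c \o dop c')%VF = dop (fun j => c j * c' j).
Proof.
by apply/lfunP=> v; apply: coord_ext => j; rewrite comp_lfunE !coord_dop mulrA.
Qed.

Lemma dop_id c : (forall j, c j = 1) -> dop c = \1%VF.
Proof.
by move=> c1; apply/lfunP=> v; apply: coord_ext => j; rewrite id_lfunE coord_dop c1 mul1r.
Qed.

Lemma coord_iter_dop e c j v : coord b j (iter e (dop c) v) = c j ^+ e * coord b j v.
Proof.
by elim: e => [|e IH]; rewrite ?mul1r // iterS coord_dop IH exprS mulrA.
Qed.

Lemma dop_eqP c c' : dop c = dop c' -> forall j, c j = c' j.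
Proof.
move=> E j; have := congr1 (fun f : 'End(g) => coord b j (f (tnth b j))) E.
by rewrite !coord_dop coord_basis_vec eqxx !mulr1.
Qed.

Lemma dop_basis c j : dop c (tnth b j) = c j *: tnth b j.
Proof.
apply: coord_ext => i; rewrite coord_dop linearZ /= coord_basis_vec.
by case: eqP => [->//|_]; rewrite !mulr0.
Qed.

Lemma dop_br c : (forall j j' r, coord b r (br (tnth b j) (tnth b j')) != 0 -> c r = c j * c j') ->
  forall x y, dop c (br x y) = br (dop c x) (dop c y).
Proof.
move=> H x y; rewrite (basis_coordE x bb) (basis_coordE y bb) !linear_sum br_suml //.
rewrite linear_sum br_suml //; apply: eq_bigr => j _; rewrite !br_sumr // linear_sum.
apply: eq_bigr => j' _; rewrite !linearZ /= !dop_basis !(brZl lieP) !(brZr lieP) !linearZ /=.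
apply: coord_ext => r; rewrite !linearZ /= coord_dop.
by have [->|/H ->] := eqVneq (coord b r (br (tnth b j) (tnth b j'))) 0; [rewrite !mulr0 | ring].
Qed.

End HomogeneousBasis.

Lemma prim_expz_eq (k : fieldType) d (z : k) (a c : int) : d.-primitive_root z ->
  (z ^ a = z ^ c) <-> (d %| a - c)%Z.
Proof.
move=> zd; have z0 : z != 0 by rewrite (prim_root_eq0 zd) -lt0n (prim_order_gt0 zd).
have E1 e : (z ^ e = 1) <-> (d %| e)%Z.
  rewrite dvdzE /= (prim_order_dvd zd); case: e => e; first by split=> /eqP.
  rewrite NegzE -invr_expz /=; split=> [/eqP|/eqP H]; first by rewrite invr_eq1.
  by apply/eqP; rewrite invr_eq1; apply/eqP.
rewrite -E1 expfzDr // -invr_expz; split=> [->|E]; first by rewrite mulfV // expfz_neq0.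
by rewrite -[RHS]mul1r -E mulfVK // expfz_neq0.
Qed.

Section Twist.
Variables (k : closedFieldType) (g : vectType k) (br : g -> g -> g).
Hypothesis lieP : is_lie br.
Hypothesis simpleP : simple_in br fullv.
Variables (n : nat) (sigma : 'I_n -> 'End(g)) (h : {vspace g}).
Hypothesis autP : forall i, is_lie_aut br (sigma i).
Hypothesis cartanP : cartan_sub br (gsig sigma) h.
Hypothesis hab : forall x y, x \in h -> y \in h -> br x y = 0.
Variables (zeta : nat -> k) (m d : 'I_n -> nat).
Hypothesis zP : forall i, (m i).-primitive_root (zeta (m i)).
Hypothesis zdP : forall i, (d i).-primitive_root (zeta (d i)).
Local Notation N := (\dim {:g}).
Variable b : N.-tuple g.
Variable al : 'I_N -> hdual h.
Variable de : 'I_N -> 'rV[int]_n.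
Hypothesis bb : basis_of fullv b.
Hypothesis bG : forall j, tnth b j \in geig sigma m zeta (de j).
Hypothesis bW : forall j, wvec br (al j) (tnth b j).
Variable RW : hdual h -> Prop.
Variable sh : hdual h -> 'rV[int]_n.
Hypothesis RWal : forall j, RW (al j).
Hypothesis RW0 : RW 0.
Hypothesis RWB : forall a c, RW a -> RW c -> RW (a - c).
Hypothesis shB : forall a c, RW a -> RW c -> sh (a - c) = sh a - sh c.
Variables (C : 'M[int]_n) (xx : 'I_N -> 'rV[int]_n).
Hypothesis xxP : forall j, de j - sh (al j) = xx j *m C.
Hypothesis CP : forall y : 'rV[int]_n,
  (forall i, (m i %| (y *m C) ord0 i)%Z) <-> (forall i, (d i %| y ord0 i)%Z).
(** An induction principle saying that the [xx j] and the sublattice of the d_i generate Z^n. This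
    makes the orders exactly d_i and the group as large as possible. *)
Hypothesis genP : forall P : 'rV[int]_n -> Prop, (forall x y, P x -> P y -> P (x - y)) ->
  (forall j, P (xx j)) -> (forall z : 'rV[int]_n, (forall i, (d i %| z ord0 i)%Z) -> P z) ->
  forall y, P y.

(** [xx j] holds the coordinates of the shifted degree of b_j in the adapted basis; the i-th
    automorphism reads off the i-th coordinate modulo d_i. *)
Definition twist i : 'End(g) := dop b (fun j => zeta (d i) ^ xx j ord0 i).

Lemma sh0 : sh 0 = 0.
Proof. by rewrite -[in LHS](subrr (0 : hdual h)) shB // subrr. Qed.

Lemma shD a c : RW a -> RW c -> sh (a + c) = sh a + sh c.
Proof.
move=> ra rc; rewrite -{1}[c]opprK -(sub0r c) shB //; last exact: RWB.
by rewrite shB // sh0 sub0r opprK.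
Qed.

Lemma twist_geig j : tnth b j \in geig twist d zeta (xx j).
Proof. by apply/mem_geig => i; rewrite dop_basis. Qed.

Lemma struct_weight j j' r : coord b r (br (tnth b j) (tnth b j')) != 0 -> al r = al j + al j'.
Proof. exact: (wvec_coord lieP bb bW (wvec_br lieP (bW j) (bW j'))). Qed.

(** The shift is additive on weights, so shifted degrees add modulo the m_i under the bracket; [CP]
    translates this into coordinates modulo the d_i. *)
Lemma struct_degree j j' r : coord b r (br (tnth b j) (tnth b j')) != 0 ->
  forall i, (d i %| xx r ord0 i - (xx j ord0 i + xx j' ord0 i))%Z.
Proof.
move=> c0; have := (CP (xx r - (xx j + xx j'))).1; rewrite mulmxBl mulmxDl -!xxP.
rewrite (struct_weight c0) shD //.
have -> : de r - (sh (al j) + sh (al j')) - (de j - sh (al j) + (de j' - sh (al j'))) =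
    de r - (de j + de j') by apply/rowP=> i; rewrite !mxE; ring.
move=> H i.
have -> : xx r ord0 i - (xx j ord0 i + xx j' ord0 i) = (xx r - (xx j + xx j')) ord0 i by rewrite !mxE.
apply: H => {}i; have := geig_coord zP bb bG (geig_br lieP autP zP (bG j) (bG j')) c0 i.
by rewrite !mxE.
Qed.

Lemma twist_order i x : iter (d i) (twist i) x = x.
Proof.
apply: (coord_ext bb) => j; rewrite (coord_iter_dop bb) -[RHS]mul1r; congr (_ * _).
have := exprz_exp (zeta (d i)) (xx j ord0 i) (d i)%:Z; rewrite -exprnP => ->.
by rewrite mulrC -exprz_exp -exprnP (prim_expr_order (zdP i)) exp1rz.
Qed.

Lemma twistC i j x : twist i (twist j x) = twist j (twist i x).
Proof. by apply: (coord_ext bb) => r; rewrite !(coord_dop bb) mulrCA. Qed.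

Lemma twist_aut i : is_lie_aut br (twist i).
Proof.
split.
  apply/vspaceP=> x; rewrite memv_ker memv0; apply/eqP/eqP => [x0|->]; last by rewrite linear0.
  rewrite -(twist_order i x); have := prim_order_gt0 (zdP i); case: (d i) => // e _.
  by rewrite iterSr x0; elim: e => //= e ->; rewrite linear0.
move=> x y; apply: (dop_br lieP bb) => j j' r c0.
have z0 : zeta (d i) != 0 by rewrite (prim_root_eq0 (zdP i)) -lt0n (prim_order_gt0 (zdP i)).
by rewrite -expfzDr //; apply/(prim_expz_eq _ _ (zdP i)); apply: struct_degree c0 i.
Qed.

Lemma hwt y j : y \in h -> coord b j y != 0 -> al j = 0.
Proof.
move=> yh; apply: (wvec_coord lieP bb bW) => z.
by rewrite zero_lfunE scale0r hab ?subvsP.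
Qed.

Lemma weight0_degree j : al j = 0 ->
  (forall i, (d i %| xx j ord0 i)%Z) <-> (forall i, (m i %| de j ord0 i)%Z).
Proof. by move=> j0; rewrite -CP -xxP j0 sh0 subr0. Qed.

Lemma h_gsig_twist : (h <= gsig twist)%VS.
Proof.
apply/subvP => y yh; rewrite -(geig0 twist zeta d); apply/(geigP zdP bb twist_geig) => j yj.
have H := (weight0_degree (hwt yh yj)).2 => i; rewrite mxE subr0; apply: H => {}i.
have y0 : y \in geig sigma m zeta 0 by rewrite geig0; apply: (cartan_gsig cartanP).
by have := geig_coord zP bb bG y0 yj i; rewrite mxE subr0.
Qed.

(** If x normalizes the abelian [h], then [y, [y, x]] = 0 for y in [h], so the weights of x have
    square 0 and x has weight 0. There the shift is trivial, so a vector fixed by the twists is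
    fixed by [sigma] and lies in [h]. *)
Lemma twist_cartan : cartan_sub br (gsig twist) h.
Proof.
have [_ hbr nil _] := cartanP; split=> //; first exact: h_gsig_twist.
move=> x; rewrite -(geig0 twist zeta d) => xS H.
have aj j : coord b j x != 0 -> al j = 0.
  move=> xj; apply/lfunP => y; rewrite zero_lfunE.
  have : coord b j (br (vsval y) (br (vsval y) x)) = 0.
    rewrite hab ?linear0 ?subvsP // (brC lieP) memvN; apply: H; exact: subvsP.
  rewrite {1}(basis_coordE x bb) !br_sumr //.
  under eq_bigr => i _ do rewrite (brZr lieP) (brZr lieP) bW (brZr lieP) bW !scalerA.
  rewrite (coord_basisE (fun i => coord b i x * al i y * al i y)) ?(basis_free bb) //.
  by move/eqP; rewrite !mulf_eq0 (negPf xj) /= orbb => /eqP.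
apply: (wvec0_h lieP cartanP); last first.
  by apply/(wvecP_coord lieP bb bW).
rewrite -(geig0 sigma zeta m); apply/(geigP zP bb bG) => j xj i; rewrite mxE subr0.
apply: (weight0_degree (aj j xj)).1 => {}i.
by have := geig_coord zdP bb twist_geig xS xj i; rewrite mxE subr0.
Qed.

Lemma twist_data : multiloop_data br twist d h.
Proof.
split=> //; split=> //; split; first exact: twist_aut.
split; first exact: twistC.
split; last exact: twist_cartan.
by move=> i; split; [exact: prim_order_gt0 (zdP i) | exact: twist_order].
Qed.

(** If the e-th power were the identity, d_i would divide e times the i-th coordinate of every
    [xx j], hence by [genP] of every integral vector, the unit vector included. *)
Lemma twist_is_order i : is_order (twist i) (d i).
Proof.
split; first exact: prim_order_gt0 (zdP i).
split; first exact: twist_order.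
move=> e /andP[e0 ed]; apply: NNPP => no.
have fx x : iter e (twist i) x = x by apply: NNPP => H; apply: no; exists x.
have /(_ (delta_mx 0 i)) : forall y : 'rV[int]_n, (d i %| y ord0 i * e%:Z)%Z.
  apply: genP => [x y xd yd|j|z /(_ i) zd].
  - by rewrite !mxE mulrBl rpredB.
  - have := coord_iter_dop bb e (fun j => zeta (d i) ^ xx j ord0 i) j (tnth b j).
    rewrite [iter _ _ _]fx coord_basis_vec // eqxx mulr1 exprnP exprz_exp => E.
    have /(prim_expz_eq (xx j ord0 i * e%:Z) 0 (zdP i)) : zeta (d i) ^ (xx j ord0 i * e%:Z) = zeta (d i) ^ 0.
      by rewrite -E expr0z.
    by rewrite subr0.
  by rewrite dvdz_mulr.
rewrite mxE !eqxx mul1r dvdzE /= => /dvdn_leq; rewrite e0 => /(_ isT).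
by rewrite leqNgt ed.
Qed.

Definition character (a : 'I_n -> nat) (y : 'rV[int]_n) : k := \prod_i zeta (d i) ^ (y ord0 i * (a i)%:Z).

Lemma character_twist (a : 'I_n -> nat) :
  foldr (fun i acc => (twist i \o acc)%VF) \1%VF (flatten [seq nseq (a i) i | i <- enum 'I_n]) =
  dop b (fun j => character a (xx j)).
Proof.
have E s : foldr (fun i acc => (twist i \o acc)%VF) \1%VF s =
    dop b (fun j => \prod_(i <- s) zeta (d i) ^ xx j ord0 i).
  elim: s => [|i s IH] /=; first by rewrite (dop_id bb) // => j; rewrite big_nil.
  by rewrite IH dop_comp //; congr dop; apply: functional_extensionality => j; rewrite big_cons.
rewrite E; congr dop; apply: functional_extensionality => j.
rewrite /character big_flatten big_map big_enum; apply: eq_bigr => i _.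
by rewrite big_nseq -exprz_exp -exprnP; elim: (a i) => //= e ->; rewrite exprS.
Qed.

Lemma word_character s : exists2 a : 'I_n -> nat, (forall i, (a i < d i)%N) &
  foldr (fun i acc => (twist i \o acc)%VF) \1%VF s = dop b (fun j => character a (xx j)).
Proof.
exists (fun i => count_mem i s %% d i)%N; first by move=> i; rewrite ltn_mod (prim_order_gt0 (zdP i)).
elim: s => [|t s IH] /=.
  rewrite (dop_id bb) // => j; rewrite /character big1 // => i _.
  by rewrite mod0n mulr0 expr0z.
rewrite IH dop_comp //; congr dop; apply: functional_extensionality => j.
rewrite /character (bigD1 t) //= [RHS](bigD1 t) //= mulrA; congr (_ * _); last first.
  by apply: eq_bigr => i /negPf it; rewrite eq_sym it add0n.
rewrite eqxx -expfzDr; last by rewrite (prim_root_eq0 (zdP t)) -lt0n (prim_order_gt0 (zdP t)).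
apply/(prim_expz_eq _ _ (zdP t)); rewrite -{1}[xx j ord0 t]mulr1 -mulrDr -mulrBr dvdz_mull //.
rewrite -PoszD; apply/(prim_expz_eq _ _ (zdP t)); rewrite -!exprnP.
by rewrite (prim_expr_mod (zdP t)) exprS (prim_expr_mod (zdP t)) -exprS.
Qed.

Lemma character_inj (a a' : 'I_n -> nat) : (forall i, (a i < d i)%N) -> (forall i, (a' i < d i)%N) ->
  (forall j, character a (xx j) = character a' (xx j)) -> forall i, a i = a' i.
Proof.
move=> ad ad' E i.
have z0 t : zeta (d t) != 0 by rewrite (prim_root_eq0 (zdP t)) -lt0n (prim_order_gt0 (zdP t)).
have chB c (x y : 'rV[int]_n) : character c (x - y) = character c x / character c y.
  rewrite /character -prodfV -big_split; apply: eq_bigr => t _.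
  by rewrite !mxE mulrBl expfzDr // invr_expz.
have /(_ (delta_mx 0 i)) : forall y, character a y = character a' y.
  apply: genP => [x y Ex Ey|//|z zd]; first by rewrite !chB Ex Ey.
  have one c : character c z = 1.
    rewrite /character big1 // => t _; rewrite -[RHS](expr0z (zeta (d t))).
    by apply/(prim_expz_eq _ _ (zdP t)); rewrite subr0 dvdz_mulr.
  by rewrite !one.
have chd c : character c (delta_mx 0 i) = zeta (d i) ^+ c i.
  rewrite /character (bigD1 i) //= big1 ?mulr1 => [|t ti]; rewrite mxE ?eqxx ?mul1r ?exprnP //.
  by rewrite (negPf ti) mul0r expr0z.
rewrite !chd => /eqP; rewrite (eq_prim_root_expr (zdP i)) !modn_small //.
by move/eqP.
Qed.

(** Words reduce to exponents modulo the d_i. Different exponent tuples give characters of Z^n that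
    differ on a unit vector, hence by [genP] on some [xx j]. *)
Lemma twist_group_order : exists E : seq 'End(g),
  [/\ uniq E, size E = (\prod_(i < n) d i)%N &
      forall f, f \in E <-> exists s : seq 'I_n, f = foldr (fun i acc => (twist i \o acc)%VF) \1%VF s].
Proof.
pose T := {dffun forall i : 'I_n, 'I_(d i)}.
pose op (a : T) := dop b (fun j => character (fun i => a i) (xx j)).
exists [seq op a | a <- enum T]; split.
- rewrite map_inj_uniq ?enum_uniq // => a a' /(dop_eqP bb) E; apply/ffunP => i; apply/val_inj.
  exact: (character_inj (fun i => ltn_ord (a i)) (fun i => ltn_ord (a' i)) E).
- rewrite size_map -cardE card_dep_ffun foldrE big_map big_enum.
  by apply: eq_bigr => i _; rewrite card_ord.
move=> f; split=> [/mapP[a _ ->]|[s ->]].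
  by exists (flatten [seq nseq (a i) i | i <- enum 'I_n]); rewrite character_twist.
have [a ad ->] := word_character s; apply/mapP.
pose a' : T := [ffun i => Ordinal (ad i)]; exists a'; first by rewrite mem_enum.
congr dop; apply: functional_extensionality => j; rewrite /character.
by apply: eq_bigr => i _; rewrite ffunE.
Qed.

End Twist.

(** * The support-isomorphism *)

Section TwistIso.
Variables (k : closedFieldType) (g : vectType k) (br : g -> g -> g).
Hypothesis lieP : is_lie br.
Variables (n : nat) (sigma : 'I_n -> 'End(g)) (h : {vspace g}).
Variables (zeta : nat -> k) (m d : 'I_n -> nat).
Hypothesis zP : forall i, (m i).-primitive_root (zeta (m i)).
Hypothesis zdP : forall i, (d i).-primitive_root (zeta (d i)).
Local Notation N := (\dim {:g}).
Variable b : N.-tuple g.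
Variable al : 'I_N -> hdual h.
Variable de : 'I_N -> 'rV[int]_n.
Hypothesis bb : basis_of fullv b.
Hypothesis bG : forall j, tnth b j \in geig sigma m zeta (de j).
Hypothesis bW : forall j, wvec br (al j) (tnth b j).
Variable RW : hdual h -> Prop.
Variable sh : hdual h -> 'rV[int]_n.
Hypothesis RWal : forall j, RW (al j).
Hypothesis RW0 : RW 0.
Hypothesis RWB : forall a c, RW a -> RW c -> RW (a - c).
Hypothesis shB : forall a c, RW a -> RW c -> sh (a - c) = sh a - sh c.
Variables (C : 'M[int]_n) (xx : 'I_N -> 'rV[int]_n).
Hypothesis xxP : forall j, de j - sh (al j) = xx j *m C.
Hypothesis CP : forall y : 'rV[int]_n,
  (forall i, (m i %| (y *m C) ord0 i)%Z) <-> (forall i, (d i %| y ord0 i)%Z).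
Hypothesis C_inj : forall y : 'rV[int]_n, y *m C = 0 -> y = 0.
Hypothesis C_lattice : forall t : 'rV[int]_n, (forall i, (m i %| t ord0 i)%Z) -> exists y, t = y *m C.

Local Notation tw := (twist zeta d b xx).
Local Notation L := (in_loop br sigma m h zeta).
Local Notation L' := (in_loop br tw d h zeta).
Let twG := twist_geig zeta d bb xx.
Let shD := shD RW0 RWB shB.

(** The old degree of the b_j-component whose new degree is [y]: return to the standard basis and
    undo the shift of its weight. *)
Definition twist_deg j (y : 'rV[int]_n) := y *m C + sh (al j).

Lemma mulC_inj (y z : 'rV[int]_n) : y *m C = z *m C -> y = z.
Proof. by move/eqP; rewrite -subr_eq0 -mulmxBl => /eqP/C_inj/eqP; rewrite subr_eq0 => /eqP. Qed.

Lemma twist_deg_inj j : injective (twist_deg j).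
Proof. by move=> y z /addIr/mulC_inj. Qed.

Lemma twist_deg_dvd j y : (forall i, (m i %| de j ord0 i - twist_deg j y ord0 i)%Z) <->
  (forall i, (d i %| xx j ord0 i - y ord0 i)%Z).
Proof.
have <- : (forall i, (m i %| ((xx j - y) *m C) ord0 i)%Z) <-> (forall i, (d i %| xx j ord0 i - y ord0 i)%Z).
  rewrite CP; split=> H i; have := H i; by rewrite !mxE.
rewrite mulmxBl -xxP; have -> : de j - sh (al j) - y *m C = de j - twist_deg j y.
  by rewrite /twist_deg opprD addrA addrAC.
by split=> H i; have := H i; rewrite !mxE.
Qed.

Lemma twist_deg_ex j (l : 'rV[int]_n) : (forall i, (m i %| de j ord0 i - l ord0 i)%Z) ->
  exists y, l = twist_deg j y.
Proof.
move=> H; have [|y yE] := C_lattice (t := de j - l); first by move=> i; have := H i; rewrite !mxE.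
exists (xx j - y); rewrite /twist_deg mulmxBl -xxP -yE.
by apply/rowP=> i; rewrite !mxE; ring.
Qed.

Definition twist_map (u : 'rV[int]_n -> g) : 'rV[int]_n -> g :=
  fun y => \sum_j coord b j (u (twist_deg j y)) *: tnth b j.

Lemma coord_twist_map u y j : coord b j (twist_map u y) = coord b j (u (twist_deg j y)).
Proof. exact: (coord_basisE (fun j => coord b j (u (twist_deg j y)))) (basis_free bb). Qed.

Lemma loop_coord u (l : 'rV[int]_n) j : L u -> coord b j (u l) != 0 -> exists y, l = twist_deg j y.
Proof. by case/(in_loopP lieP zP bb bG bW) => _ /(_ l)/(geigP zP bb bG) H /H/twist_deg_ex. Qed.

Lemma twist_map_supp u : fin_supp u -> fin_supp (twist_map u).
Proof.
case=> s sP; pose inv j l := epsilon (inhabits 0) (fun y => l = twist_deg j y).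
exists [seq inv j l | l <- s, j <- enum 'I_N] => y /(ex_coord_neq0 bb)[j].
rewrite coord_twist_map => uj; apply/allpairsP; exists (twist_deg j y, j); split=> /=.
- by apply: sP; apply: contraNneq uj => ->; rewrite linear0.
- by rewrite mem_enum.
apply: (@twist_deg_inj j); apply: (epsilon_spec (inhabits 0) (fun z => twist_deg j y = twist_deg j z)).
by exists y.
Qed.

Lemma twist_map_loop u : L u -> L' (twist_map u).
Proof.
case/(in_loopP lieP zP bb bG bW) => uf ug; apply/(in_loopP lieP zdP bb twG bW).
split; first exact: twist_map_supp.
move=> y; apply/(geigP zdP bb twG) => j; rewrite coord_twist_map => uj.
by apply/twist_deg_dvd; apply: (geigP zP bb bG _ _).1 uj.
Qed.

Lemma twist_map_inj u v : L u -> L v -> twist_map u = twist_map v -> u = v.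
Proof.
move=> Lu Lv E; apply: functional_extensionality => l; apply: (coord_ext bb) => j.
have Ey y : coord b j (u (twist_deg j y)) = coord b j (v (twist_deg j y)).
  by rewrite -!coord_twist_map E.
have [u0|/(loop_coord Lu)[y ->]] := eqVneq (coord b j (u l)) 0; last exact: Ey.
have [->|/(loop_coord Lv)[y lE]] := eqVneq (coord b j (v l)) 0; first by rewrite u0.
by rewrite lE Ey.
Qed.

Lemma twist_map_surj w : L' w -> exists u, L u /\ twist_map u = w.
Proof.
case/(in_loopP lieP zdP bb twG bW) => -[s sP] wg.
(* Coefficients of the preimage: in an old degree of the form [twist_deg j y] take the
   b_j-coefficient of [w y], elsewhere 0. *)
pose c j l := epsilon (inhabits (0 : k)) (fun t => (exists2 y, l = twist_deg j y & t = coord b j (w y)) \/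
  ((forall y, l <> twist_deg j y) /\ t = 0)).
have cP j l : (exists2 y, l = twist_deg j y & c j l = coord b j (w y)) \/
    ((forall y, l <> twist_deg j y) /\ c j l = 0).
  apply: (epsilon_spec (inhabits (0 : k)) (fun t => (exists2 y, l = twist_deg j y & t = coord b j (w y)) \/
    ((forall y, l <> twist_deg j y) /\ t = 0))).
  have [[y lE]|no] := classic (exists y, l = twist_deg j y).
    by exists (coord b j (w y)); left; exists y.
  by exists 0; right; split=> // y lE; apply: no; exists y.
pose u l := \sum_j c j l *: tnth b j.
have cu j l : coord b j (u l) = c j l by exact: (coord_basisE (fun j => c j l)) (basis_free bb).
exists u; split; last first.
  apply: functional_extensionality => y; apply: (coord_ext bb) => j.
  rewrite coord_twist_map cu; have [[z /twist_deg_inj-> //]|[/(_ y)]] := cP j (twist_deg j y).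
  by [].
apply/(in_loopP lieP zP bb bG bW); split.
  exists [seq twist_deg j y | j <- enum 'I_N, y <- s] => l /(ex_coord_neq0 bb)[j]; rewrite cu => cj.
  have [[y lE cE]|[_ c0]] := cP j l; last by rewrite c0 eqxx in cj.
  apply/allpairsP; exists (j, y); split=> //=; first by rewrite mem_enum.
  by apply: sP; apply: contraNneq cj => w0; rewrite cE w0 linear0.
move=> l; apply/(geigP zP bb bG) => j; rewrite cu => cj.
have [[y lE cE]|[_ c0]] := cP j l; last by rewrite c0 eqxx in cj.
rewrite lE; apply/twist_deg_dvd; apply: (geigP zdP bb twG _ _).1 (wg y) _ _.
by rewrite -cE.
Qed.

Lemma twist_map_lin a u v :
  twist_map (fun mu => a *: u mu + v mu) = fun mu => a *: twist_map u mu + twist_map v mu.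
Proof.
apply: functional_extensionality => y; apply: (coord_ext bb) => j.
by rewrite linearP /= !coord_twist_map linearP.
Qed.

Lemma coord_br x y r : coord b r (br x y) =
  \sum_j \sum_j' coord b j x * coord b j' y * coord b r (br (tnth b j) (tnth b j')).
Proof.
rewrite {1}(basis_coordE x bb) {1}(basis_coordE y bb) br_suml // linear_sum.
apply: eq_bigr => j _; rewrite br_sumr // linear_sum; apply: eq_bigr => j' _.
by rewrite brZl // brZr // !linearZ /= mulrA.
Qed.

Lemma fin_supp_uniq (u : 'rV[int]_n -> g) : fin_supp u -> exists2 s, uniq s & forall l, u l != 0 -> l \in s.
Proof. by case=> s sP; exists (undup s); rewrite ?undup_uniq // => l /sP; rewrite mem_undup. Qed.

Lemma twist_map_br u v : L u -> L v ->
  twist_map (loop_br br u v) = loop_br br (twist_map u) (twist_map v).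
Proof.
move=> Lu Lv; have /(in_loopP lieP zP bb bG bW)[uf _] := Lu.
have [s us sP] := fin_supp_uniq uf.
have [s' us' sP'] := fin_supp_uniq (twist_map_supp uf).
apply: functional_extensionality => y; apply: (coord_ext bb) => r.
rewrite coord_twist_map (loop_brE lieP _ _ uf us sP) (loop_brE lieP _ _ (twist_map_supp uf) us' sP').
rewrite !linear_sum /=.
under eq_bigr => l _ do rewrite coord_br.
under [RHS]eq_bigr => l _ do rewrite coord_br.
rewrite exchange_big [RHS]exchange_big; apply: eq_bigr => j _ /=.
rewrite exchange_big [RHS]exchange_big; apply: eq_bigr => j' _ /=.
have [c0|c0] := eqVneq (coord b r (br (tnth b j) (tnth b j'))) 0.
  by rewrite !big1 // => l _; rewrite c0 mulr0.
rewrite -!mulr_suml; congr (_ * _).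
(* A nonzero structure constant makes the weight of r the sum of those of j and j', so
   [twist_deg r y] minus [twist_deg j x] is [twist_deg j' (y - x)], and the two convolutions match
   term by term. *)
have shr : sh (al r) = sh (al j) + sh (al j').
  by rewrite (struct_weight lieP bb bW c0) shD.
pose F l := coord b j (u l) * coord b j' (v (twist_deg r y - l)).
transitivity (\sum_(x <- s') F (twist_deg j x)); last first.
  apply: eq_bigr => x _; rewrite /F !coord_twist_map; congr (_ * coord b j' (v _)).
  by rewrite /twist_deg mulmxBl shr; apply/rowP=> i; rewrite !mxE; ring.
have drop (t : seq 'rV[int]_n) (E : 'rV[int]_n -> 'rV[int]_n) : \sum_(l <- t) F (E l) =
    \sum_(l <- [seq l <- t | coord b j (u (E l)) != 0]) F (E l).
  rewrite big_filter [RHS]big_mkcond; apply: eq_bigr => l _; rewrite /F.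
  by case: eqP => //= ->; rewrite mul0r.
rewrite (drop s id) (drop s' (twist_deg j)) -(big_map (twist_deg j) xpredT F); apply: perm_big.
apply: uniq_perm; rewrite ?map_inj_uniq ?filter_uniq //; first exact: twist_deg_inj.
move=> l; rewrite mem_filter; apply/andP/mapP => [[/= uj ls]|[x]].
  have [x lE] := loop_coord Lu uj; exists x => //; rewrite mem_filter -lE uj /=.
  by apply: sP'; apply: contraNneq uj => tx; rewrite lE -coord_twist_map tx linear0.
rewrite mem_filter => /andP[uj _] ->; split=> //.
by apply: sP; apply: contraNneq uj => ->; rewrite linear0.
Qed.

(** A solution y exists on the group generated by the support, and injectivity of [C] makes it
    unique; without a solution the value is arbitrary. *)
Definition twist_psi (e : hdual h * 'rV[int]_n) : hdual h * 'rV[int]_n :=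
  (e.1, epsilon (inhabits 0) (fun y => y *m C = e.2 - sh e.1)).

Lemma twist_psiE a l y : y *m C = l - sh a -> twist_psi (a, l) = (a, y).
Proof.
move=> yE; rewrite /twist_psi /=; congr (_, _); apply: mulC_inj; rewrite yE.
by apply: (epsilon_spec (inhabits 0) (fun y => y *m C = l - sh a)); exists y.
Qed.

Local Notation S := (loop_supp br sigma m h zeta).
Local Notation S' := (loop_supp br tw d h zeta).

Lemma supp_twist a l : in_gen S (a, l) -> RW a /\ exists y, y *m C = l - sh a.
Proof.
pose P (e : hdual h * 'rV[int]_n) := RW e.1 /\ exists y, y *m C = e.2 - sh e.1.
suff PG e : in_gen S e -> P e by move/PG.
elim/in_gen_ind => [|[c t] /(loop_suppP lieP zP bb bG bW)[j [<- jt]]|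
  [c t] [c' t'] [/= rc [y yE]] [/= rc' [y' yE']]].
- by split=> //; exists 0; rewrite mul0mx /= (sh0 RW0 shB) subr0.
- split; first exact: RWal.
  by have [y ->] := twist_deg_ex jt; exists y; rewrite /= /twist_deg addrK.
split; first exact: RWB.
exists (y - y'); rewrite mulmxBl yE yE' /= shB //.
by apply/rowP=> i; rewrite !mxE; ring.
Qed.

Lemma twist_psi_spec a l : in_gen S (a, l) ->
  (twist_psi (a, l)).1 = a /\ (twist_psi (a, l)).2 *m C = l - sh a.
Proof. by case/supp_twist => _ [y yE]; rewrite (twist_psiE yE). Qed.

Lemma twist_psiB e e' : in_gen S e -> in_gen S e' -> twist_psi (e - e') = twist_psi e - twist_psi e'.
Proof.
case: e e' => [a l] [a' l'] G G'.
have [ra [y yE]] := supp_twist G; have [ra' [y' yE']] := supp_twist G'.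
rewrite (twist_psiE yE) (twist_psiE yE'); apply: twist_psiE.
by rewrite mulmxBl yE yE' shB //; apply/rowP=> i; rewrite !mxE; ring.
Qed.

Lemma twist_psi_gen e : in_gen S e -> in_gen S e /\ in_gen S' (twist_psi e).
Proof.
pose P e := in_gen S e /\ in_gen S' (twist_psi e).
apply: (in_gen_ind (P := P)) => [|[a l] Se|e1 e2 [G1 G1'] [G2 G2']].
- split; first exact: in_gen0.
  suff -> : twist_psi 0 = 0 by exact: in_gen0.
  by apply: twist_psiE; rewrite mul0mx (sh0 RW0 shB) subr0.
- split; first exact: mem_in_gen.
  have /(loop_suppP lieP zP bb bG bW)[j [ja jl]] := Se.
  have [y lE] := twist_deg_ex jl; rewrite (twist_psiE (y := y)); last first.
    by rewrite lE /twist_deg ja addrK.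
  apply: mem_in_gen; apply/(loop_suppP lieP zdP bb twG bW); exists j; split=> //.
  by apply/twist_deg_dvd; rewrite -lE.
split; first exact: in_genB.
by rewrite twist_psiB //; apply: in_genB.
Qed.

Lemma twist_psi_surj e : in_gen S' e -> exists e0, in_gen S e0 /\ twist_psi e0 = e.
Proof.
apply: (in_gen_ind (P := fun e => exists e0, in_gen S e0 /\ twist_psi e0 = e)).
- exists 0; split; first exact: in_gen0.
  by apply: twist_psiE; rewrite mul0mx (sh0 RW0 shB) subr0.
- move=> [a y] /(loop_suppP lieP zdP bb twG bW)[j [ja jy]].
  exists (a, twist_deg j y); split; last by apply: twist_psiE; rewrite /twist_deg ja addrK.
  apply: mem_in_gen; apply/(loop_suppP lieP zP bb bG bW); exists j; split=> //.
  exact/twist_deg_dvd.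
move=> _ _ [e1 [G1 <-]] [e2 [G2 <-]]; exists (e1 - e2).
by split; [exact: in_genB | rewrite twist_psiB].
Qed.

Theorem twist_support_iso : support_iso zeta br sigma m h br tw d h.
Proof.
exists twist_map, twist_psi; split; split.
- exact: twist_map_loop.
- by move=> a u v _ _; apply: twist_map_lin.
- exact: twist_map_inj.
- exact: twist_map_surj.
- exact: twist_map_br.
- by move=> e /twist_psi_gen[].
- move=> e e' G G'; have G0 := in_gen0 S; have GN := in_genB G0 G'.
  have psi0 : twist_psi 0 = 0 by rewrite -[in LHS](subrr 0) twist_psiB // subrr.
  by rewrite -{1}[e']opprK -(sub0r e') twist_psiB // twist_psiB // psi0 sub0r opprK.
- move=> [a l] [a' l'] G G' E; have [a1 l1] := twist_psi_spec G; have [a2 l2] := twist_psi_spec G'.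
  have aa : a = a' by rewrite -a1 E a2.
  congr (_, _) => //; apply: (addIr (- sh a)); by rewrite -l1 E l2 aa.
- exact: twist_psi_surj.
move=> [a l] G; have [_ [y yE]] := supp_twist G; rewrite (twist_psiE yE).
have td j : al j = a -> forall z, (twist_deg j z = l) <-> (z = y).
  move=> ja z; rewrite /twist_deg ja; split=> [zl|->]; last by rewrite yE subrK.
  by apply: mulC_inj; rewrite yE -zl addrK.
split.
  move=> u [/= u0 ul /(wvecP_coord lieP bb bW) uw]; have uz z : twist_map u z = if z == y then u l else 0.
    apply: (coord_ext bb) => j; rewrite coord_twist_map.
    have [ja|ja] := eqVneq (al j) a.
      case: eqP => [/(td j ja) -> //|zy]; rewrite u0 //.
      by apply/eqP => /(td j ja).
    have ul0 : coord b j (u l) = 0 by apply/eqP; apply: contraNT ja => /uw ->.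
    have -> : coord b j (u (twist_deg j z)) = 0.
      by have [->//|zl] := eqVneq (twist_deg j z) l; rewrite u0 // linear0.
    by case: ifP; rewrite ?linear0.
  split=> /= [z zy|| ]; rewrite uz ?(negPf zy) ?eqxx //; last exact/(wvecP_coord lieP bb bW).
  apply/(geigP zdP bb twG) => j uj; apply/twist_deg_dvd.
  by rewrite ((td j (uw j uj) y).2 erefl); apply: (geigP zP bb bG _ _).1 ul _ uj.
move=> w [/= w0 wy /(wvecP_coord lieP bb bW) ww].
exists (fun mu => if mu == l then w y else 0); split.
  split=> /= [mu /negPf->//||]; rewrite eqxx; last exact/(wvecP_coord lieP bb bW).
  apply/(geigP zP bb bG) => j wj; rewrite -((td j (ww j wj) y).2 erefl); apply/twist_deg_dvd.
  exact: (geigP zdP bb twG _ _).1 wy _ wj.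
apply: functional_extensionality => z; apply: (coord_ext bb) => j; rewrite coord_twist_map.
have [ja|ja] := eqVneq (al j) a.
  case: eqP => [/(td j ja) -> //|zl]; rewrite w0 //.
  by apply/eqP => /(td j ja).
have wj t : coord b j (w t) = 0.
  have [->|ty] := eqVneq t y; last by rewrite w0 // linear0.
  by apply/eqP; apply: contraNT ja => /ww ->.
by rewrite wj; case: ifP; rewrite ?linear0 ?wj.
Qed.

End TwistIso.

(** * The multiloop torus *)

Section KillingForm.
Variables (k : closedFieldType) (g : vectType k) (br : g -> g -> g).
Variable io : {rmorphism rat -> k}.
Hypothesis lieP : is_lie br.
Variables (n : nat) (sigma : 'I_n -> 'End(g)) (h : {vspace g}).
Local Notation S := (gsig sigma).
Local Notation kl := (kill br sigma).
Hypothesis Sbr : forall x y, x \in S -> y \in S -> br x y \in S.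
Hypothesis hS : (h <= S)%VS.
Local Notation N := (\dim {:g}).
Variable b : N.-tuple g.
Variable al : 'I_N -> hdual h.
Hypothesis bb : basis_of fullv b.
Hypothesis bW : forall j, wvec br (al j) (tnth b j).
Hypothesis Sb : forall x j, x \in S -> coord b j x != 0 -> tnth b j \in S.

Lemma kill_trU x y : kl x y = trU S (ad br x \o ad br y)%VF.
Proof. by apply: eq_bigr => i _; rewrite comp_lfunE !adE. Qed.

Lemma killC x y : x \in S -> y \in S -> kl x y = kl y x.
Proof. by move=> xS yS; rewrite !kill_trU; apply: trU_mulC => v vS; rewrite adE // Sbr. Qed.

Lemma kill_lin a x y z : kl (a *: x + y) z = a * kl x z + kl y z.
Proof.
rewrite !kill_trU -trUZ -trUD; apply: trU_eq => v _.
by rewrite add_lfunE scale_lfunE !comp_lfunE !adE // br_lin_l.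
Qed.

Lemma kill_inv x y z : x \in S -> y \in S -> z \in S -> kl (br x y) z = kl x (br y z).
Proof.
move=> xS yS zS; rewrite !kill_trU.
pose A := ad br x; pose B := ad br y; pose D := ad br z.
transitivity (trU S (A \o (B \o D))%VF - trU S (B \o (A \o D))%VF).
  rewrite -trUN -trUD; apply: trU_eq => v _.
  by rewrite add_lfunE opp_lfunE !comp_lfunE !adE // (jacobi lieP x) addrK.
have st w : w \in S -> forall v, v \in S -> ad br w v \in S.
  by move=> wS v vS; rewrite adE // Sbr.
have -> : trU S (B \o (A \o D))%VF = trU S ((A \o D) \o B)%VF.
  by apply: trU_mulC => v vS; rewrite ?comp_lfunE !st.
rewrite -trUN -trUD; apply: trU_eq => v _.
rewrite add_lfunE opp_lfunE !comp_lfunE !adE // (jacobi lieP y) brDr //.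
by rewrite addrK.
Qed.

(** In a basis of S taken from [b], the trace of (ad t)^2 is a sum of rational squares, one of them
    nonzero. *)
Lemma kill_h_nonneg t (r : 'I_N -> rat) : t \in h ->
  (forall j, hev (al j) t = io (r j)) ->
  (exists2 j, tnth b j \in S & r j != 0) -> kl t t != 0.
Proof.
move=> th tr [j0 jS rj]; pose X := [seq v <- b | v \in S].
have Xb : basis_of S (in_tuple X).
  rewrite basisEfree filter_free ?(basis_free bb) //=; apply/andP; split.
    by apply/span_subvP => v; rewrite mem_filter => /andP[].
  rewrite -(eqP (_ : \dim S == size X)) ?leqnn //.
  suff SX : (S <= <<X>>)%VS.
    have XS : (<<X>> <= S)%VS by apply/span_subvP => v; rewrite mem_filter => /andP[].
    have -> : S = <<X>>%VS by apply/eqP; rewrite eqEsubv SX.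
    by have := filter_free (fun v => v \in S) (basis_free bb); rewrite /free eq_sym eq_sym => /eqP->.
  apply/subvP => x xS; rewrite (basis_coordE x bb); apply: memv_suml => j _.
  have [->|xj] := eqVneq (coord b j x) 0; first by rewrite scale0r mem0v.
  by rewrite memvZ // memv_span // mem_filter (Sb xS xj) mem_tnth.
rewrite kill_trU (trU_basis Xb); last first.
  by move=> v vS; rewrite comp_lfunE !adE // !Sbr // (subvP hS).
have ev v : v \in X -> exists2 j, v = tnth b j & br t (br t v) = io (r j ^+ 2) *: v.
  rewrite mem_filter => /andP[_ /tnthP[j ->]]; exists j => //.
  by rewrite !(wvecE (bW j) th, brZr lieP) tr scalerA -rmorphM.
have cE i : exists2 j, tnth (in_tuple X) i = tnth b j &
    coord (in_tuple X) i ((ad br t \o ad br t)%VF (tnth (in_tuple X) i)) = io (r j ^+ 2).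
  have [|j Xj E] := ev (tnth (in_tuple X) i); first exact: mem_tnth.
  exists j => //; rewrite comp_lfunE !adE // E linearZ /= (tnth_nth 0) coord_free ?eqxx ?mulr1 //.
  exact: basis_free Xb.
have [|i0 iE] := tnthP (in_tuple X) (tnth b j0) _; first by rewrite mem_filter jS mem_tnth.
have nn (P : pred 'I_(size X)) : exists2 q : rat, 0 <= q &
    \sum_(i | P i) coord (in_tuple X) i ((ad br t \o ad br t)%VF (tnth (in_tuple X) i)) = io q.
  elim/big_rec: _ => [|i _ _ [q q0 ->]]; first by exists 0; rewrite ?rmorph0.
  have [j _ ->] := cE i; exists (r j ^+ 2 + q); last by rewrite rmorphD.
  by rewrite addr_ge0 ?sqr_ge0.
rewrite (bigD1 i0) //=; have [q q0 ->] := nn (fun i => i != i0).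
have [j jE ->] := cE i0; have jj0 : j = j0.
  have := coord_basis_vec bb j j0; rewrite iE jE coord_basis_vec // eqxx.
  by case: eqP => // _ /eqP; rewrite oner_eq0.
rewrite -rmorphD fmorph_eq0 jj0 gt_eqF // ltr_wpDr // exprn_even_gt0 //.
Qed.

(** [tvec] is a vector chosen for a prescribed pairing. A coroot t = [e, f] inside the fixed algebra
    shows that such a vector exists and gives its pairings. *)
Record coroot_triple (a : hdual h) (t : g) : Prop := CorootTriple {
  ct_mem : t \in h;
  ct_br : exists e f, [/\ e \in S, f \in S, wvec br (- a) f & t = br e f];
  ct_neq0 : kl t t != 0;
  ct_two : hev a t = 2%:R }.

(** By invariance, the form of [e, f] and y is a(y) times the form of e and f, so t is proportional
    to the dual vector of a. *)
Lemma ct_scal a t : coroot_triple a t -> exists2 c, c != 0 & forall y, y \in h -> kl t y = c * hev a y.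
Proof.
case=> th [e [f [eS fS fW tE]]] t0 t2; exists (kl e f).
  apply: contraNneq t0 => ef; rewrite {1}tE kill_inv // ?(subvP hS) //.
  rewrite (brC lieP) (wvecE fW th) /hev opp_lfunE -/(hev a t) scaleNr opprK -[_ *: f]addr0.
  rewrite killC ?addr0 ?memvZ // -[_ *: f]addr0 kill_lin killC // ef mulr0 add0r.
  by have := kill_lin 0 f 0 e; rewrite scale0r add0r mul0r add0r => <-;
     have := kill_lin (-1) 0 0 e; rewrite scaler0 addr0 mulN1r addNr => ->.
move=> y yh; have yS := subvP hS y yh.
rewrite tE kill_inv // (brC lieP) (wvecE fW yh) /hev opp_lfunE -/(hev a y) scaleNr opprK.
rewrite -[_ *: f]addr0 killC ?addr0 ?memvZ // -[_ *: f]addr0 kill_lin killC //.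
have -> : kl 0 e = 0 by have := kill_lin (-1) 0 0 e; rewrite scaler0 addr0 mulN1r addNr.
by rewrite addr0 mulrC.
Qed.

Lemma tvec_spec a t : coroot_triple a t ->
  tvec br sigma a \in h /\ forall y, y \in h -> kl y (tvec br sigma a) = hev a y.
Proof.
move=> ct; have [c c0 cE] := ct_scal ct.
pose P u := u \in h /\ forall y : subvs_of h, kl (vsval y) u = a y.
have [uh uE] : P (tvec br sigma a).
  apply: (epsilon_spec (inhabits 0) P); exists (c^-1 *: t).
  have th := ct_mem ct; split=> [|y]; first by rewrite memvZ.
  rewrite killC ?(subvP hS) ?memvZ ?subvsP // -[_ *: t]addr0 kill_lin cE ?subvsP //.
  have -> : kl 0 (vsval y) = 0 by have := kill_lin (-1) 0 0 (vsval y); rewrite scaler0 addr0 mulN1r addNr.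
  by rewrite addr0 mulKf // /hev vsvalK.
split=> // y yh; have := uE (vsproj h y); by rewrite vsprojK.
Qed.

Lemma dform_coroot a c t u : coroot_triple a t -> coroot_triple c u ->
  dform br sigma a c = dform br sigma c a /\
  2%:R * dform br sigma a c = hev a u * dform br sigma c c.
Proof.
move=> ca cc; have [ah aE] := tvec_spec ca; have [ch cE] := tvec_spec cc.
have sym x y : x \in h -> y \in h -> kl x y = kl y x by move=> xh yh; rewrite killC ?(subvP hS).
split; first by rewrite /dform sym.
have [z z0 zE] := ct_scal cc; have uh := ct_mem cc.
have E x t' (cx : coroot_triple x t') : z * dform br sigma x c = hev x u.
  have [xh xE] := tvec_spec cx; by rewrite /dform cE // -zE // xE.
apply: (mulfI z0); rewrite mulrCA (E a t ca) (mulrCA z) (E c u cc) (ct_two cc) mulrC.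
by [].
Qed.

End KillingForm.

(** * The torus axioms for the twisted automorphisms *)

Section TwistedTorus.
Variables (k : closedFieldType) (g : vectType k) (br : g -> g -> g).
Variable io : {rmorphism rat -> k}.
Hypothesis lieP : is_lie br.
Hypothesis simpleP : simple_in br fullv.
Variables (n : nat) (sigma : 'I_n -> 'End(g)) (h : {vspace g}).
Hypothesis autP : forall i, is_lie_aut br (sigma i).
Hypothesis sigmaC : forall i j x, sigma i (sigma j x) = sigma j (sigma i x).
Hypothesis cartanP : cartan_sub br (gsig sigma) h.
Variables (zeta : nat -> k) (m : 'I_n -> nat).
Hypothesis zP : forall i, (m i).-primitive_root (zeta (m i)).
Hypothesis mP : forall i x, iter (m i) (sigma i) x = x.
Local Notation N := (\dim {:g}).
Variable b : N.-tuple g.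
Variable al : 'I_N -> hdual h.
Variable de : 'I_N -> 'rV[int]_n.
Hypothesis bb : basis_of fullv b.
Hypothesis bG : forall j, tnth b j \in geig sigma m zeta (de j).
Hypothesis bW : forall j, wvec br (al j) (tnth b j).
Local Notation rv := (rv io lieP simpleP autP sigmaC cartanP zP mP al).
Local Notation rat_w := (rational_weight io lieP simpleP autP sigmaC cartanP zP mP al).
Local Notation Phi := (Phi io lieP simpleP autP sigmaC cartanP zP mP al).
Local Notation Gr := (Gr io lieP simpleP autP sigmaC cartanP zP mP al).
Let RS : root_system Phi := Phi_roots io lieP simpleP autP sigmaC cartanP zP mP bb bG bW.
Variables (tau : g) (phi : 'rV[rat]_N -> rat).
Hypothesis GR : graded br io Phi Gr tau phi.
Variables (l0 : nat) (p : 'I_l0 -> 'rV[rat]_N) (cf : 'I_l0 -> 'rV[rat]_N -> rat).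
Hypothesis BP : base Phi p cf.
Variable s : 'I_l0 -> 'rV[int]_n.
Hypothesis sP : forall i, exists2 e, e \in Gr (p i) (s i) & e != 0.

Let ratal j : rat_w (al j) := rational_al io lieP simpleP autP sigmaC cartanP zP mP bb bG bW j.

(* The degree shift which moves the simple root vectors to degree 0. *)
Definition shv (a : 'rV[rat]_N) : 'rV[int]_n := \sum_i s i *~ numq (cf i a).
Definition integral (a : 'rV[rat]_N) := forall i, exists z : int, cf i a = z%:~R.

Lemma cfB i x y : cf i (x - y) = cf i x - cf i y.
Proof. by rewrite addrC -scaleN1r (base_lin BP) mulN1r addrC. Qed.

Lemma integralB a c : integral a -> integral c -> integral (a - c).
Proof.
move=> ai ci i; have [z zE] := ai i; have [t tE] := ci i.
by exists (z - t); rewrite cfB zE tE rmorphB.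
Qed.

Lemma shvB a c : integral a -> integral c -> shv (a - c) = shv a - shv c.
Proof.
move=> ai ci; rewrite /shv -sumrB; apply: eq_bigr => i _.
have [z zE] := ai i; have [t tE] := ci i.
by rewrite cfB zE tE -rmorphB !numq_int mulrzBr.
Qed.

Lemma integral_wts a : a \in 0 :: Phi -> integral a.
Proof.
rewrite inE => /orP[/eqP-> i|aP i].
  by exists 0; rewrite -(subrr (0 : 'rV[rat]_N)) cfB subrr.
by have [/(_ i)[t ->]|/(_ i)[t ->]] := base_sign BP aP; [exists t | exists (- t%:Z); rewrite rmorphN].
Qed.

Lemma integral0 : integral 0.
Proof. by apply: integral_wts; rewrite mem_head. Qed.

Lemma shv0 : shv 0 = 0.
Proof. by rewrite -[in LHS](subrr 0) shvB ?subrr //; apply: integral0. Qed.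

Lemma shvN a : integral a -> shv (- a) = - shv a.
Proof. by move=> ai; rewrite -sub0r shvB ?shv0 ?sub0r //; apply: integral0. Qed.

Lemma shvD a c : integral a -> integral c -> shv (a + c) = shv a + shv c.
Proof.
move=> ai ci; have ni : integral (- c) by rewrite -sub0r; apply: integralB => //; apply: integral0.
by rewrite -{1}[c]opprK shvB // shvN // opprK.
Qed.

Lemma shv_p i : shv (p i) = s i.
Proof.
rewrite /shv (bigD1 i) //= (base_dual BP) eqxx big1 ?addr0 => [|j ji].
  by rewrite (numq_int 1).
by rewrite (base_dual BP) (negPf ji).
Qed.

Lemma al_wts j : rv (al j) \in 0 :: Phi.
Proof.
have [->|aj] := eqVneq (al j) 0; first by rewrite rv0 ?mem_head.
by rewrite inE; apply/orP; right; apply/PhiP; exists j.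
Qed.

Definition lattice_weight (a : hdual h) := rat_w a /\ integral (rv a).

Lemma lattice_al j : lattice_weight (al j).
Proof. by split=> //; apply: integral_wts; apply: al_wts. Qed.

Lemma lattice0 : lattice_weight 0.
Proof. by split; [exact: rational0 | rewrite rv0 //; exact: integral0]. Qed.

Lemma rvB a c : rat_w a -> rat_w c -> rv (a - c) = rv a - rv c.
Proof. by move=> ra rc; rewrite rvD ?rvN //; apply: rationalN. Qed.

Lemma latticeB a c : lattice_weight a -> lattice_weight c -> lattice_weight (a - c).
Proof.
move=> [ra ai] [rc ci]; split; first by apply: rationalD => //; apply: rationalN.
by rewrite rvB //; apply: integralB.
Qed.

Definition shw a := shv (rv a).

Lemma shwB a c : lattice_weight a -> lattice_weight c -> shw (a - c) = shw a - shw c.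
Proof. by move=> [ra ai] [rc ci]; rewrite /shw rvB // shvB. Qed.

Variable d : 'I_n -> nat.
Hypothesis zdP : forall i, (d i).-primitive_root (zeta (d i)).
Variables (C : 'M[int]_n) (xx : 'I_N -> 'rV[int]_n).
Hypothesis xxP : forall j, de j - shw (al j) = xx j *m C.
Hypothesis CP : forall y : 'rV[int]_n,
  (forall i, (m i %| (y *m C) ord0 i)%Z) <-> (forall i, (d i %| y ord0 i)%Z).

Local Notation tw := (twist zeta d b xx).
Let twG := twist_geig zeta d bb xx.
Local Notation D := (geig tw d zeta).

Definition Gt (a : 'rV[rat]_N) (y : 'rV[int]_n) := Gr a (y *m C + shv a).

Lemma Gt_coord a y x : (x \in Gt a y) <->
  forall j, coord b j x != 0 -> rv (al j) = a /\ forall i, (d i %| xx j ord0 i - y ord0 i)%Z.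
Proof.
have [->|x0] := eqVneq x 0.
  by rewrite mem0v; split=> // _ j; rewrite linear0 eqxx.
have deg j : a = rv (al j) -> (forall i, (m i %| de j ord0 i - (y *m C + shv a) ord0 i)%Z) <->
    (forall i, (d i %| xx j ord0 i - y ord0 i)%Z).
  by move=> ->; apply: (twist_deg_dvd xxP CP).
split=> [xG j xj|H].
  have [j0 [aE jW]] := Gr_al bb bG bW xG x0.
  have ja := (wvecP_coord lieP bb bW _ _).1 jW j xj; split; first by rewrite ja.
  apply/(deg j); first by rewrite ja.
  have /mem_Gr[xl _] := xG.
  exact: (geigP zP bb bG _ _).1 xl j xj.
have [j0 /H[j0a _]] := ex_coord_neq0 bb x0.
rewrite /Gt -{1}j0a; apply/(Gr_wvec bb bG bW) => //; split.
  by apply/(geigP zP bb bG) => j /H[ja jd]; apply/deg.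
apply/(wvecP_coord lieP bb bW) => j /H[ja _].
by apply: (rv_inj bb bW (ratal j) (ratal j0)); rewrite ja j0a.
Qed.

Lemma Gt_deg a y x : x \in Gt a y -> x \in D y.
Proof. by move=> /Gt_coord H; apply/(geigP zdP bb twG) => j /H[]. Qed.

Lemma sum_comp_twist y x : x \in D y <-> sum_comp Phi Gt y x.
Proof.
split=> [/(geigP zdP bb twG) H|[c [cG ->]]]; last first.
  by apply: memv_suml => a _; apply: Gt_deg (cG a).
exists (fun a => \sum_(j | rv (al j) == a) coord b j x *: tnth b j); split=> [a|].
  apply: memv_suml => j /eqP ja; have [->|/H jd] := eqVneq (coord b j x) 0.
    by rewrite scale0r mem0v.
  rewrite memvZ //; apply/Gt_coord => t; rewrite coord_basis_vec //.
  by have [->//|_] := eqVneq t j; rewrite eqxx.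
rewrite {1}(basis_coordE x bb) (exchange_big_dep xpredT) //=; apply: eq_bigr => j _.
have uw := uniq_wts GR; have jw : rv (al j) \in wts Phi by rewrite mem_wts al_wts.
rewrite big_mkcond (bigD1_seq _ jw uw) /= eqxx.
by rewrite big1 ?addr0 // => a; rewrite eq_sym => /negPf->.
Qed.

Lemma Gt_supp a y x : x \in Gt a y -> x != 0 -> a \in 0 :: Phi.
Proof. exact: (gr_supp GR). Qed.

Lemma basis_Gt j : tnth b j \in Gt (rv (al j)) (xx j).
Proof.
apply/Gt_coord => t; rewrite coord_basis_vec //; have [-> _|_] := eqVneq t j; last by rewrite eqxx.
by split=> // i; rewrite subrr dvdz0.
Qed.

Lemma Gt_opp a y : a \in 0 :: Phi -> Gt (- a) (- y) = Gr (- a) (- (y *m C + shv a)).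
Proof. by move=> /integral_wts ai; rewrite /Gt mulNmx shvN // opprD. Qed.

Lemma Gt00 : Gt 0 0 = Gr 0 0.
Proof. by rewrite /Gt mul0mx shv0 addr0. Qed.

Lemma graded_twist : graded br io Phi Gt tau phi.
Proof.
split=> //.
- move=> a c y z x x' xG xG'.
  have [->|x0] := eqVneq x 0; first by rewrite br0l // mem0v.
  have [->|x0'] := eqVneq x' 0; first by rewrite br0r // mem0v.
  have := gr_br GR xG xG'; rewrite /Gt shvD ?mulmxDl; first by rewrite addrACA.
    exact: integral_wts (Gt_supp xG x0).
  exact: integral_wts (Gt_supp xG' x0').
- move=> v; exists [seq coord b j v *: tnth b j | j <- enum 'I_N].
    move=> _ /mapP[j _ ->]; exists (rv (al j)), (xx j).
    by rewrite memvZ // basis_Gt.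
  by rewrite big_map big_enum -basis_coordE.
- exact: Gt_supp.
- move=> a /PhiP[j aj ->]; exists (xx j), (tnth b j); split; first exact: basis_Gt.
  apply/eqP => bj0; have := coord_basis_vec bb j j.
  by rewrite bj0 linear0 eqxx => /eqP; rewrite eq_sym oner_eq0.
- by rewrite Gt00; apply: gr_tau GR.
- by move=> a y x; apply: (gr_tauE GR).
- exact: gr_phi GR.
- move=> y a; rewrite Gt00 => yG; have [c [c0 cE]] := gr_cart GR a yG; exists c; split=> // l x.
  exact: cE.
- move=> a y x xG H; apply/eqP/negPn/negP => x0; case/eqP: (x0).
  by apply: (gr_kf GR xG) => z; rewrite -Gt_opp ?(Gt_supp xG) //; apply: H.
- by move=> a c y z x x'; apply: (gr_kf0 GR).
- move=> a y e aP eG e0; have [f fG fE] := gr_sl2 GR aP eG e0.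
  exists f; first by rewrite Gt_opp // inE aP orbT.
  by move=> c z x; apply: fE.
by move=> a y x x'; apply: (gr_dim GR).
Qed.

Lemma twist_simple i : exists2 e, e \in Gt (p i) 0 & e != 0.
Proof. by rewrite /Gt mul0mx add0r shv_p. Qed.

Hypothesis Phi_n0 : exists a, a \in Phi.

Lemma twist_simple_gsig : simple_in br (gsig tw).
Proof.
rewrite -(geig0 tw zeta d).
exact: (graded_deg0_simple graded_twist sum_comp_twist BP twist_simple).
Qed.

Lemma tw_mem0 x j : x \in gsig tw -> coord b j x != 0 -> tnth b j \in gsig tw.
Proof.
rewrite -(geig0 tw zeta d) => /(geigP zdP bb twG) H /H jd.
by apply/(geigP zdP bb twG) => t; rewrite coord_basis_vec //; have [->//|_] := eqVneq t j; rewrite eqxx.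
Qed.

Hypothesis htw : (h <= gsig tw)%VS.

Local Notation root0 := (is_root0 br tw (h := h)).

(** After the shift every indivisible root has vectors of degree 0 and no divisible one does, so the
    fixed algebra has a reduced root system. *)
Lemma root0P (a : hdual h) : root0 a <-> [/\ rat_w a, rv a \in Phi & indivisible Phi (rv a)].
Proof.
split=> [[a0 [x [x0 xS xW]]]|[ra aP ai]].
  have [aP ra] := weight_Phi io lieP simpleP autP sigmaC cartanP zP mP bb bG bW xW x0 a0.
  split=> // c cP; apply/eqP => aE.
  have [c' cP' [ci cE]] : exists2 c', c' \in Phi & indivisible Phi c' /\ rv a = 2%:R *: c'.
    apply: (divisible_half RS aP) => H; have := H _ cP; by rewrite aE eqxx.
  case/eqP: (x0); apply: (deg0_divisible graded_twist BP twist_simple cP' _ ci).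
  rewrite -cE; apply/Gt_coord => j xj; split.
    by rewrite ((wvecP_coord lieP bb bW _ _).1 xW j xj).
  by move: xS; rewrite -(geig0 tw zeta d) => /(geigP zdP bb twG)/(_ j xj).
have [e eG e0] := deg0_indivisible graded_twist BP twist_simple aP ai.
split; first by apply: contraNneq (root_neq0 RS aP) => ->; rewrite rv0.
exists e; split=> //; first by rewrite -(geig0 tw zeta d); apply: Gt_deg eG.
by have /(Gr_wvec bb bG bW)[] := eG.
Qed.

Lemma root0_coroot (a : hdual h) : root0 a -> exists t, coroot_triple br tw a t /\
  forall c, rat_w c -> rv c \in Phi -> hev c t = io (cn (rv c) (rv a)).
Proof.
move=> /[dup] ra0 /root0P[ra aP ai].
have [e eG e0] := deg0_indivisible graded_twist BP twist_simple aP ai.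
have [f [fG sl2 fE]] := deg0_sl2 graded_twist aP eG e0.
have eW : wvec br a e by have /(Gr_wvec bb bG bW)[] := eG.
have fW : wvec br (- a) f.
  by move: fG; rewrite /Gt -rvN // => /(Gr_wvec bb bG bW)[] //; apply: rationalN.
have th : br e f \in h.
  apply: (@Gr00_h _ _ _ io _ _ _ _ _ _ _ _ _ _ _ _ _ _ _ bb bG bW); rewrite -Gt00.
  by have := gr_br graded_twist eG fG; rewrite subrr addr0.
have tE j : hev (al j) (br e f) = io (cn (rv (al j)) (rv a)).
  have := fE _ _ _ (basis_Gt j); rewrite (wvecE (bW j) th) => /(congr1 (coord b j)).
  by rewrite !linearZ /= coord_basis_vec // eqxx !mulr1.
have tc c : rat_w c -> rv c \in Phi -> hev c (br e f) = io (cn (rv c) (rv a)).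
  move=> rc /PhiP[j _ cE]; rewrite cE -tE; congr (hev _ _).
  exact: (rv_inj bb bW rc (ratal j)).
exists (br e f); split=> //; have [a0 _] := ra0.
have inS y x : x \in Gt y 0 -> x \in gsig tw by rewrite -(geig0 tw zeta d); apply: Gt_deg.
split=> //.
- by exists e, f; split=> //; apply: inS; eassumption.
- apply: (kill_h_nonneg lieP _ htw bb bW tw_mem0 th tE).
    by have [] := twist_simple_gsig.
  have [j ej] := ex_coord_neq0 bb e0; exists j; first by apply: tw_mem0 ej; apply: inS eG.
  rewrite ((wvecP_coord lieP bb bW _ _).1 eW j ej) cnxx ?(root_neq0 RS) //.
by rewrite tc // cnxx ?(root_neq0 RS) // rmorph_nat.
Qed.

Lemma dform_cn (a c : hdual h) : root0 a -> root0 c ->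
  dform br tw a c = dform br tw c a /\
  2%:R * dform br tw a c = io (cn (rv a) (rv c)) * dform br tw c c.
Proof.
move=> a0 c0; have [t [ta _]] := root0_coroot a0; have [u [uc uE]] := root0_coroot c0.
have [] // := dform_coroot lieP _ htw ta uc; first by have [] := twist_simple_gsig.
by have /root0P[ra aP _] := a0; rewrite uE.
Qed.

Lemma root0_al a : a \in Phi -> indivisible Phi a -> exists2 j, root0 (al j) & rv (al j) = a.
Proof. by move=> /PhiP[j aj ->] ai; exists j => //; apply/root0P; split=> //; apply/PhiP; exists j. Qed.

(** [dform] and [dot] come from Killing forms of different algebras, but yield the same Cartan
    integers, and these determine the length ratio of two nonorthogonal roots. *)
Lemma dform_dot (a c : hdual h) : root0 a -> root0 c -> dot (rv a) (rv c) != 0 ->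
  io (dot (rv c) (rv c)) * dform br tw a a = io (dot (rv a) (rv a)) * dform br tw c c.
Proof.
move=> a0 c0 ac; have [sym E] := dform_cn a0 c0; have [_ E'] := dform_cn c0 a0.
have two0 : (2%:R : k) != 0 by rewrite -(rmorph_nat io) fmorph_eq0.
have iac : io (dot (rv a) (rv c)) != 0 by rewrite fmorph_eq0.
have X : io (cn (rv a) (rv c)) * io (dot (rv c) (rv c)) = 2%:R * io (dot (rv a) (rv c)).
  by rewrite -rmorphM cn_dot rmorphM rmorph_nat.
have Y : io (cn (rv c) (rv a)) * io (dot (rv a) (rv a)) = 2%:R * io (dot (rv a) (rv c)).
  by rewrite -rmorphM cn_dot dotC rmorphM rmorph_nat.
have EE : io (cn (rv a) (rv c)) * dform br tw c c = io (cn (rv c) (rv a)) * dform br tw a a.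
  by rewrite -E -E' sym.
have alg (A B u x y fa fc : k) : u != 0 -> x * B = u -> y * A = u -> x * fc = y * fa -> B * fa = A * fc.
  move=> u0 xB yA xy; apply: (mulfI u0); transitivity (A * B * (y * fa)); first by rewrite -yA; ring.
  by rewrite -xy -xB; ring.
exact: alg (mulf_neq0 two0 iac) X Y EE.
Qed.

Lemma rv_natcomb (I : finType) (F : I -> hdual h) (c : I -> nat) : (forall i, rat_w (F i)) ->
  rat_w (\sum_i F i *+ c i) /\ rv (\sum_i F i *+ c i) = \sum_i (c i)%:R *: rv (F i).
Proof.
move=> rF; elim/big_rec2: _ => [|i y1 y2 _ [r2 E2]]; first by split; [exact: rational0 | rewrite rv0].
have -> : F i *+ c i + y2 = io (c i)%:R *: F i + y2 by rewrite rmorph_nat scaler_nat.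
by split; [exact: rational_lin | rewrite rv_lin // E2].
Qed.

Lemma twist_typeB e : halfroot Phi e -> typeB br tw h.
Proof.
move=> /(typeB_base RS)[l [q [l_gt0 qP [ee [Cd [eP dualP]]] comb cart]]]; exists l; split=> //.
have qJ i : exists j, root0 (al j) /\ rv (al j) = q i.
  by have [qi qind] := qP i; have [j j0 jE] := root0_al qi qind; exists j.
pose J i := projT1 (constructive_indefinite_description _ (qJ i)).
have [J0 JE] : (forall i, root0 (al (J i))) /\ (forall i, rv (al (J i)) = q i).
  by split=> i; have [] := projT2 (constructive_indefinite_description _ (qJ i)).
pose Pi i := al (J i); exists Pi; split; last first.
  move=> i j; have [_ ->] := dform_cn (J0 i) (J0 j).
  by rewrite !JE cart rmorph_int.
split=> //; split.
  have : free [tuple Pi i | i < l]; last by [].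
  apply/freeP => c c0 j; have {}c0 : \sum_(t < l) c t *: Pi t = 0.
    by rewrite -[RHS]c0; apply: eq_bigr => t _; rewrite -tnth_nth tnth_mktuple.
  (* Evaluating the relation on the dual vectors of the roots [ee t] gives rational pairings; the
     combinations from [dual_comb] then isolate each coefficient. *)
  have cs t : \sum_(i < l) c i * io (dot (ee t) (q i)) = 0.
    have /PhiP[r _ rE] := eP t; rewrite rE.
    have := congr1 (fun f : hdual h => hev f (dualv io lieP simpleP autP sigmaC cartanP zP mP (al r))) c0.
    rewrite /hev zero_lfunE sum_lfunE => E; rewrite -[RHS]E; apply: eq_bigr => i _.
    by rewrite scale_lfunE -JE dotC (dot_rv bb bW (ratal _) (ratal r)).
  transitivity (\sum_(i < l) c i * io (j == i)%:R).
    rewrite (bigD1 j) //= eqxx rmorph1 mulr1 big1 ?addr0 // => i ij.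
    by rewrite eq_sym (negPf ij) rmorph0 mulr0.
  under eq_bigr => i _ do rewrite -dualP rmorph_sum mulr_sumr.
  rewrite exchange_big big1 // => t _ /=.
  under eq_bigr => i _ do rewrite rmorphM mulrCA.
  by rewrite -mulr_sumr cs mulr0.
move=> a a0; have /root0P[ra aP ai] := a0; have [c cE] := comb _ aP ai; exists c.
have [rc rE] := rv_natcomb c (fun i => ratal (J i)).
have qE : \sum_i (c i)%:R *: q i = rv (\sum_i Pi i *+ c i).
  by rewrite rE; apply: eq_bigr => i _; rewrite JE.
case: cE => cE; [left | right].
  by apply: (rv_inj bb bW ra rc); rewrite cE qE.
by apply: (rv_inj bb bW ra (rationalN rc)); rewrite cE qE rvN.
Qed.

(** Norms are compared along the chain of nonorthogonal roots from [halfroot_length]; the ratio 1 or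
    2 gives the witnesses. *)
Lemma twist_short_root j : halfroot Phi (rv (al j)) -> short_root br tw (al j).
Proof.
move=> hj; have ji := halfroot_indivisible RS hj; have /andP[jP _] := hj.
have j0 : root0 (al j) by apply/root0P.
split=> // a a0; have /root0P[ra aP ai] := a0.
have [len [c [cP ci bc ca]]] := halfroot_length RS hj aP ai.
have [t t0 tE] := root0_al cP ci; rewrite -tE in bc ca.
have E1 := dform_dot j0 t0 bc; have E2 := dform_dot t0 a0 ca.
have nz (x : 'rV[rat]_N) : x \in Phi -> io (dot x x) != 0.
  by move=> xP; rewrite fmorph_eq0 dot_eq0 (root_neq0 RS).
have E : io (dot (rv a) (rv a)) * dform br tw (al j) (al j) =
    io (dot (rv (al j)) (rv (al j))) * dform br tw a a.
  have tn := nz _ cP; rewrite -tE in tn; apply: (mulfI tn).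
  by rewrite mulrCA E1 mulrCA E2 mulrCA.
have jn := nz _ jP; case: len => len; rewrite len in E.
  by exists 1, 1; split=> //; rewrite !mul1r; apply: (mulfI jn); rewrite E.
exists 2, 1; split=> //; rewrite mul1r; apply: (mulfI jn); rewrite -E rmorphM rmorph_nat; ring.
Qed.

(** A divisible weight is twice a half-root; half-roots force type B and are the short roots
    there. *)
Lemma twist_in_en (a : hdual h) x : wvec br a x -> x != 0 -> a = 0 \/ in_en br tw a.
Proof.
move=> xW x0; have [->|a0] := eqVneq a 0; first by left.
right; have [aP ra] := weight_Phi io lieP simpleP autP sigmaC cartanP zP mP bb bG bW xW x0 a0.
have [ai|ai] := classic (indivisible Phi (rv a)); first by left; apply/root0P.
right; have [c cP [ci aE]] := divisible_half RS aP ai.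
have [j j0 jE] := root0_al cP ci.
have hj : halfroot Phi (rv (al j)) by rewrite /halfroot jE cP -aE.
split; first exact: twist_typeB hj.
exists (al j); split; first exact: twist_short_root.
apply: (rv_inj bb bW ra).
  by rewrite mulr2n; apply: rationalD.
by rewrite mulr2n rvD // jE aE scaler_nat mulr2n.
Qed.

Hypothesis genP : forall P : 'rV[int]_n -> Prop, (forall x y, P x -> P y -> P (x - y)) ->
  (forall j, P (xx j)) -> (forall z : 'rV[int]_n, (forall i, (d i %| z ord0 i)%Z) -> P z) ->
  forall y, P y.

Theorem twist_lie_torus : lie_torus br tw d h zeta.
Proof.
split.
- exact: twist_is_order.
- exact: twist_simple_gsig.
- move=> lam _ _.
  have [U [V [UV UV0 U0 Vsub VP]]] :=
    graded_module_decomposition graded_twist sum_comp_twist BP twist_simple lam.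
  rewrite (geig0 tw zeta d) in U0 Vsub VP; exists U, V; split=> //.
  case: VP => [->|[dV irr]]; [by left | right; split=> //].
  by move=> a v _ v0 vW; apply: twist_in_en vW v0.
exact: twist_group_order.
Qed.

End TwistedTorus.

(** Multiplication by [C] is injective and yC = yC'A = yC'A'C, so y = (yC')A' is an integral
    combination of the rows of [A']. *)
Lemma adapted_generation n r (A A' : 'M[int]_(r, n)) (C' : 'M[int]_(n, r)) (C : 'M[int]_n)
    (P : 'rV[int]_n -> Prop) :
  A = A' *m C -> C = C' *m A -> (forall y : 'rV[int]_n, y *m C = 0 -> y = 0) ->
  (forall x y, P x -> P y -> P (x - y)) -> P 0 -> (forall i, P (row i A')) -> forall y, P y.
Proof.
move=> AE CE Ci PB P0 PA y.
have yE : y = y *m C' *m A'.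
  apply/eqP; rewrite eq_sym -subr_eq0; apply/eqP/Ci.
  by rewrite mulmxBl -!mulmxA -AE -CE subrr.
apply: (in_gen_ind P0 (S := P)) => //.
apply/in_genP; exists [seq (row i A', (y *m C') 0 i) | i <- enum 'I_r]; split.
  by move=> _ /mapP[i _ ->]; apply: PA.
rewrite big_map big_enum {1}yE mulmx_sum_row; apply: eq_bigr => i _ /=.
by rewrite -[in LHS](intz ((y *m C') 0 i)) scaler_int.
Qed.

Theorem ex_torus (k : closedFieldType) (zeta : nat -> k) (n : nat)
    (g : vectType k) (br : g -> g -> g) (sigma : 'I_n -> 'End(g))
    (m : 'I_n -> nat) (h : {vspace g}) :
  [pchar k] =i pred0 -> zeta_ok zeta -> multiloop_data br sigma m h -> gsig sigma != 0%VS ->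
  exists (sigma' : 'I_n -> 'End(g)) (m' : 'I_n -> nat),
     [/\ multiloop_data br sigma' m' h,
         lie_torus br sigma' m' h zeta &
         support_iso zeta br sigma m h br sigma' m' h].
Proof.
move=> char0 [zprim _] [lieP [simpleP [autP [sigmaC [mm cartanP]]]]] S0.
have [io _] := ex_rat_morph char0.
have zP i : (m i).-primitive_root (zeta (m i)) := zprim _ (mm i).1.
have mP i x : iter (m i) (sigma i) x = x := (mm i).2 x.
have h0 := cartan_zero_centralizer lieP cartanP S0.
have sigma_diag i : diagop (sigma i) := finite_order_diagop (zP i) (mP i).
have hab := cartan_abelian io lieP simpleP autP sigmaC sigma_diag cartanP.
have [b [bb bP]] := ex_basis (hom_span io lieP simpleP autP sigmaC cartanP zP mP).
pose al j := projT1 (constructive_indefinite_description _ (bP j)).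
have alP j : exists l, tnth b j \in geig sigma m zeta l /\ wvec br (al j) (tnth b j).
  exact: projT2 (constructive_indefinite_description _ (bP j)).
pose de j := projT1 (constructive_indefinite_description _ (alP j)).
have [bG bW] : (forall j, tnth b j \in geig sigma m zeta (de j)) /\ (forall j, wvec br (al j) (tnth b j)).
  by split=> j; have [] := projT2 (constructive_indefinite_description _ (alP j)).
have [tau [phi GR]] := ex_graded io lieP simpleP autP sigmaC cartanP zP mP bb bG bW.
have RS := gr_roots GR.
(* If all weights vanished, the nonzero [h] would be central in [g]. *)
have Phi_n0 : exists a, a \in Phi io lieP simpleP autP sigmaC cartanP zP mP al.
  apply: NNPP => no; case/negP: h0; rewrite -subv0; apply/subvP => y yh; rewrite memv0.
  apply/eqP; apply: (simple_center lieP simpleP) => x; rewrite (basis_coordE x bb) br_sumr // big1 // => j _.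
  have [j0|j0] := eqVneq (al j) 0.
    by rewrite (brZr lieP) (wvecE (bW j) yh) j0 /hev zero_lfunE scale0r scaler0.
  by case: no; exists (rv io lieP simpleP autP sigmaC cartanP zP mP al (al j)); apply/PhiP; exists j.
have [l0 [p [cf BP]]] := ex_base RS.
have sE i := gr_root GR (base_root BP i).
pose s i := projT1 (constructive_indefinite_description _ (sE i)).
have sP i : exists2 e, e \in Gr io lieP simpleP autP sigmaC cartanP zP mP al (p i) (s i) & e != 0.
  by have [e []] := projT2 (constructive_indefinite_description _ (sE i)); exists e.
pose sh := shw io lieP simpleP autP sigmaC cartanP zP mP al cf s.
pose A0 : 'M[int]_(_, n) := \matrix_(j < \dim {:g}) (de j - sh (al j)).
pose M : 'M[int]_n := \matrix_(i, j) ((m i)%:Z *+ (i == j)).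
(* Stacking the diagonal matrix of the m_i under the shifted degrees puts the vectors m_i e_i into
   the lattice; [B] selects these last n rows. *)
pose A := col_mx A0 M; pose B : 'M[int]_(n, \dim {:g} + n) := row_mx 0 1%:M.
have MB : M = B *m A by rewrite mul_row_col mul0mx add0r mul1mx.
have [C [d [A' [C' [d0 AE CE CP Ci]]]]] := adapted_basis (fun i => (mm i).1) MB.
have zdP i : (d i).-primitive_root (zeta (d i)) := zprim _ (d0 i).
pose xx j := row (lshift n j) A'.
have xxP j : de j - sh (al j) = xx j *m C by rewrite -row_mul -AE rowKu rowK.
have genP (P : 'rV[int]_n -> Prop) : (forall x y, P x -> P y -> P (x - y)) -> (forall j, P (xx j)) ->
    (forall z : 'rV[int]_n, (forall i, (d i %| z ord0 i)%Z) -> P z) -> forall y, P y.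
  move=> PB Px Pz; apply: (adapted_generation AE CE Ci PB).
    by apply: Pz => i; rewrite mxE dvdz0.
  move=> i; case: (split_ordP i) => [j ->|j ->]; first exact: Px.
  apply: Pz; apply/CP => t; rewrite -row_mul -AE rowKd !mxE.
  by have [->|_] := eqVneq j t; rewrite ?mulr1n ?dvdzz ?mulr0n ?dvdz0.
have C_lattice (t : 'rV[int]_n) : (forall i, (m i %| t ord0 i)%Z) -> exists y, t = y *m C.
  move=> mt; exists ((\row_i (t ord0 i %/ m i)%Z) *m (B *m A')); rewrite -!mulmxA -AE -MB.
  apply/rowP=> i; rewrite mxE (bigD1 i) //= !mxE eqxx mulr1n divzK // big1 ?addr0 // => j ji.
  by rewrite !mxE (negPf ji) mulr0n mulr0.
have RWal := lattice_al bb bG bW BP.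
pose lw (a : hdual h) := lattice_weight io lieP simpleP autP sigmaC cartanP zP mP al cf a.
have RW0 : lw 0 by apply: lattice0 BP.
have RWB a c : lw a -> lw c -> lw (a - c) by exact: (latticeB BP).
have shB a c : lw a -> lw c -> sh (a - c) = sh a - sh c by exact: (shwB BP s).
exists (twist zeta d b xx), d; split.
- exact: (twist_data lieP simpleP autP cartanP hab zP zdP bb bG bW RWal RW0 RWB shB xxP CP).
- apply: (twist_lie_torus bb bG bW GR BP sP zdP xxP CP Phi_n0 _ genP).
  exact: (h_gsig_twist lieP cartanP hab zP zdP bb bG bW RW0 shB xxP CP).
exact: (twist_support_iso lieP zP zdP bb bG bW RWal RW0 RWB shB xxP CP Ci C_lattice).
Qed.

Theorem theorem5p1p4 (k : closedFieldType) (zeta : nat -> k) (n : nat)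
    (g : vectType k) (br : g -> g -> g) (sigma : 'I_n -> 'End(g))
    (m : 'I_n -> nat) (h : {vspace g}) :
  [pchar k] =i pred0 -> zeta_ok zeta ->
  multiloop_data br sigma m h ->
  (exists (g' : vectType k) (br' : g' -> g' -> g') (sigma' : 'I_n -> 'End(g'))
          (m' : 'I_n -> nat) (h' : {vspace g'}),
     [/\ multiloop_data br' sigma' m' h',
         lie_torus br' sigma' m' h' zeta &
         support_iso zeta br sigma m h br' sigma' m' h'])
  <-> gsig sigma != 0%VS.
Proof.
move=> char0 zok data; split=> [[g' [br' [sigma' [m' [h' [data' torus iso]]]]]]|S0].
  exact: torus_gsig_neq0 data' torus iso.
have [sigma' [m' [data' torus iso]]] := ex_torus char0 zok data S0.
by exists g, br, sigma', m', h.
Qed.
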